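(* Let $B=(B_s)_{s\ge 0}$ be a standard Brownian motion and, for $\delta>0$, define \[ F(\delta)=\mathbb{P}\Big(\sup_{t\ge 0}\Big|\int_0^1 e^{-st}\,dB_s\Big|\le \delta\Big). \] Then for $\delta\in(0,1/4)$, \[ \log F(\delta)=-\frac{2}{3\pi^2}\log^3(1/\delta)+O\Big(\log^{5/2}(1/\delta)\sqrt{\log\log(1/\delta)}\Big), \] where the implied constant is absolute.
   Context: The process $t\mapsto \int_0^1 e^{-st}\,dB_s$ (Wiener integrals), $t\ge 0$, is taken in its version with continuous sample paths. All logarithms are natural, and $\log^{a} x=(\log x)^{a}$. *)

(* Defs.v *)
From HB Require Import structures.
From mathcomp Require Export all_boot all_order all_algebra.
From mathcomp Require Export all_classical all_reals all_analysis.
Export Order.TTheory GRing.Theory Num.Theory.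
Export numFieldNormedType.Exports.

Set Implicit Arguments.
Unset Strict Implicit.
Unset Printing Implicit Defensive.

Local Open Scope classical_set_scope.
Local Open Scope ring_scope.

(* The whole finite family is tested at once: taking some [A i] equal to [setT]
   gives the product rule for every subfamily. *)
Definition mutually_independent (d : measure_display) (T : measurableType d)
    (R : realType) (P : probability T R) (n : nat) (Y : 'I_n -> T -> R) : Prop :=
  forall A : 'I_n -> set R, (forall i, measurable (A i)) ->
    P (\bigcap_(i in [set: 'I_n]) (Y i @^-1` A i)) =
    (\prod_(i < n) P (Y i @^-1` A i))%E.

(* The index set is [R], but only nonnegative times are constrained.  The
   second parameter of [normal_prob] is the standard deviation. *)
Record standard_brownian_motion (d : measure_display) (T : measurableType d)
    (R : realType) (P : probability T R) (B : R -> {RV P >-> R}) : Prop := {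
  brownian_start : {ae P, forall w, B 0 w = 0} ;
  brownian_indep : forall (n : nat) (t : nat -> R),
    0 <= t 0%N -> (forall i, t i <= t i.+1) ->
    mutually_independent P
      (fun (i : 'I_n) (w : T) => B (t i.+1) w - B (t i) w) ;
  brownian_gauss : forall s t : R, 0 <= s -> s < t ->
    forall A : set R, measurable A ->
      P ((fun w : T => B t w - B s w) @^-1` A) =
      normal_prob 0 (Num.sqrt (t - s)) A ;
  brownian_path : {ae P, forall w, {within `[0, +oo[, continuous (fun t : R => B t w)}} }.

(* Step functions on [0, 1], with value [step_coef i] on
   ]step_node i, step_node i.+1]. *)
Record step_fun (R : realType) := StepFun {
  step_size : nat ;
  step_node : nat -> R ;
  step_coef : nat -> R ;
  step_node_first : step_node 0%N = 0 ;
  step_node_last : step_node step_size = 1 ;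
  step_node_le : forall i, (i < step_size)%N -> step_node i <= step_node i.+1 }.

Definition step_eval (R : realType) (phi : step_fun R) (s : R) : R :=
  \sum_(i < step_size phi)
    step_coef phi i * \1_(`]step_node phi i, step_node phi i.+1]) s.

Definition step_integral (T : Type) (R : realType) (B : R -> T -> R)
    (phi : step_fun R) (w : T) : R :=
  \sum_(i < step_size phi)
    step_coef phi i * (B (step_node phi i.+1) w - B (step_node phi i) w).

(* [X] is (a version of) the Wiener integral of [f] over [0, 1] against [B]: the
   L^2(P)-limit of the integrals of step functions converging to [f] in
   L^2([0, 1]).  By the Ito isometry the limit does not depend on the
   approximating sequence, up to almost sure equality. *)
Definition is_wiener_integral (d : measure_display) (T : measurableType d)
    (R : realType) (P : probability T R) (B : R -> {RV P >-> R})
    (f : R -> R) (X : {RV P >-> R}) : Prop :=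
  exists phi : nat -> step_fun R,
    (\int[lebesgue_measure]_(s in `[0%R, 1%R])
        ((step_eval (phi n) s - f s) ^+ 2)%:E @[n --> \oo] --> (0 : \bar R))%E /\
    (\int[P]_w ((step_integral B (phi n) w - X w) ^+ 2)%:E @[n --> \oo] --> (0 : \bar R))%E.

(* The continuous version of the process t |-> int_0^1 e^(-st) dB_s, t >= 0. *)
Definition continuous_laplace_process (d : measure_display)
    (T : measurableType d) (R : realType) (P : probability T R)
    (B X : R -> {RV P >-> R}) : Prop :=
  (forall t : R, 0 <= t ->
     is_wiener_integral B (fun s => expR (- (s * t))) (X t)) /\
  (forall w : T, {within `[0, +oo[, continuous (fun t : R => X t w)}).

(* The supremum is taken in the extended reals, so unbounded paths are
   outside the event. *)
Definition small_ball_prob (d : measure_display) (T : measurableType d)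
    (R : realType) (P : probability T R) (X : R -> {RV P >-> R})
    (delta : R) : \bar R :=
  P [set w | (ereal_sup [set `|X t w|%:E | t in `[0%R, +oo[] <= delta%:E)%E].

(* Main.v *)
(* The variables X t are the Laplace field of the exponentials e^(- t s) in
   L^2(0, 1).  Its small balls are controlled through finite families of nodes
   t = e^y: a family of nodes costs the product of the successive distances of
   the exponentials, and on (0, +oo) these distances are the Blaschke products
   given by Cauchy determinants, prod |tanh ((y - y_i) / 2)|.  The sum of
   - log tanh (x / 2) = 2 sum_k e^(- (2k+1) x) / (2k+1) over a progression of
   small step h is close to pi^2 / (4h) on each side of a node, by the Basel sum
   over odd integers.  For the upper bound we tilt the field by the square norm
   over a mesh of nodes whose step is adapted to the size remaining at y.  For
   the lower bound, with r close to sqrt (L log L) and L = log (1 / delta), we add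
   groups of nodes of step pi^2 / (2r), the g-th on 0 <= y <= 2rg; each group
   divides all distances by e^r, and shrinking the resulting orthonormal
   coordinates costs sum_g (4 r^2 g / pi^2) (L - r g)^+ = 2 L^3 / (3 pi^2) + error. *)

Require Import Defs.
From mathcomp Require Import measurable_realfun.
From mathcomp Require Import ring lra zify.
Set Implicit Arguments.
Unset Strict Implicit.
Unset Printing Implicit Defensive.
Local Open Scope classical_set_scope.
Local Open Scope ring_scope.

(** * Expectations of bounded functions *)

(** No Gaussian density, determinant or correlation inequality enters. The only input on the joint
    law is that [cos (W v)] has mean [exp (- q v v / 2)]. Multiplying by [exp (- s (W u)^2 / 2)]
    preserves this shape, with a rank one change of [q] and an explicit total mass. The upper bound
    compares an indicator with such a weight; the lower bound shows that at least half of the mass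
    of such a weight sits on the event. Blaschke products give distances on (0, +oo), while the
    integrals live on (0, 1). In the upper bound the discrepancy is absorbed by the penalty
    [delta^2 sum c_j^2] created by the tilt itself, once all nodes are at least [2 L]; this costs
    [L^2 log L]. The square root in the error comes from the lower bound alone. A group of gain
    about [r] loses O(log r) of it, through a harmonic sum in the series and through the number of
    nodes in Chebyshev's inequality: an error [L^3 log L / r]. Working by whole groups costs
    [r L^2]. The choice [r = sqrt (L log L)] balances the two. *)

Definition bounded_measurable (d : measure_display) (T : measurableType d)
    (R : realType) (f : T -> R) : Prop :=
  measurable_fun setT f /\ exists M, forall x, `|f x| <= M.

Section bounded_expectation.
Context (d : measure_display) (T : measurableType d) (R : realType).
Implicit Types (f g : T -> R) (P : probability T R).

Lemma bm_cst (c : R) : bounded_measurable (fun _ : T => c).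
Proof. by split; [exact: measurable_cst | exists `|c|]. Qed.

Lemma bmD f g : bounded_measurable f -> bounded_measurable g ->
  bounded_measurable (fun x => f x + g x).
Proof.
move=> [mf [M hM]] [mg [N hN]]; split; first exact: measurable_funD.
by exists (M + N) => x; rewrite (le_trans (ler_normD _ _))// lerD.
Qed.

Lemma bmM f g : bounded_measurable f -> bounded_measurable g ->
  bounded_measurable (fun x => f x * g x).
Proof.
move=> [mf [M hM]] [mg [N hN]]; split; first exact: measurable_funM.
by exists (M * N) => x; rewrite normrM ler_pM.
Qed.

Lemma bmN f : bounded_measurable f -> bounded_measurable (fun x => - f x).
Proof.
move=> [mf [M hM]]; split; first exact: measurable_funN.
by exists M => x; rewrite normrN.
Qed.

Lemma bmB f g : bounded_measurable f -> bounded_measurable g ->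
  bounded_measurable (fun x => f x - g x).
Proof. by move=> bf bg; apply: bmD => //; exact: bmN. Qed.

Lemma bm_norm f : bounded_measurable f -> bounded_measurable (fun x => `|f x|).
Proof.
move=> [mf [M hM]]; split; first exact: measurableT_comp.
by exists M => x; rewrite normr_id.
Qed.

Lemma bm_indic (A : set T) : measurable A ->
  bounded_measurable (\1_A : T -> R).
Proof.
move=> mA; split; first exact: measurable_indic.
by exists 1 => x; rewrite indicE; case: (_ \in _); rewrite ?normr1 ?normr0.
Qed.

Lemma bm_sum (I : Type) (s : seq I) (p : pred I) (F : I -> T -> R) :
  (forall i, bounded_measurable (F i)) ->
  bounded_measurable (fun x => \sum_(i <- s | p i) F i x).
Proof.
move=> bF; elim: s => [|i s IH].
  by under eq_fun do rewrite big_nil; exact: bm_cst.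
under eq_fun do rewrite big_cons.
by case: (p i) => //; exact: bmD.
Qed.

Lemma bm_prod (I : Type) (s : seq I) (p : pred I) (F : I -> T -> R) :
  (forall i, bounded_measurable (F i)) ->
  bounded_measurable (fun x => \prod_(i <- s | p i) F i x).
Proof.
move=> bF; elim: s => [|i s IH].
  by under eq_fun do rewrite big_nil; exact: bm_cst.
under eq_fun do rewrite big_cons.
by case: (p i) => //; exact: bmM.
Qed.

Lemma bm_cos f : measurable_fun setT f -> bounded_measurable (fun x => cos (f x)).
Proof.
move=> mf; split; last by exists 1 => x; exact: cos_max.
apply: measurableT_comp => //; apply: continuous_measurable_fun.
exact: continuous_cos.
Qed.

Lemma bm_sin f : measurable_fun setT f -> bounded_measurable (fun x => sin (f x)).
Proof.
move=> mf; split; last by exists 1 => x; exact: sin_max.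
apply: measurableT_comp => //; apply: continuous_measurable_fun.
exact: continuous_sin.
Qed.

Lemma bm_exp f : measurable_fun setT f -> (forall x, f x <= 0) ->
  bounded_measurable (fun x => expR (f x)).
Proof.
move=> mf f0; split; first exact: measurableT_comp.
by exists 1 => x; rewrite ger0_norm ?expR_ge0// -expR0 ler_expR.
Qed.

Definition Ex P f : R := \int[P]_x f x.

Lemma bm_integrable P f : bounded_measurable f ->
  P.-integrable setT (EFin \o f).
Proof.
move=> [mf [M hM]]; apply: measurable_bounded_integrable => //.
  by rewrite [X in (X < _)%E]probability_setT ltry.
exists M; split; first exact: num_real.
by move=> y My x _; apply: le_trans (hM x) _; exact: ltW.
Qed.

Lemma ExE P f : bounded_measurable f -> (\int[P]_x (f x)%:E)%E = (Ex P f)%:E.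
Proof.
by move=> bf; rewrite /Ex /Rintegral fineK// integrable_fin_num//;
  exact: bm_integrable.
Qed.

Lemma ExD P f g : bounded_measurable f -> bounded_measurable g ->
  Ex P (fun x => f x + g x) = Ex P f + Ex P g.
Proof. by move=> bf bg; rewrite /Ex RintegralD//; exact: bm_integrable. Qed.

Lemma ExZ P c f : bounded_measurable f -> Ex P (fun x => c * f x) = c * Ex P f.
Proof. by move=> bf; rewrite /Ex RintegralZl//; exact: bm_integrable. Qed.

Lemma ExN P f : bounded_measurable f -> Ex P (fun x => - f x) = - Ex P f.
Proof.
move=> bf; rewrite -mulN1r -ExZ//.
by congr (Ex P); apply/funext => x; rewrite mulN1r.
Qed.

Lemma ExB P f g : bounded_measurable f -> bounded_measurable g ->
  Ex P (fun x => f x - g x) = Ex P f - Ex P g.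
Proof. by move=> bf bg; rewrite ExD ?ExN//; exact: bmN. Qed.

Lemma Ex_cst P c : Ex P (fun=> c) = c.
Proof. by rewrite /Ex Rintegral_cst// [X in fine X]probability_setT mulr1. Qed.

Lemma le_Ex P f g : bounded_measurable f -> bounded_measurable g ->
  (forall x, f x <= g x) -> Ex P f <= Ex P g.
Proof. by move=> bf bg fg; apply: le_Rintegral => //; exact: bm_integrable. Qed.

Lemma norm_Ex P f : bounded_measurable f -> `|Ex P f| <= Ex P (fun x => `|f x|).
Proof. by move=> bf; apply: le_normr_Rintegral => //; exact: bm_integrable. Qed.

Lemma norm_Ex_le P f M : bounded_measurable f -> (forall x, `|f x| <= M) ->
  `|Ex P f| <= M.
Proof.
move=> bf hM; rewrite (le_trans (norm_Ex P bf))// -[leRHS](Ex_cst P).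
by apply: le_Ex => //; [exact: bm_norm|exact: bm_cst].
Qed.

Lemma Ex_sum P (I : Type) (s : seq I) (p : pred I) (F : I -> T -> R) :
  (forall i, bounded_measurable (F i)) ->
  Ex P (fun x => \sum_(i <- s | p i) F i x) = \sum_(i <- s | p i) Ex P (F i).
Proof.
move=> bF; elim: s => [|i s IH].
  by rewrite big_nil; under eq_fun do rewrite big_nil; rewrite Ex_cst.
rewrite big_cons; under eq_fun do rewrite big_cons.
by case: (p i) => //; rewrite ExD ?IH//; exact: bm_sum.
Qed.

Lemma Ex_indic P (A : set T) : measurable A -> Ex P \1_A = fine (P A).
Proof.
by move=> mA; rewrite /Ex /Rintegral integral_indic// setIT.
Qed.

End bounded_expectation.

Lemma bm_comp (d d' : measure_display) (T : measurableType d)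
  (T' : measurableType d') (R : realType) (f : T' -> R) (Y : T -> T') :
  bounded_measurable f -> measurable_fun setT Y ->
  bounded_measurable (fun x => f (Y x)).
Proof.
move=> [mf [M hM]] mY; split; first exact: measurableT_comp.
by exists M => x.
Qed.

Section staircase.
Context (R : realType).

(** Applied to a bounded function, this makes it uniformly close to a combination of indicators of
    superlevel sets, so identities known for indicators pass to bounded functions. *)
Lemma staircase_approx (eps y : R) n : 0 < eps -> 0 <= y <= n%:R * eps ->
  `|y - eps * \sum_(j < n) (j.+1%:R * eps <= y)%R%:R| <= eps.
Proof.
move=> e0; elim: n => [|n IH] /andP[y0 yn].
  have -> : y = 0 by apply/le_anti; rewrite y0 andbT; move: yn; rewrite mul0r.
  by rewrite big_ord0 mulr0 subr0 normr0 ltW.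
rewrite big_ord_recr/=; have [yne|yne] := leP y (n%:R * eps).
  rewrite [(n.+1%:R * eps <= y)%R](_ : _ = false) ?addr0.
    by apply: IH; rewrite y0.
  apply/negbTE; rewrite -ltNge (le_lt_trans yne)// ltr_pM2r// ltr_nat//.
rewrite (eq_bigr (fun=> 1)); last first.
  move=> i _; rewrite (_ : (_ <= y) = true)//; apply: le_trans (ltW yne).
  by rewrite ler_pM2r// ler_nat.
rewrite sumr_const card_ord; move: yn yne.
rewrite -[n.+1%:R]natr1 mulrDl mul1r => yn yne.
rewrite mulrDr (mulrC eps n%:R) ler_norml.
have [h|h] := leP (n%:R * eps + eps) y; rewrite ?mulr1 ?mulr0.
  by apply/andP; split; lra.
by apply/andP; split; lra.
Qed.

End staircase.

(** * Products and cosines of independent variables *)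

Section independence.
Context (d : measure_display) (T : measurableType d) (R : realType).
Variable P : probability T R.

Lemma indicator_factor_ext (h Y : T -> R) (c : R) :
  bounded_measurable h -> measurable_fun setT Y ->
  (forall A : set R, measurable A ->
     Ex P (fun w => h w * \1_A (Y w)) = c * Ex P (fun w => \1_A (Y w))) ->
  forall f : R -> R, bounded_measurable f ->
    Ex P (fun w => h w * f (Y w)) = c * Ex P (fun w => f (Y w)).
Proof.
move=> bh mY hA f bf; have [mf [M hM]] := bf; have [mh [H hH]] := bh.
have bfY : bounded_measurable (fun w => f (Y w)) by exact: bm_comp.
apply/eqP; rewrite -subr_eq0 -normr_le0; apply/ler_addgt0Pl => e e0; rewrite addr0.
have H0 : 0 <= H by rewrite (le_trans _ (hH point)).
have M0 : 0 <= M by rewrite (le_trans _ (hM point)).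
(* Replacing [f] by a staircase within [eps] moves the left side by at most [H * eps] and the right
   side by at most [|c| * eps]. *)
pose eps := e / (H + `|c| + 1).
have K0 : 0 < H + `|c| + 1 by rewrite ltr_wpDl// addr_ge0.
have eps0 : 0 < eps by rewrite divr_gt0.
pose n := (Num.truncn (2 * M / eps)).+1.
have nE : 2 * M <= n%:R * eps.
  by rewrite -ler_pdivrMr// ltW// truncnS_gt.
pose A j := [set x | j.+1%:R * eps <= f x + M].
have mA j : measurable (A j).
  rewrite (_ : A j = (fun x => f x + M) @^-1` `[j.+1%:R * eps, +oo[).
    rewrite -[_ @^-1` _]setTI; apply: (measurable_funD mf (measurable_cst _)) => //.
  by apply/seteqP; split => x /=; rewrite in_itv/= andbT.
pose g x := - M + eps * \sum_(j < n) (\1_(A j) x : R).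
have bg : bounded_measurable g.
  apply: bmD; first exact: bm_cst.
  apply: bmM; first exact: bm_cst.
  by apply: bm_sum => j; exact: bm_indic.
have bgY : bounded_measurable (fun w => g (Y w)) by exact: bm_comp.
have fg x : `|f x - g x| <= eps.
  have -> : f x - g x = (f x + M) - eps * \sum_(j < n) (j.+1%:R * eps <= f x + M)%R%:R.
    rewrite /g opprD opprK addrA; congr (_ - eps * _); apply: eq_bigr => j _.
    by rewrite indicE; congr (nat_of_bool _)%:R; apply/idP/idP; rewrite inE.
  apply: staircase_approx => //; move: (hM x); rewrite ler_norml; lra.
have mAY j : bounded_measurable (fun w => \1_(A j) (Y w) : R).
  by apply: (@bm_comp _ _ _ _ _ (\1_(A j))) => //; exact: bm_indic.
have hg : Ex P (fun w => h w * g (Y w)) = c * Ex P (fun w => g (Y w)).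
  rewrite ExD; [|exact: bm_cst|]; last first.
    by apply: bmM; [exact: bm_cst|apply: bm_sum].
  rewrite ExZ ?Ex_cst; last exact: bm_sum.
  rewrite Ex_sum// mulrDr mulrCA.
  have -> : c * \sum_(j < n) Ex P (fun w => \1_(A j) (Y w)) =
     \sum_(j < n) Ex P (fun w => h w * \1_(A j) (Y w)).
    by rewrite mulr_sumr; apply: eq_bigr => j _; rewrite hA.
  rewrite -Ex_sum; last by move=> j; apply: bmM.
  rewrite -ExZ; last by apply: bm_sum => j; apply: bmM.
  have -> : c * - M = Ex P (fun w => h w * - M).
    have := hA setT measurableT.
    rewrite (_ : (fun w => h w * \1_setT (Y w)) = h); last first.
      by apply/funext => w; rewrite indicT mulr1.
    rewrite (_ : (fun w => \1_setT (Y w)) = (fun=> 1)); last first.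
      by apply/funext => w; rewrite indicT.
    rewrite Ex_cst mulr1 => <-; rewrite mulrC -ExZ//.
    by congr Ex; apply/funext => w; rewrite mulrC.
  rewrite -ExD; last 2 first.
  - by apply: bmM => //; exact: bm_cst.
  - by apply: bmM; [exact: bm_cst|apply: bm_sum => j; apply: bmM].
  congr Ex; apply/funext => w; rewrite /g mulrDr; congr (_ + _).
  by rewrite mulrCA mulr_sumr.
have -> : Ex P (fun w => h w * f (Y w)) - c * Ex P (fun w => f (Y w)) =
   Ex P (fun w => h w * (f (Y w) - g (Y w))) - c * Ex P (fun w => f (Y w) - g (Y w)).
  have -> : (fun w => h w * (f (Y w) - g (Y w))) =
            (fun w => h w * f (Y w) - h w * g (Y w)).
    by apply/funext => w; rewrite mulrBr.
  by rewrite !ExB//; [rewrite hg; ring|exact: bmM|exact: bmM].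
have b1 : `|Ex P (fun w => h w * (f (Y w) - g (Y w)))| <= H * eps.
  apply: norm_Ex_le; first by apply: bmM => //; exact: bmB.
  by move=> w; rewrite normrM ler_pM.
have b2 : `|Ex P (fun w => f (Y w) - g (Y w))| <= eps.
  by apply: norm_Ex_le => //; exact: bmB.
rewrite (le_trans (ler_normB _ _))// normrM.
have -> : e = (H + `|c| + 1) * eps by rewrite /eps mulrC divfK// gt_eqF.
rewrite -addrA mulrDl lerD// (le_trans (ler_wpM2l _ b2))//.
by rewrite ler_pM2r// lerDl.
Qed.

End independence.

Section independence_products.
Context (d : measure_display) (T : measurableType d) (R : realType).
Variable P : probability T R.

Lemma mutually_independent_Ex_prod n (Y : 'I_n -> T -> R) (f : 'I_n -> R -> R) :
  (forall i, measurable_fun setT (Y i)) -> mutually_independent P Y ->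
  (forall i, bounded_measurable (f i)) ->
  Ex P (fun w => \prod_i f i (Y i w)) = \prod_i Ex P (fun w => f i (Y i w)).
Proof.
move=> mY iY bf.
(* Induction on the number of coordinates carrying arbitrary bounded functions, the coordinates from
   [k] on carrying indicators. The case 0 is independence, and [indicator_factor_ext] frees one more
   coordinate. *)
have claim : forall k, forall f : 'I_n -> R -> R, (forall i, bounded_measurable (f i)) ->
    (forall i : 'I_n, (k <= i)%N -> exists A, measurable A /\ f i = \1_A) ->
    Ex P (fun w => \prod_i f i (Y i w)) = \prod_i Ex P (fun w => f i (Y i w)).
  elim=> [|k IH] {}f {}bf hf.
    have /choice[A hA] : forall i, exists A, measurable A /\ f i = \1_A.
      by move=> i; exact: hf.
    have mA i : measurable (A i) by have [] := hA i.
    have mYA i : measurable (Y i @^-1` A i) by rewrite -[_ @^-1` _]setTI; exact: mY.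
    have fE i w : f i (Y i w) = \1_(Y i @^-1` A i) w.
      by have [_ ->] := hA i; rewrite !indicE; congr (nat_of_bool _)%:R;
        apply/idP/idP; rewrite !inE.
    have -> : (fun w => \prod_i f i (Y i w)) =
        \1_(\bigcap_(i in [set: 'I_n]) (Y i @^-1` A i)).
      apply/funext => w; under eq_bigr do rewrite fE.
      rewrite [RHS]indicE; have [h|h] := boolP (w \in _).
        rewrite big1// => i _; rewrite indicE mem_set//.
        by move: h; rewrite inE; apply.
      have [i hi] : exists i, ~ (Y i @^-1` A i) w.
        apply: contrapT => /forallNP h'; move/negP: h; apply; rewrite inE => i _.
        by apply: contrapT; exact: h'.
      by rewrite (bigD1 i)//= indicE memNset// mul0r.
    rewrite Ex_indic; last by apply: fin_bigcap_measurable => // i _; exact: mYA.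
    rewrite iY//; under [RHS]eq_bigr do under eq_fun do rewrite fE.
    under [RHS]eq_bigr do rewrite Ex_indic//.
    rewrite [X in fine X](_ : _ = (\prod_(i < n) fine (P (Y i @^-1` A i)))%:E)//.
    elim/big_rec2 : _ => // i x y _ ->; rewrite EFinM; congr (_ * _)%E.
    by rewrite fineK// fin_num_measure.
  have [kn|nk] := ltnP k n; last first.
    by apply: IH => // i ki; have := ltn_ord i; rewrite ltnNge (leq_trans nk ki).
  pose i0 := Ordinal kn.
  under eq_fun do rewrite (bigD1 i0)//= mulrC.
  rewrite [RHS](bigD1 i0)//= [RHS]mulrC.
  apply: (@indicator_factor_ext _ _ _ P (fun w => \prod_(i < n | i != i0) f i (Y i w))) => //.
    by apply: bm_prod => i; apply: bm_comp.
  move=> A mA; pose f' i := if i == i0 then \1_A else f i.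
  have := IH f'; rewrite /f'.
  under eq_fun do rewrite (bigD1 i0)//= eqxx mulrC.
  rewrite (bigD1 i0)//= eqxx [X in _ = X]mulrC.
  have e1 : (fun x => \1_A (Y i0 x) * \prod_(i < n | i != i0)
      (if i == i0 then \1_A else f i) (Y i x)) =
      (fun w => \prod_(i < n | i != i0) f i (Y i w) * \1_A (Y i0 w)).
    apply/funext => w; rewrite mulrC; congr (_ * _).
    by apply: eq_bigr => i /negbTE ->.
  have -> : \prod_(i < n | i != i0) Ex P (fun w : T =>
       (if i == i0 then \1_A else f i) (Y i w)) =
     \prod_(i < n | i != i0) Ex P (fun w => f i (Y i w)).
    by apply: eq_bigr => i /negbTE ->.
  under eq_fun do under eq_bigr => i /negbTE hi do rewrite hi.
  apply.
    by move=> i; case: ifP => // _; exact: bm_indic.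
  move=> i ki; case: ifP => [_|/negbT ii0]; first by exists A.
  apply: hf; rewrite ltn_neqAle ki andbT; apply: contra ii0 => /eqP ki0.
  by apply/eqP/val_inj.
by apply: (claim n) => // i; rewrite leqNgt ltn_ord.
Qed.

(** A real substitute for the product formula of characteristic functions: with vanishing sine
    means, the sine part of the addition formula contributes nothing. *)
Lemma Ex_cos_sum n (Y : 'I_n -> T -> R) :
  (forall i, measurable_fun setT (Y i)) -> mutually_independent P Y ->
  (forall i, Ex P (fun w => sin (Y i w)) = 0) ->
  Ex P (fun w => cos (\sum_i Y i w)) = \prod_i Ex P (fun w => cos (Y i w)).
Proof.
move=> mY iY sY.
pose C j w := cos (\sum_(i < n | (i < j)%N) Y i w).
pose S j w := sin (\sum_(i < n | (i < j)%N) Y i w).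
pose F (f : 'I_n -> R -> R) j w := \prod_(i < n | ~~ (i < j)%N) f i (Y i w).
have mS j : measurable_fun setT (fun w => \sum_(i < n | (i < j)%N) Y i w).
  under eq_fun do rewrite big_mkcond/=; apply: measurable_sum => i.
  by case: (i < j)%N; [exact: mY|exact: measurable_cst].
have bC j : bounded_measurable (C j) by exact: bm_cos.
have bS j : bounded_measurable (S j) by exact: bm_sin.
have bF f j : (forall i, bounded_measurable (f i)) -> bounded_measurable (F f j).
  by move=> bf; apply: bm_prod => i; exact: bm_comp.
have bcos : bounded_measurable (cos : R -> R).
  by apply: (@bm_cos _ _ _ id); exact: measurable_id.
have bsin : bounded_measurable (sin : R -> R).
  by apply: (@bm_sin _ _ _ id); exact: measurable_id.
(* The first [j] variables are inside the cosine or sine, the others enter through arbitrary factors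
   [f i]. This generality is needed because the addition formula puts both [cos] and [sin] at place
   [j]. *)
have claim : forall j, (j <= n)%N -> forall f : 'I_n -> R -> R, (forall i, bounded_measurable (f i)) ->
   Ex P (fun w => C j w * F f j w) =
     (\prod_(i < n | (i < j)%N) Ex P (fun w => cos (Y i w))) *
     \prod_(i < n | ~~ (i < j)%N) Ex P (fun w => f i (Y i w)) /\
   Ex P (fun w => S j w * F f j w) = 0.
  elim=> [_ f bf|j IH jn f bf].
    split.
      rewrite [X in X * _]big_pred0 ?mul1r// -mutually_independent_Ex_prod//.
      congr (Ex P); apply/funext => w; rewrite /C /F [X in cos X]big_pred0// cos0 mul1r.
      exact: eq_bigl.
    rewrite -[RHS](Ex_cst P); congr (Ex P); apply/funext => w.
    by rewrite /S [X in sin X]big_pred0// sin0 mul0r.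
  pose i0 := Ordinal jn.
  have ij (i : 'I_n) : ((i < j.+1)%N && (i != i0)) = (i < j)%N.
    rewrite ltnS leq_eqVlt; have [->|ne] := eqVneq i i0.
      by rewrite eqxx ltnn.
    by rewrite andbT; case: eqVneq => // e; case/eqP: ne; exact/val_inj.
  have ji (i : 'I_n) : (~~ (i < j)%N && (i != i0)) = ~~ (i < j.+1)%N.
    by rewrite -ij negb_and negbK; case: eqVneq => [->|_]; rewrite ?ltnS ?leqnn ?andbF ?orbF ?andbT.
  have sE w : \sum_(i < n | (i < j.+1)%N) Y i w = \sum_(i < n | (i < j)%N) Y i w + Y i0 w.
    rewrite (bigD1 i0)/=; last exact: ltnSn.
    by rewrite addrC; congr (_ + _); apply: eq_bigl => i; exact: ij.
  pose g h i := if i == i0 then h else f i.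
  have bg h : bounded_measurable h -> forall i, bounded_measurable (g h i).
    by move=> bh i; rewrite /g; case: ifP.
  have FE h w : F (g h) j w = h (Y i0 w) * F f j.+1 w.
    rewrite /F (bigD1 i0)/= ?ltnn// /g eqxx; congr (_ * _).
    rewrite (eq_bigl _ _ ji); apply: eq_bigr => i.
    by rewrite -ji => /andP[_ /negbTE ->].
  have [Cc Sc] := IH (ltnW jn) _ (bg _ bcos).
  have [Cs Ss] := IH (ltnW jn) _ (bg _ bsin).
  split.
    have -> : (fun w => C j.+1 w * F f j.+1 w) =
        (fun w => C j w * F (g cos) j w - S j w * F (g sin) j w).
      apply/funext => w; rewrite !FE /C /S sE cosD; ring.
    rewrite ExB; [|apply: bmM => //; apply: bF; exact: bg..].
    rewrite Cc Ss subr0 [X in _ * X](bigD1 i0)/= ?ltnn// {1}/g eqxx mulrA.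
    congr (_ * _).
      rewrite [RHS](bigD1 i0)/=; last exact: ltnSn.
      by rewrite [RHS]mulrC; congr (_ * _); apply: eq_bigl => i; rewrite ij.
    rewrite (eq_bigl _ _ ji); apply: eq_bigr => i.
    by rewrite -ji /g => /andP[_ /negbTE ->].
  have -> : (fun w => S j.+1 w * F f j.+1 w) =
      (fun w => S j w * F (g cos) j w + C j w * F (g sin) j w).
    apply/funext => w; rewrite !FE /C /S sE sinD; ring.
  rewrite ExD; [|apply: bmM => //; apply: bF; exact: bg..].
  rewrite Sc add0r Cs [X in _ * X](bigD1 i0)/= ?ltnn// {1}/g eqxx.
  by rewrite sY mul0r mulr0.
have [+ _] := claim n (leqnn n) (fun=> cos) (fun=> bcos).
rewrite [X in _ = _ * X -> _]big_pred0 ?mulr1; last by move=> i; rewrite ltn_ord.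
have -> : \prod_(i < n) Ex P (fun w => cos (Y i w)) =
          \prod_(i < n | (i < n)%N) Ex P (fun w => cos (Y i w)).
  by apply: eq_bigl => i; rewrite ltn_ord.
move=> <-.
congr (Ex P); apply/funext => w.
rewrite /C /F [X in _ * X]big_pred0 ?mulr1; last by move=> i; rewrite ltn_ord.
by congr cos; apply: eq_bigl => i; rewrite ltn_ord.
Qed.

Lemma Ex_law (Y : T -> R) (nu : probability (measurableTypeR R) R) (f : R -> R) :
  measurable_fun setT Y -> bounded_measurable f ->
  (forall A, measurable A -> P (Y @^-1` A) = nu A) ->
  Ex P (fun w => f (Y w)) = Ex nu f.
Proof.
move=> mY bf hP; rewrite /Ex /Rintegral; congr fine.
rewrite -[RHS](@eq_measure_integral _ _ _ setT nu (pushforward P (Y : T -> measurableTypeR R))) /=; last first.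
  by move=> A mA _; rewrite -hP.
rewrite integral_pushforward//; last first.
  by apply: bm_integrable; exact: bm_comp.
by case: bf => /measurable_EFinP.
Qed.

End independence_products.

(** * Elementary inequalities for trigonometric, exponential and inverse square root functions *)

Section calculus.
Context (R : realType).
Implicit Types a b x y u v w z : R.

Lemma derive_ge0_le (f df : R -> R) a b : a <= b ->
  (forall x, a <= x <= b -> is_derive x 1 f (df x)) ->
  (forall x, a <= x <= b -> 0 <= df x) -> f a <= f b.
Proof.
move=> ab fdf df0; rewrite -subr_ge0.
have fdf' x : x \in `]a, b[%R -> is_derive x 1 f (df x).
  by rewrite in_itv/= => /andP[? ?]; apply: fdf; rewrite !ltW.
have cf : {within `[a, b], continuous f}.
  apply: derivable_within_continuous => x; rewrite in_itv/= => xab.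
  by have [] := fdf _ xab.
have [x xab ->] := MVT_segment ab fdf' cf.
by move: xab; rewrite in_itv/= => xab; rewrite mulr_ge0 ?subr_ge0// df0.
Qed.

Lemma sin_le x : 0 <= x -> sin x <= x.
Proof.
move=> x0; rewrite -subr_ge0 -[X in X <= _](_ : 0 - sin (0:R) = 0); last by rewrite sin0 subr0.
apply: (@derive_ge0_le (fun y => y - sin y) (fun y => 1 - cos y)) => // y _; rewrite subr_ge0 cos_le1.
Qed.

Lemma cos_ge x : 1 - x ^+ 2 / 2 <= cos x.
Proof.
wlog x0 : x / 0 <= x => [hw|].
  have [x0|/ltW x0] := leP 0 x; first exact: hw.
  by rewrite -sqrrN -cosN; apply: hw; rewrite oppr_ge0.
rewrite -subr_ge0 -[X in X <= _](_ : cos (0:R) - (1 - 0 ^+ 2 / 2) = 0); last first.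
  by rewrite cos0 expr0n/= mul0r subr0 subrr.
apply: (@derive_ge0_le (fun y => cos y - (1 - y ^+ 2 / 2)) (fun y => y - sin y)) => // y /andP[y0 _].
  apply: is_derive_eq; rewrite /GRing.scale/=; by field.
by rewrite subr_ge0 sin_le.
Qed.

Lemma sin_ge x : 0 <= x -> x - x ^+ 3 / 6 <= sin x.
Proof.
move=> x0; rewrite -subr_ge0 -[X in X <= _](_ : sin (0:R) - (0 - 0 ^+ 3 / 6) = 0); last first.
  by rewrite sin0 expr0n/= mul0r !subr0.
apply: (@derive_ge0_le (fun y => sin y - (y - y ^+ 3 / 6)) (fun y => cos y - (1 - y ^+ 2 / 2))) => // y _.
  apply: is_derive_eq; rewrite /GRing.scale/=; by field.
by rewrite subr_ge0 cos_ge.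
Qed.

Lemma cos_le x : cos x <= 1 - x ^+ 2 / 2 + x ^+ 4 / 24.
Proof.
wlog x0 : x / 0 <= x => [hw|].
  have [x0|/ltW x0] := leP 0 x; first exact: hw.
  have := hw (- x); rewrite cosN (_ : (- x) ^+ 4 = x ^+ 4) ?sqrrN; last by ring.
  by apply; rewrite oppr_ge0.
rewrite -subr_ge0 -[X in X <= _](_ : (1 - 0 ^+ 2 / 2 + 0 ^+ 4 / 24) - cos (0:R) = 0); last first.
  by rewrite cos0 !expr0n/= !mul0r subr0 addr0 subrr.
apply: (@derive_ge0_le (fun y => (1 - y ^+ 2 / 2 + y ^+ 4 / 24) - cos y) (fun y => sin y - (y - y ^+ 3 / 6))) => // y /andP[y0 _].
  apply: is_derive_eq; rewrite /GRing.scale/=; by field.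
by rewrite subr_ge0 sin_ge.
Qed.

Lemma expRN_le v : 0 <= v -> expR (- v) <= 1 - v + v ^+ 2.
Proof.
move=> v0; have h := expR_ge1Dx v; have e0 := expR_gt0 v.
rewrite expRN -[leLHS]mul1r ler_pdivrMr//.
have : (1 + v) * (1 - v + v ^+ 2) <= expR v * (1 - v + v ^+ 2).
  by apply: ler_wpM2r => //; nra.
nra.
Qed.

(* The Gaussian mean of the right-hand side is explicit and of order [c ^+ 4]
   for [u = c * g], so this is all that is needed to find the characteristic
   function of [g] by infinite divisibility. *)
Lemma cos_sub_gauss u :
  `|cos u - expR (- (u ^+ 2 / 2))| <= 18 * (1 - expR (- (u ^+ 2 / 2))) ^+ 2.
Proof.
set v := u ^+ 2 / 2; have v0 : 0 <= v by rewrite divr_ge0// sqr_ge0.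
set e := expR (- v); have e0 : 0 < e by exact: expR_gt0.
have e1 : 1 - v <= e by have := expR_ge1Dx (- v); rewrite -/e.
have e3 : e * (1 + v) <= 1.
  rewrite /e expRN mulrC ler_pdivrMr ?expR_gt0// mul1r; exact: expR_ge1Dx.
have c1 := cos_le1 u; have c2 := cos_geN1 u.
have [v2|v2] := leP (1/2) v.
  have : 1 / 3 <= 1 - e by nra.
  rewrite ler_norml => h; apply/andP; split; nra.
have e2 : e <= 1 - v + v ^+ 2 by exact: expRN_le.
have := cos_ge u; have := cos_le u; rewrite (_ : u ^+ 4 = 4 * v ^+ 2); last by rewrite /v; field.
rewrite -/v => h1 h2.
have h3 : 2 / 3 * v <= 1 - e by nra.
have h4 : (2 / 3 * v) ^+ 2 <= (1 - e) ^+ 2 by rewrite lerXn2r// nnegrE; lra.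
rewrite ler_norml; apply/andP; split; nra.
Qed.

Lemma invsqrt_ge v : 0 <= v -> 1 - v / 2 <= (Num.sqrt (1 + v))^-1.
Proof.
move=> v0; set z := Num.sqrt _.
have z1 : 1 <= z by rewrite -sqrtr1 ler_wsqrtr// lerDl.
have zE : z ^+ 2 = 1 + v by rewrite sqr_sqrtr// addr_ge0.
rewrite -[leRHS]mul1r ler_pdivlMr; last by lra.
have -> : v = z ^+ 2 - 1 by lra.
rewrite -subr_ge0 (_ : _ - _ = (z - 1) ^+ 2 * (z + 2) / 2); last by field.
by rewrite divr_ge0// mulr_ge0 ?sqr_ge0//; lra.
Qed.

Lemma invsqrt_le v : 0 <= v ->
  (Num.sqrt (1 + v))^-1 <= 1 - v / 2 + 3 / 8 * v ^+ 2.
Proof.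
move=> v0; set z := Num.sqrt _.
have z1 : 1 <= z by rewrite -sqrtr1 ler_wsqrtr// lerDl.
have zE : z ^+ 2 = 1 + v by rewrite sqr_sqrtr// addr_ge0.
rewrite -[leLHS]mul1r ler_pdivrMr; last by lra.
have -> : v = z ^+ 2 - 1 by lra.
rewrite -subr_ge0 (_ : _ - _ = (z - 1) ^+ 2 * (z - 1) * (3 * z ^+ 2 + 9 * z + 8) / 8); last by field.
have z2 := sqr_ge0 z.
by rewrite divr_ge0// !mulr_ge0 ?sqr_ge0//; lra.
Qed.

Lemma invsqrt_sub_exp v : 0 <= v ->
  `|(Num.sqrt (1 + v))^-1 - expR (- (v / 2))| <= v ^+ 2.
Proof.
move=> v0; have h1 := invsqrt_ge v0; have h2 := invsqrt_le v0.
have v20 : 0 <= v / 2 by lra.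
have h3 := expRN_le v20; have h4 := expR_ge1Dx (- (v / 2)).
rewrite ler_norml; apply/andP; split; nra.
Qed.

Lemma exprn_sub_le x y n : `|x| <= 1 -> `|y| <= 1 ->
  `|x ^+ n - y ^+ n| <= n%:R * `|x - y|.
Proof.
move=> x1 y1; elim: n => [|n IH]; first by rewrite !expr0 subrr normr0 mul0r.
have -> : x ^+ n.+1 - y ^+ n.+1 = x * (x ^+ n - y ^+ n) + (x - y) * y ^+ n.
  by rewrite !exprS; ring.
rewrite (le_trans (ler_normD _ _))// !normrM -[n.+1]addn1 natrD mulrDl mul1r lerD//.
  by rewrite -[leRHS]mul1r ler_pM.
by rewrite -[leRHS]mulr1 ler_wpM2l// normrX exprn_ile1.
Qed.

End calculus.

(** * Gaussian characteristic functions *)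

Section normal_integrals.
Context (R : realType).
Local Notation mu := (@lebesgue_measure R).

Lemma Ex_normal (m s : R) (f : R -> R) : bounded_measurable f ->
  (Ex (normal_prob m s) f)%:E = (\int[mu]_x (f x * normal_pdf m s x)%:E)%E.
Proof.
move=> bf; rewrite -ExE//; have dom := @normal_prob_dominates R m s.
have mpdf : measurable_fun setT (EFin \o normal_pdf m s).
  by apply/measurable_EFinP; exact: measurable_normal_pdf.
have mf : measurable_fun setT (EFin \o f) by case: bf => /measurable_EFinP.
have RN : ae_eq mu setT (Radon_Nikodym (charge_of_finite_measure (normal_prob m s)) mu)
    (EFin \o normal_pdf m s).
  apply: integral_ae_eq => // [|E _ mE]; first exact: Radon_Nikodym_integrable.
  by rewrite -Radon_Nikodym_integral.
have fi := bm_integrable (normal_prob m s) bf.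
rewrite -(Radon_Nikodym_change_of_variables dom measurableT fi).
under [RHS]eq_integral do rewrite EFinM.
apply: ae_eq_integral => //; last exact: ae_eqe_mul2l.
- exact: emeasurable_funM.
- exact: emeasurable_funM.
Qed.

(** The condition [a = 0 -> b = 0] excludes the unbounded [exp (b x)]; otherwise completing the
    square bounds the function by [exp (b^2 / (2 a))]. *)
Lemma gauss_bm (a b : R) : 0 <= a -> (a = 0 -> b = 0) ->
  bounded_measurable (fun x => expR (b * x - a * x ^+ 2 / 2)).
Proof.
move=> a0 ab; split.
  apply: measurableT_comp => //; apply: measurable_funB.
    by apply: measurable_funM.
  by apply: measurable_funM => //; apply: measurable_funM.
have [a00|a0'] := eqVneq a 0.
  by exists 1 => x; rewrite a00 ab// !mul0r subr0 expR0 normr1.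
exists (expR (b ^+ 2 / (2 * a))) => x.
rewrite ger0_norm ?expR_ge0// ler_expR -subr_ge0.
rewrite (_ : _ - _ = (b - a * x) ^+ 2 / (2 * a)); last by field.
by rewrite divr_ge0 ?sqr_ge0// mulr_ge0.
Qed.

(* Completing the square. *)
Lemma Ex_normal_gauss (s a b : R) : 0 < s -> 0 <= a -> (a = 0 -> b = 0) ->
  Ex (normal_prob 0 s) (fun x => expR (b * x - a * x ^+ 2 / 2)) =
  (Num.sqrt (1 + a * s ^+ 2))^-1 * expR (b ^+ 2 * s ^+ 2 / (2 * (1 + a * s ^+ 2))).
Proof.
move=> s0 a0 ab; apply/EFin_inj; rewrite Ex_normal; last exact: gauss_bm.
set z := Num.sqrt _.
have D1 : 1 <= 1 + a * s ^+ 2 by rewrite lerDl mulr_ge0// sqr_ge0.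
have z1 : 1 <= z by rewrite -sqrtr1 ler_wsqrtr.
have zE : z ^+ 2 = 1 + a * s ^+ 2 by rewrite sqr_sqrtr//; lra.
have z0 : z != 0 by rewrite gt_eqF//; lra.
have s00 : s != 0 by rewrite gt_eqF.
set s' := s / z; set m := b * s' ^+ 2.
have s'0 : s' != 0 by rewrite mulf_neq0// invr_eq0.
under eq_integral => x _.
  rewrite (_ : (_ * _)%:E = ((z^-1 * expR (b ^+ 2 * s ^+ 2 / (2 * (1 + a * s ^+ 2))))%:E
      * (normal_pdf m s' x)%:E)%E).
    over.
  rewrite -EFinM; congr EFin.
  rewrite !normal_pdfE// /normal_peak /normal_fun.
  have -> : (Num.sqrt (s ^+ 2 * pi *+ 2))^-1 = z^-1 * (Num.sqrt (s' ^+ 2 * pi *+ 2))^-1.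
    rewrite -invfM; congr (_^-1).
    have -> : s ^+ 2 * pi *+ 2 = z ^+ 2 * (s' ^+ 2 * pi *+ 2).
      by rewrite /s' !mulr2n; field.
    rewrite sqrtrM ?sqr_ge0// sqrtr_sqr ger0_norm//; lra.
  set w := (Num.sqrt (s' ^+ 2 * pi *+ 2))^-1.
  set E1 := expR (b * x - _); set E2 := expR (- _ / _).
  set E3 := expR (b ^+ 2 * _ / _); set E4 := expR (- _ / _).
  have hE : E1 * E2 = E3 * E4.
    rewrite /E1 /E2 /E3 /E4 -!expRD; congr expR; rewrite -zE /m /s' -[s ^+ 2 *+ 2]mulr_natl -[(s / z) ^+ 2 *+ 2]mulr_natl.
    have -> : a = (z ^+ 2 - 1) / s ^+ 2 by rewrite zE; field.
    by field; rewrite ?s00 ?z0.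
  transitivity (z^-1 * w * (E1 * E2)); first by ring.
  by rewrite hE; ring.
by rewrite integralZl//=; [rewrite integral_normal_pdf mule1|exact: integrable_normal_pdf].
Qed.

Lemma Ex_normal_exp (s a : R) : 0 < s -> 0 <= a ->
  Ex (normal_prob 0 s) (fun x => expR (- ((a * x) ^+ 2 / 2))) =
  (Num.sqrt (1 + (a * s) ^+ 2))^-1.
Proof.
move=> s0 a0; have := @Ex_normal_gauss s (a ^+ 2) 0 s0 (sqr_ge0 _) (fun=> erefl).
rewrite expr0n/= !mul0r expR0 mulr1 -exprMn => <-.
by congr Ex; apply/funext => x; congr expR; field.
Qed.

(** By [cos_sub_gauss] the cosine may be replaced by [exp (- (c x)^2 / 2)], at a cost of 18 times [1
    - 2 / sqrt (1 + v) + 1 / sqrt (1 + 2 v) <= 3 v^2 / 2], which is the 27; comparing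
    [1 / sqrt (1 + v)] with [exp (- v / 2)] adds the last [v^2]. *)
Lemma Ex_normal_cos_approx (s c : R) : 0 < s -> 0 <= c ->
  `|Ex (normal_prob 0 s) (fun x => cos (c * x)) - expR (- ((c * s) ^+ 2 / 2))|
    <= 28 * ((c * s) ^+ 2) ^+ 2.
Proof.
move=> s0 c0; set v := (c * s) ^+ 2; have v0 : 0 <= v by exact: sqr_ge0.
pose e k (x : measurableTypeR R) : R := expR (- ((k * x) ^+ 2 / 2)).
have be k : bounded_measurable (e k).
  apply: bm_exp; last by move=> x; rewrite oppr_le0 divr_ge0// sqr_ge0.
  apply: measurable_funN; apply: measurable_funM => //; apply: measurable_funX.
  by apply: measurable_funM.
have bc : bounded_measurable (fun x : measurableTypeR R => cos (c * x)).
  by apply: bm_cos; apply: measurable_funM.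
have b1 : bounded_measurable (fun x : measurableTypeR R => 1 - e c x) by apply: bmB => //; exact: bm_cst.
have b2 : bounded_measurable (fun x : measurableTypeR R => (1 - e c x) ^+ 2) by exact: (bmM b1 b1).
have b3 k : bounded_measurable (fun x : measurableTypeR R => 2 * e k x) by apply: bmM => //; exact: bm_cst.
have E1 := Ex_normal_exp s0 c0; rewrite -/v -/(e c) in E1.
have sq2 : (Num.sqrt 2) ^+ 2 = 2 :> R by rewrite sqr_sqrtr.
have E2 : Ex (normal_prob 0 s) (e (Num.sqrt 2 * c)) = (Num.sqrt (1 + 2 * v))^-1.
  rewrite Ex_normal_exp ?mulr_ge0 ?sqrtr_ge0//.
  by rewrite -mulrA exprMn sq2.
have h := @invsqrt_sub_exp R v v0.
have E3 : Ex (normal_prob 0 s) (fun x : measurableTypeR R => 18 * (1 - e c x) ^+ 2) =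
    18 * (1 - 2 * (Num.sqrt (1 + v))^-1 + (Num.sqrt (1 + 2 * v))^-1).
  rewrite ExZ//; congr (_ * _).
  have -> : (fun x : measurableTypeR R => (1 - e c x) ^+ 2) =
            (fun x : measurableTypeR R => (1 - 2 * e c x) + e (Num.sqrt 2 * c) x).
    apply/funext => x.
    have -> : e (Num.sqrt 2 * c) x = e c x ^+ 2.
      rewrite /e -expRM_natr; congr expR.
      rewrite (_ : (Num.sqrt 2 * c * x) ^+ 2 = 2 * (c * x) ^+ 2); first by field.
      by rewrite -mulrA [LHS]exprMn sq2.
    by ring.
  have b4 : bounded_measurable (fun x : measurableTypeR R => 1 - 2 * e c x).
    by apply: bmB => //; exact: bm_cst.
  by rewrite (ExD _ b4 (be _)) (ExB _ (bm_cst _ _) (b3 _)) Ex_cst ExZ// E1 E2.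
have h2 : 0 <= 2 * v by lra.
have := invsqrt_ge v0; have := invsqrt_le h2 => i2 i1.
have E4 : `|Ex (normal_prob 0 s) (fun x : measurableTypeR R => cos (c * x)) - (Num.sqrt (1 + v))^-1| <= 27 * v ^+ 2.
  rewrite -E1 -ExB// (le_trans (norm_Ex _ _))//; first exact: bmB.
  apply: (@le_trans _ _ (Ex (normal_prob 0 s) (fun x : measurableTypeR R => 18 * (1 - e c x) ^+ 2))); last first.
    rewrite E3; nra.
  apply: le_Ex.
  - by apply: bm_norm; exact: bmB.
  - by apply: bmM => //; exact: bm_cst.
  - by move=> x; exact: cos_sub_gauss.
rewrite (_ : 28 * v ^+ 2 = 27 * v ^+ 2 + v ^+ 2); last by ring.
apply: le_trans (lerD E4 h).
by rewrite (le_trans _ (ler_normD _ _))// addrA subrK.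
Qed.

Lemma lebesgue_measure_opp (A : set R) : measurable A ->
  mu A = mu ((fun x => - x) @^-1` A).
Proof.
have mopp : measurable_fun setT (-%R : measurableTypeR R -> measurableTypeR R) by exact: measurable_funN.
move=> mA; rewrite -[RHS]/(pushforward mu (-%R : measurableTypeR R -> measurableTypeR R) A).
apply: (@lebesgue_measure_unique R (pushforward mu (-%R : measurableTypeR R -> measurableTypeR R)) _ A mA) => X [[a b]/= _ <-].
rewrite /pushforward (_ : _ @^-1` _ = `[- b, - a[%classic); last first.
  by apply/seteqP; split => x /=; rewrite !in_itv/= lerNl ltrNr andbC.
rewrite !lebesgue_measure_itv/= !lte_fin ltrN2; case: ifP => // _.
by rewrite opprK addeC.
Qed.

Lemma Ex_normal_sin (s c : R) : 0 < s ->
  Ex (normal_prob 0 s) (fun x => sin (c * x)) = 0.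
Proof.
move=> s0; have s00 : s != 0 by rewrite gt_eqF.
have bs : bounded_measurable (fun x => sin (c * x)).
  by apply: bm_sin; apply: measurable_funM.
pose g x := (sin (c * x) * normal_pdf 0 s x)%:E.
have mg : measurable_fun setT g.
  apply/measurable_EFinP; apply: measurable_funM; first by case: bs.
  exact: measurable_normal_pdf.
have ig : mu.-integrable setT g.
  apply: le_integrable (integrable_normal_pdf 0 s) => // x _.
  rewrite /g !abse_EFin lee_fin normrM ler_piMl// sin_max//.
have mopp : measurable_fun setT (-%R : measurableTypeR R -> measurableTypeR R) by exact: measurable_funN.
have gN x : g (- x) = (- g x)%E.
  rewrite /g mulrN sinN mulNr -EFinN; congr (- (_ * _))%:E.
  by rewrite !normal_pdfE// /normal_fun !subr0 sqrrN.
have igN : mu.-integrable setT (fun x => g (- x)).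
  by under eq_fun do rewrite gN; exact: integrableN.
have h : (\int[mu]_x g x = \int[mu]_x g (- x)%R)%E.
  rewrite -[LHS](@eq_measure_integral _ _ _ setT mu (pushforward mu (-%R : measurableTypeR R -> measurableTypeR R))) /=; last first.
    by move=> A mA _; rewrite [RHS]lebesgue_measure_opp.
  by rewrite integral_pushforward.
move: h; under [in RHS]eq_integral do rewrite gN.
rewrite integralN//=; last by apply: integrable_add_def.
rewrite /g -Ex_normal// => -[]; lra.
Qed.

End normal_integrals.

Lemma mutually_independent_comp (d : measure_display) (T : measurableType d)
    (R : realType) (P : probability T R) n (Y : 'I_n -> T -> R)
    (g : 'I_n -> R -> R) :
  (forall i, measurable_fun setT (g i)) -> mutually_independent P Y ->
  mutually_independent P (fun i w => g i (Y i w)).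
Proof.
move=> mg iY A mA; apply: (iY (fun i => g i @^-1` A i)) => i.
by rewrite -[_ @^-1` _]setTI; exact: mg.
Qed.

(** * Characteristic functions of Brownian increments *)

Section brownian_characteristic_function.
Context (d : measure_display) (T : measurableType d) (R : realType).
Variables (P : probability T R) (B : R -> {RV P >-> R}).
Hypothesis BM : standard_brownian_motion B.

Lemma measurable_increment s t : measurable_fun setT (fun w => B t w - B s w).
Proof. by apply: measurable_funB; exact: measurable_funP. Qed.

Lemma Ex_increment_law s t (f : R -> R) : 0 <= s -> s < t -> bounded_measurable f ->
  Ex P (fun w => f (B t w - B s w)) = Ex (normal_prob 0 (Num.sqrt (t - s))) f.
Proof.
move=> s0 st bf.
apply: (@Ex_law _ _ _ P (fun w => B t w - B s w) (normal_prob 0 (Num.sqrt (t - s)))) => //.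
  exact: measurable_increment.
by move=> A mA; exact: (brownian_gauss BM).
Qed.

Lemma Ex_increment_sin c s t : 0 <= s -> s <= t ->
  Ex P (fun w => sin (c * (B t w - B s w))) = 0.
Proof.
move=> s0; rewrite le_eqVlt => /predU1P[->|st].
  by under eq_fun do rewrite subrr mulr0 sin0; rewrite Ex_cst.
rewrite (@Ex_increment_law s t (fun x => sin (c * x)))//.
  by rewrite Ex_normal_sin// sqrtr_gt0 subr_gt0.
by apply: bm_sin; apply: measurable_funM.
Qed.

Lemma Ex_increments_prod n (t c : nat -> R) :
  0 <= t 0%N -> (forall i, t i <= t i.+1) ->
  Ex P (fun w => cos (\sum_(i < n) c i * (B (t i.+1) w - B (t i) w))) =
  \prod_(i < n) Ex P (fun w => cos (c i * (B (t i.+1) w - B (t i) w))).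
Proof.
move=> t0 ht; have tge0 i : 0 <= t i.
  by elim: i => // i IH; exact: le_trans (ht i).
apply: (@Ex_cos_sum _ _ _ P n (fun i w => c i * (B (t i.+1) w - B (t i) w))).
- by move=> i; apply: measurable_funM => //; exact: measurable_increment.
- apply: (@mutually_independent_comp _ _ _ P n (fun i w => B (t i.+1) w - B (t i) w)
    (fun i x => c i * x)).
    by move=> i; apply: measurable_funM.
  exact: (brownian_indep BM).
- by move=> i; exact: Ex_increment_sin.
Qed.

(** Infinite divisibility is read off the Brownian motion. Over [n + 1] equal pieces the mean is a
    product of factors each known up to [28 (v / (n + 1))^2], so the total error is of order
    [1 / (n + 1)], while the left side does not depend on [n]. *)
Lemma Ex_increment_cos c s t : 0 <= s -> s <= t ->
  Ex P (fun w => cos (c * (B t w - B s w))) = expR (- (c ^+ 2 * (t - s) / 2)).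
Proof.
move=> s0; rewrite le_eqVlt => /predU1P[->|st].
  under eq_fun do rewrite subrr mulr0 cos0.
  by rewrite Ex_cst subrr mulr0 mul0r oppr0 expR0.
wlog c0 : c / 0 <= c => [hw|].
  have [c0|/ltW c0] := leP 0 c; first exact: hw.
  have := hw (- c); rewrite oppr_ge0 sqrrN => /(_ c0) <-.
  by congr Ex; apply/funext => w; rewrite mulNr cosN.
set v := c ^+ 2 * (t - s); have v0 : 0 <= v by rewrite mulr_ge0 ?sqr_ge0// subr_ge0 ltW.
suff h n : `|Ex P (fun w => cos (c * (B t w - B s w))) - expR (- (v / 2))|
    <= 28 * v ^+ 2 / n.+1%:R.
  apply/eqP; rewrite -subr_eq0 -normr_le0; apply/ler_addgt0Pl => e e0; rewrite addr0.
  have := h (Num.truncn (28 * v ^+ 2 / e)) => /le_trans; apply.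
  by rewrite ler_pdivrMr// [e * _]mulrC -ler_pdivrMr// ltW// truncnS_gt.
pose tau i := s + i%:R * ((t - s) / n.+1%:R).
have N0 : 0 < n.+1%:R :> R by [].
have N00 : n.+1%:R != 0 :> R by rewrite gt_eqF.
have dt : 0 < (t - s) / n.+1%:R by rewrite divr_gt0// subr_gt0.
have tauS i : tau i.+1 - tau i = (t - s) / n.+1%:R.
  by rewrite /tau -natr1; ring.
have htau i : tau i <= tau i.+1 by rewrite -subr_ge0 tauS ltW.
have tau0 : tau 0%N = s by rewrite /tau mul0r addr0.
have tauN : tau n.+1 = t by rewrite /tau mulrC divfK// addrC subrK.
have taui i : 0 <= tau i by elim: i => [|i IH]; rewrite ?tau0// (le_trans IH).
have -> : (fun w => cos (c * (B t w - B s w))) =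
    (fun w => cos (\sum_(i < n.+1) c * (B (tau i.+1) w - B (tau i) w))).
  apply/funext => w; congr cos; rewrite -mulr_sumr; congr (_ * _).
  have := telescope_sumr (fun i => B (tau i) w) (leq0n n.+1).
  by rewrite big_mkord tau0 tauN => ->.
rewrite (@Ex_increments_prod n.+1 tau (fun=> c)) ?tau0//.
set s2 := (t - s) / n.+1%:R in dt tauS *.
set G := Ex (normal_prob 0 (Num.sqrt s2)) (fun x => cos (c * x)).
have bc : bounded_measurable (fun x : R => cos (c * x)).
  by apply: bm_cos; apply: measurable_funM.
have EG i : Ex P (fun w => cos (c * (B (tau i.+1) w - B (tau i) w))) = G.
  have lt_tau : tau i < tau i.+1 by rewrite -subr_gt0 tauS.
  have := Ex_increment_law (taui i) lt_tau bc; rewrite tauS; exact.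
have E : `|G - expR (- (v / n.+1%:R / 2))| <= 28 * (v / n.+1%:R) ^+ 2.
  have sg : 0 < Num.sqrt s2 by rewrite sqrtr_gt0.
  have := Ex_normal_cos_approx sg c0.
  by rewrite exprMn sqr_sqrtr ?(ltW dt)// /s2 mulrA.
under eq_bigr do rewrite EG.
rewrite prodr_const card_ord.
have -> : - (v / 2) = - (v / n.+1%:R / 2) * n.+1%:R by field.
rewrite expRM_natr.
apply: (le_trans (exprn_sub_le _ _ _)).
- rewrite -(EG 0%N); apply: norm_Ex_le => [|w]; last exact: cos_max.
  by apply: bm_cos; apply: measurable_funM => //; exact: measurable_increment.
- rewrite ger0_norm ?expR_ge0// -expR0 ler_expR oppr_le0.
  by rewrite !divr_ge0.
apply: (le_trans (ler_wpM2l (ltW N0) E)).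
set N : R := n.+1%:R in N00 *.
by rewrite le_eqVlt; apply/orP; left; apply/eqP; field.
Qed.

Lemma Ex_increments_cos n (t c : nat -> R) :
  0 <= t 0%N -> (forall i, t i <= t i.+1) ->
  Ex P (fun w => cos (\sum_(i < n) c i * (B (t i.+1) w - B (t i) w))) =
  expR (- (\sum_(i < n) c i ^+ 2 * (t i.+1 - t i) / 2)).
Proof.
move=> t0 ht; have tge0 i : 0 <= t i.
  by elim: i => // i IH; exact: le_trans (ht i).
rewrite Ex_increments_prod// -sumrN expR_sum.
by apply: eq_bigr => i _; rewrite Ex_increment_cos.
Qed.

End brownian_characteristic_function.

(** * Common grids and step functions *)

Section grids.
Context (R : realType).

Lemma grid_exists (L : seq R) : (forall x, x \in L -> 0 <= x <= 1) ->
  exists (n : nat) (t : nat -> R),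
    [/\ t 0%N = 0, t n = 1, (forall i, t i <= t i.+1) &
        forall x, x \in L -> exists2 j, (j <= n)%N & x = t j].
Proof.
(* The default value 1 of [nth] makes the sequence reach 1 at [size s] and stay there, hence
   monotone at every index. *)
move=> hL; pose s := sort <=%R (0 :: L); exists (size s), (nth 1 s).
have hs x : x \in s -> 0 <= x <= 1.
  by rewrite mem_sort inE => /predU1P[->|/hL//]; rewrite lexx ler01.
have ss : sorted <=%R s by apply: sort_sorted; exact: le_total.
have sz : (0 < size s)%N by rewrite size_sort.
split.
- have m0 : 0 \in s by rewrite mem_sort inE eqxx.
  have := hs _ (mem_nth 1 sz) => /andP[h0 _]; apply/le_anti; rewrite h0 andbT.
  rewrite -[X in _ <= X](nth_index 1 m0).
  by apply: (sorted_leq_nth le_trans lexx 1 ss) => //; rewrite inE ?index_mem.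
- by rewrite nth_default.
- move=> i; have [h|h] := ltnP i.+1 (size s).
    by apply: (sorted_leq_nth le_trans lexx 1 ss) => //; rewrite inE// ltnW.
  rewrite [X in _ <= X]nth_default//.
  have [h'|h'] := ltnP i (size s); last by rewrite nth_default.
  by have /andP[] := hs _ (mem_nth 1 h').
- move=> x xL; have xs : x \in s by rewrite mem_sort inE xL orbT.
  exists (index x s); first by rewrite ltnW// index_mem.
  by rewrite nth_index.
Qed.

Variables (n : nat) (t : nat -> R).
Hypotheses (ht : forall i, t i <= t i.+1).

Lemma grid_le i j : (i <= j)%N -> t i <= t j.
Proof.
move=> /subnK <-; elim: (j - i)%N => [|k IH]; first by rewrite add0n.
by rewrite addSn (le_trans IH).
Qed.

(** The indicator stops the sum at [t q], and [F] composed with the minimum with [t q] telescopes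
    over the whole grid. *)
Lemma grid_telescope (F : R -> R) q : (q <= n)%N ->
  \sum_(j < n) (t j.+1 <= t q)%R%:R * (F (t j.+1) - F (t j)) = F (t q) - F (t 0%N).
Proof.
move=> qn.
transitivity (\sum_(j < n) (F (Num.min (t j.+1) (t q)) - F (Num.min (t j) (t q)))).
  apply: eq_bigr => j _; have [h|h] := leP (t j.+1) (t q).
    by rewrite mul1r min_l// (le_trans (ht j)).
  have qj : (q <= j)%N.
    by rewrite leqNgt; apply/negP => /grid_le; rewrite leNgt h.
  by rewrite mul0r min_r ?subrr// grid_le.
have := telescope_sumr (fun i => F (Num.min (t i) (t q))) (leq0n n).
by rewrite big_mkord => ->; rewrite min_r ?grid_le// min_l// grid_le.
Qed.

Lemma grid_cell_le s j q : t j < s <= t j.+1 -> (s <= t q) = (t j.+1 <= t q).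
Proof.
move=> /andP[js sj]; apply/idP/idP => [sq|]; last exact: le_trans.
apply: grid_le; rewrite ltnNge; apply/negP => /grid_le qj.
by have := lt_le_trans js (le_trans sq qj); rewrite ltxx.
Qed.

Lemma itv_oc_indic (a b s : R) : a <= b ->
  \1_(`]a, b]) s = (s <= b)%R%:R - (s <= a)%R%:R :> R.
Proof.
move=> ab; rewrite indicE mem_setE in_itv/=.
have [sa|sa] := leP s a; first by rewrite (le_trans sa ab) subrr.
by rewrite subr0.
Qed.

End grids.

Section step_functions.
Context (R : realType).
Local Notation mu := (@lebesgue_measure R).

Lemma step_node_ge0 (phi : step_fun R) k : (k <= step_size phi)%N ->
  0 <= step_node phi k.
Proof.
elim: k => [|k IH] h; first by rewrite step_node_first.
by rewrite (le_trans (IH (ltnW h)))// step_node_le.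
Qed.

Lemma step_node_le1 (phi : step_fun R) k : (k <= step_size phi)%N ->
  step_node phi k <= 1.
Proof.
rewrite -(step_node_last phi) => /subKn <-.
elim: (step_size phi - k)%N => [|m IH]; first by rewrite subn0.
have [h|h] := ltnP m (step_size phi).
  apply: le_trans IH; rewrite subnS -[X in _ <= step_node _ X](@prednK (step_size phi - m)).
    by apply: step_node_le; rewrite prednK ?subn_gt0// leq_subr.
  by rewrite subn_gt0.
by move: h; rewrite -subn_eq0 => /eqP h; rewrite subnS h/= -h.
Qed.

Lemma measurable_step_eval (phi : step_fun R) : measurable_fun setT (step_eval phi).
Proof.
by apply: measurable_sum => i; apply: measurable_funM.
Qed.

Lemma bm_step_eval (phi : step_fun R) : bounded_measurable (step_eval phi).
Proof.
by apply: bm_sum => i; apply: bmM; [exact: bm_cst|exact: bm_indic].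
Qed.

Definition on_grid (n : nat) (t : nat -> R) (phi : step_fun R) :=
  forall k, (k <= step_size phi)%N -> exists2 j, (j <= n)%N & step_node phi k = t j.

Variables (n : nat) (t : nat -> R).
Hypotheses (ht : forall i, t i <= t i.+1).

(** Refining the nodes does not change the integral; as the cells are open on the left and closed on
    the right, the value on a cell is read at its right end. *)
Lemma step_integral_grid (T : Type) (B : R -> T -> R) phi w : on_grid n t phi ->
  step_integral B phi w =
  \sum_(j < n) step_eval phi (t j.+1) * (B (t j.+1) w - B (t j) w).
Proof.
move=> gphi; rewrite /step_integral /step_eval.
under [RHS]eq_bigr do rewrite mulr_suml.
rewrite exchange_big/=; apply: eq_bigr => i _.
under eq_bigr do rewrite -mulrA.
rewrite -mulr_sumr; congr (_ * _).
under eq_bigr do rewrite itv_oc_indic ?step_node_le// mulrBl.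
have [p pn ->] := gphi i.+1 (ltn_ord i).
have [q qn ->] := gphi i (ltnW (ltn_ord i)).
rewrite sumrB (grid_telescope ht (fun x => B x w) pn) (grid_telescope ht (fun x => B x w) qn).
by rewrite opprB addrA subrK.
Qed.

Lemma step_eval_cell phi j s : on_grid n t phi -> t j < s <= t j.+1 ->
  step_eval phi s = step_eval phi (t j.+1).
Proof.
move=> gphi sj; apply: eq_bigr => i _; congr (_ * _).
rewrite !itv_oc_indic ?step_node_le//.
have [p pn ->] := gphi i.+1 (ltn_ord i).
have [q qn ->] := gphi i (ltnW (ltn_ord i)).
by rewrite !(grid_cell_le ht _ sj).
Qed.

Lemma finite_itv_integrable (f : R -> R) (a b : R) : bounded_measurable f ->
  mu.-integrable `]a, b] (EFin \o f).
Proof.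
move=> [mf [M hM]]; apply: measurable_bounded_integrable => //.
- rewrite [X in (X < _)%E]lebesgue_measure_itv/=.
  by case: ifP => // _; rewrite -EFinB ltry.
- exact: measurable_funTS.
- exists M; split; first exact: num_real.
  by move=> y My x _; apply: le_trans (hM x) _; exact: ltW.
Qed.

Lemma Rintegral_grid (f : R -> R) k : bounded_measurable f ->
  (forall j s, t j < s <= t j.+1 -> f s = f (t j.+1)) ->
  \int[mu]_(s in `]t 0%N, t k]) f s =
  \sum_(j < k) f (t j.+1) * (t j.+1 - t j).
Proof.
move=> bf hf; elim: k => [|k IH].
  by rewrite big_ord0 set_itvoc0 Rintegral_set0.
have t0k : t 0%N <= t k by exact: grid_le.
have -> : `]t 0%N, t k.+1]%classic = `]t 0%N, t k] `|` `]t k, t k.+1].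
  by rewrite -itv_bndbnd_setU// bnd_simp.
rewrite Rintegral_setU//=; last 2 first.
- by rewrite -itv_bndbnd_setU// ?bnd_simp//; exact: finite_itv_integrable.
- apply/eqP; rewrite -subset0 => x [/=]; rewrite !in_itv/= => /andP[_ h1] /andP[h2 _].
  by have := le_lt_trans h1 h2; rewrite ltxx.
rewrite IH big_ord_recr/=; congr (_ + _).
rewrite (@eq_Rintegral _ _ _ _ _ (fun=> f (t k.+1))); last first.
  by move=> x; rewrite inE/= in_itv/= => /hf.
rewrite Rintegral_cst// [X in fine X]lebesgue_measure_itv/= lte_fin.
case: ltP => // h; have -> : t k.+1 = t k by apply/le_anti; rewrite h ht.
by rewrite subrr.
Qed.

End step_functions.

Section step_characteristic_function.
Context (d : measure_display) (T : measurableType d) (R : realType).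
Variables (P : probability T R) (B : R -> {RV P >-> R}).
Hypothesis BM : standard_brownian_motion B.
Local Notation mu := (@lebesgue_measure R).

(** On a grid containing the nodes of all the step functions, the combination is a single sum over
    independent increments; its variance is the integral of the squared combination. *)
Lemma Ex_cos_step m (v : 'I_m -> R) (phi : 'I_m -> step_fun R) :
  Ex P (fun w => cos (\sum_i v i * step_integral B (phi i) w)) =
  expR (- ((\int[mu]_(s in `[0, 1]) (\sum_i v i * step_eval (phi i) s) ^+ 2) / 2)).
Proof.
pose L := flatten [seq [seq step_node (phi i) k | k <- iota 0 (step_size (phi i)).+1] | i <- enum 'I_m].
have [n [t [t0 tn ht gL]]] : exists (n : nat) (t : nat -> R),
    [/\ t 0%N = 0, t n = 1, (forall i, t i <= t i.+1) &
        forall x, x \in L -> exists2 j, (j <= n)%N & x = t j].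
  apply: grid_exists => x /allpairsPdep[i [k [_ hk ->]]].
  rewrite mem_iota/= add0n ltnS in hk.
  by rewrite step_node_ge0// step_node_le1.
have gphi i : on_grid n t (phi i).
  move=> k hk; apply: gL; apply/allpairsPdep; exists i, k.
  by rewrite mem_enum mem_iota.
pose q s := \sum_i v i * step_eval (phi i) s.
have bq : bounded_measurable q.
  by apply: bm_sum => i; apply: bmM; [exact: bm_cst|exact: bm_step_eval].
have -> : (fun w => cos (\sum_i v i * step_integral B (phi i) w)) =
   (fun w => cos (\sum_(j < n) q (t j.+1) * (B (t j.+1) w - B (t j) w))).
  apply/funext => w; congr cos.
  under [RHS]eq_bigr do rewrite mulr_suml.
  rewrite exchange_big/=; apply: eq_bigr => i _.
  rewrite (step_integral_grid ht _ _ (gphi i)) mulr_sumr.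
  by apply: eq_bigr => j _; rewrite mulrA.
rewrite (@Ex_increments_cos _ _ _ P B BM n t (fun j => q (t j.+1))) ?t0//.
congr expR; congr (- _); rewrite -mulr_suml; congr (_ / _).
have bq2 : bounded_measurable (fun s => q s ^+ 2) by exact: (bmM bq bq).
rewrite -Rintegral_itv_obnd_cbnd; last exact: finite_itv_integrable.
have hq j s : t j < s <= t j.+1 -> q s ^+ 2 = q (t j.+1) ^+ 2.
  move=> sj; congr (_ ^+ 2).
  by apply: eq_bigr => i _; rewrite (step_eval_cell ht (gphi i) sj).
by have := Rintegral_grid ht n bq2 hq; rewrite t0 tn => ->.
Qed.

End step_characteristic_function.

Section elementary_inequalities.
Context (R : realType).

Lemma sqr_sum_le (m : nat) (x : 'I_m -> R) :
  (\sum_i x i) ^+ 2 <= m%:R * \sum_i x i ^+ 2.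
Proof.
have -> : m%:R * \sum_i x i ^+ 2 = \sum_i \sum_j (x i ^+ 2 + x j ^+ 2) / 2.
  under [RHS]eq_bigr do rewrite -mulr_suml big_split/= sumr_const card_ord.
  rewrite -mulr_suml big_split/= sumr_const card_ord sumrMnl.
  by rewrite -!(mulr_natl (\sum_i _) m); field.
rewrite expr2 mulr_suml; apply: ler_sum => i _.
rewrite mulr_sumr; apply: ler_sum => j _.
have := sqr_ge0 (x i - x j); nra.
Qed.

Lemma cos_lipschitz (a b : R) : `|cos a - cos b| <= `|a - b|.
Proof.
have cc (x y : R) : x <= y -> `|cos y - cos x| <= y - x.
  move=> xy; have cf : {within `[x, y], continuous (@cos R)}.
    by apply: continuous_subspaceT; exact: continuous_cos.
  have [c _ ->] := MVT_segment xy (fun z _ => is_derive_cos z) cf.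
  rewrite normrM normrN [X in _ * X]ger0_norm ?subr_ge0//.
  by rewrite ler_piMl ?subr_ge0// sin_max.
have [ab|/ltW ba] := leP a b; first by rewrite distrC [leRHS]distrC [leRHS]ger0_norm ?subr_ge0// cc.
by rewrite [X in _ <= X]ger0_norm ?subr_ge0// cc.
Qed.

Lemma expRN_lipschitz (a b : R) : 0 <= a -> 0 <= b ->
  `|expR (- a) - expR (- b)| <= `|a - b|.
Proof.
have ee (x y : R) : 0 <= x -> x <= y -> expR (- x) - expR (- y) <= y - x.
  move=> x0 xy; have := expR_ge1Dx (x - y).
  have -> : expR (- y) = expR (- x) * expR (x - y) by rewrite -expRD; congr expR; ring.
  have : expR (- x) <= 1 by rewrite -expR0 ler_expR oppr_le0.
  have : 0 < expR (- x) by exact: expR_gt0.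
  have : expR (x - y) <= 1 by rewrite -expR0 ler_expR subr_le0.
  nra.
move=> a0 b0; have [ab|/ltW ba] := leP a b.
  rewrite distrC [X in _ <= X]distrC [X in _ <= X]ger0_norm ?subr_ge0//.
  rewrite distrC ger0_norm ?subr_ge0 ?ler_expR ?lerN2//; exact: ee.
rewrite [X in _ <= X]ger0_norm ?subr_ge0//.
rewrite distrC ger0_norm ?subr_ge0 ?ler_expR ?lerN2//; exact: ee.
Qed.

Lemma norm_sqr_sub_le (a b e : R) : 0 < e ->
  `|a ^+ 2 - b ^+ 2| <= (1 + e^-1) * (a - b) ^+ 2 + e * b ^+ 2.
Proof.
(* The values [k = 1] and [k = -1] control the cross term with both signs. *)
move=> e0; have h (k : R) : 0 <= e^-1 * ((a - b) + k * e * b) ^+ 2.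
  by rewrite mulr_ge0 ?sqr_ge0// invr_ge0 ltW.
have hE k : e^-1 * ((a - b) + k * e * b) ^+ 2 =
    e^-1 * (a - b) ^+ 2 + 2 * k * ((a - b) * b) + k ^+ 2 * (e * b ^+ 2).
  by field; rewrite gt_eqF.
have := h 1; have := h (-1); rewrite !hE; have := sqr_ge0 (a - b).
by rewrite ler_norml => ? ? ?; apply/andP; split; lra.
Qed.

Lemma small_dist_eq (x y C : R) : 0 <= C ->
  (forall e, 0 < e <= 1 -> `|x - y| <= C * e) -> x = y.
Proof.
move=> C0 h; apply/eqP; rewrite -subr_eq0 -normr_le0.
apply/ler_addgt0Pl => e e0; rewrite addr0.
pose e' := Num.min 1 (e / (C + 1)).
have C1 : 0 < C + 1 by lra.
have e'0 : 0 < e' by rewrite lt_min ltr01 divr_gt0.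
have : `|x - y| <= C * e' by apply: h; rewrite e'0 ge_min lexx.
move/le_trans; apply; have : e' <= e / (C + 1) by rewrite ge_min lexx orbT.
rewrite ler_pdivlMr// => he; nra.
Qed.

End elementary_inequalities.

Section unit_interval.
Context (R : realType).
Local Notation mu := (@lebesgue_measure R).
Local Notation I01 := (`[0 : R, 1]%classic).

Lemma unit_integrable (f : R -> R) : measurable_fun setT f ->
  (exists M, forall x, 0 <= x <= 1 -> `|f x| <= M) ->
  mu.-integrable I01 (EFin \o f).
Proof.
move=> mf [M hM]; apply: measurable_bounded_integrable => //.
- by rewrite [X in (X < _)%E]lebesgue_measure_itv/= lte_fin ltr01 -EFinB ltry.
- exact: measurable_funTS.
- exists M; split; first exact: num_real.
  move=> y My x; rewrite /= in_itv/= => x01.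
  by apply: le_trans (hM x x01) _; exact: ltW.
Qed.

Lemma measurable_laplace (t : R) : measurable_fun setT (fun s : R => expR (- (s * t))).
Proof.
apply: measurableT_comp => //; apply: measurable_funN.
by apply: measurable_funM.
Qed.

Lemma laplace_le1 (t x : R) : 0 <= t -> 0 <= x <= 1 -> `|expR (- (x * t))| <= 1.
Proof.
move=> t0 /andP[x0 _]; rewrite ger0_norm ?expR_ge0// -expR0 ler_expR.
by rewrite oppr_le0 mulr_ge0.
Qed.

End unit_interval.

(** * Joint characteristic functions of the Wiener integrals *)

Section wiener_combination.
Context (d : measure_display) (T : measurableType d) (R : realType).
Variables (P : probability T R) (B X : R -> {RV P >-> R}).
Hypotheses (BM : standard_brownian_motion B) (LX : continuous_laplace_process B X).
Local Notation mu := (@lebesgue_measure R).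

Lemma wiener_step_approx (t eta : R) : 0 <= t -> 0 < eta ->
  exists phi : step_fun R,
   (\int[mu]_(s in `[0%R, 1%R]) ((step_eval phi s - expR (- (s * t))) ^+ 2)%:E <= eta%:E)%E /\
   (\int[P]_w ((step_integral B phi w - X t w) ^+ 2)%:E <= eta%:E)%E.
Proof.
move=> t0 eta0; have [phi [h1 h2]] := LX.1 t t0.
have e1 : (0 < eta%:E)%E by rewrite lte_fin.
move/fine_cvgP : h1 => [f1 /cvgr_lt/(_ _ eta0) n1].
move/fine_cvgP : h2 => [f2 /cvgr_lt/(_ _ eta0) n2].
have [n [[/fineK F1 /ltW N1] [/fineK F2 /ltW N2]]] :=
  @filter_ex _ \oo _ _ (filterI (filterI f1 n1) (filterI f2 n2)).
by exists (phi n); split; [rewrite -F1|rewrite -F2]; rewrite lee_fin.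
Qed.

Lemma measurable_step_integral (phi : step_fun R) :
  measurable_fun setT (fun w => step_integral B phi w).
Proof.
apply: measurable_sum => i; apply: measurable_funM => //.
by apply: measurable_funB; exact: measurable_funP.
Qed.

Lemma ge0_integral_sqr_sum_le (d' : measure_display) (T' : measurableType d')
   (nu : {measure set T' -> \bar R}) (D : set T') m (v : 'I_m -> R) (f g : 'I_m -> T' -> R) (eta : R) :
  measurable D ->
  (forall i, measurable_fun D (f i)) -> (forall i, measurable_fun D (g i)) ->
  (forall i, (\int[nu]_(x in D) ((f i x - g i x) ^+ 2)%:E <= eta%:E)%E) ->
  (\int[nu]_(x in D) ((\sum_i v i * f i x - \sum_i v i * g i x) ^+ 2)%:E <=
     (m%:R * (\sum_i v i ^+ 2) * eta)%:E)%E.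
Proof.
move=> mD mf mg h.
have v0 i : 0 <= m%:R * v i ^+ 2 by apply: mulr_ge0 => //; exact: sqr_ge0.
have mfg i : measurable_fun D (fun x => ((f i x - g i x) ^+ 2)).
  by apply: measurable_funX; apply: measurable_funB.
apply: (@le_trans _ _ (\int[nu]_(x in D) (\sum_i (m%:R * v i ^+ 2)%:E * ((f i x - g i x) ^+ 2)%:E))%E).
  apply: ge0_le_integral => //.
  - by move=> x _; rewrite lee_fin sqr_ge0.
  - apply/measurable_EFinP; apply: measurable_funX; apply: measurable_funB;
    by apply: measurable_sum => i; apply: measurable_funM.
  - by apply: emeasurable_sum => i _; apply: emeasurable_funM => //; exact/measurable_EFinP.
  - move=> x _; rewrite -sumrB; under eq_bigr do rewrite -mulrBr.
    under [leRHS]eq_bigr do rewrite -EFinM.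
    rewrite sumEFin lee_fin (le_trans (sqr_sum_le _))// mulr_sumr.
    by apply: ler_sum => i _; rewrite exprMn mulrA.
rewrite ge0_integral_sum//; last 2 first.
- by move=> i; apply: emeasurable_funM => //; exact/measurable_EFinP.
- by move=> i x _; rewrite -EFinM lee_fin; apply: mulr_ge0 => //; exact: sqr_ge0.
rewrite mulr_sumr mulr_suml -sumEFin; apply: lee_sum => i _.
rewrite ge0_integralZl//; last 3 first.
- exact/measurable_EFinP.
- by move=> x _; rewrite lee_fin sqr_ge0.
- by rewrite lee_fin.
by rewrite [leRHS]EFinM lee_wpmul2l// lee_fin.
Qed.

(** The inequality [|z| <= e + z^2 / e], integrated, passes from the second moment to the first
    without Cauchy-Schwarz. *)
Lemma Ex_cos_dist (Y S : T -> R) (e eta : R) : 0 < e ->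
  measurable_fun setT Y -> measurable_fun setT S ->
  (\int[P]_w ((Y w - S w) ^+ 2)%:E <= eta%:E)%E ->
  `|Ex P (fun w => cos (Y w)) - Ex P (fun w => cos (S w))| <= e + eta / e.
Proof.
move=> e0 mY mS h; have bY := bm_cos mY; have bS := bm_cos mS.
rewrite -ExB// (le_trans (norm_Ex P _))//; first exact: bmB.
rewrite -lee_fin -ExE; last by apply: bm_norm; exact: bmB.
have m2 : measurable_fun setT (fun w => ((Y w - S w) ^+ 2)%:E).
  by apply/measurable_EFinP; apply: measurable_funX; apply: measurable_funB.
apply: (@le_trans _ _ (\int[P]_w (e%:E + (e^-1)%:E * ((Y w - S w) ^+ 2)%:E))%E).
  apply: ge0_le_integral => //.
  - by apply/measurable_EFinP; apply: measurableT_comp => //; apply: measurable_funB; [case: bY|case: bS].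
  - by apply: emeasurable_funD => //; apply: emeasurable_funM.
  - move=> w _; rewrite -EFinM -EFinD lee_fin (le_trans (cos_lipschitz _ _))//.
    set z := Y w - S w; rewrite -[X in _ + _ * X]real_normK ?num_real//.
    rewrite -subr_ge0 -(pmulr_rge0 _ e0) mulrBr mulrDr mulrA divff ?gt_eqF// mul1r.
    have := sqr_ge0 (e - `|z|); have := normr_ge0 z; nra.
rewrite ge0_integralD//; last 3 first.
- by move=> w _; rewrite lee_fin ltW.
- by move=> w _; rewrite -EFinM lee_fin mulr_ge0 ?sqr_ge0// invr_ge0 ltW.
- by apply: emeasurable_funM.
rewrite integral_cst// [X in (_ * X)%E]probability_setT mule1.
rewrite ge0_integralZl//; last 2 first.
- by move=> x _; rewrite lee_fin sqr_ge0.
- by rewrite lee_fin invr_ge0 ltW.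
rewrite EFinD leeD2l// mulrC EFinM lee_wpmul2l// lee_fin invr_ge0 ltW//.
Qed.

(** This determines all that the small ball estimates use of the joint law of [X]. Both sides are
    continuous for the two L^2 convergences in the definition of the Wiener integral, and they agree
    on step functions. *)
Lemma Ex_cos_wiener m (v pts : 'I_m -> R) : (forall i, 0 <= pts i) ->
  Ex P (fun w => cos (\sum_i v i * X (pts i) w)) =
  expR (- ((\int[mu]_(s in `[0, 1]) (\sum_i v i * expR (- (s * pts i))) ^+ 2) / 2)).
Proof.
move=> pts0; set I01 := `[0 : R, 1]%classic.
have mI : measurable (I01 : set (measurableTypeR R)) by exact: measurable_itv.
pose f s := \sum_i v i * expR (- (s * pts i)).
pose K : R := m%:R * \sum_i v i ^+ 2.
have K0 : 0 <= K by rewrite mulr_ge0// sumr_ge0// => i _; rewrite sqr_ge0.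
pose M : R := (\sum_i `|v i|) ^+ 2.
have M0 : 0 <= M by exact: sqr_ge0.
have mf : measurable_fun setT f.
  by apply: measurable_sum => i; apply: measurable_funM => //; exact: measurable_laplace.
have mf2 : measurable_fun setT (fun s => f s ^+ 2) by exact: measurable_funX.
have hf s : 0 <= s <= 1 -> f s ^+ 2 <= M.
  move=> s01; rewrite -[leLHS]real_normK ?num_real// ler_sqr ?nnegrE ?sumr_ge0//.
  rewrite (le_trans (ler_norm_sum _ _ _))//; apply: ler_sum => i _.
  by rewrite normrM ler_piMr// laplace_le1.
apply: (@small_dist_eq _ _ _ (3 + M)) => [|e /andP[e0 e1]]; first by lra.
(* Combining with the coefficients [v] multiplies squared errors by at most [K], so both
   combinations have squared error at most [e^2]. *)
pose eta := e ^+ 2 / (K + 1).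
have K1 : 0 < K + 1 by lra.
have eta0 : 0 < eta by rewrite divr_gt0// exprn_gt0.
have Keta : K * eta <= e ^+ 2.
  by rewrite /eta mulrA ler_pdivrMr// mulrDr mulr1 mulrC lerDl sqr_ge0.
have /choice[phi hphi] : forall i, exists phi : step_fun R,
   (\int[mu]_(s in `[0%R, 1%R]) ((step_eval phi s - expR (- (s * pts i))) ^+ 2)%:E <= eta%:E)%E /\
   (\int[P]_w ((step_integral B phi w - X (pts i) w) ^+ 2)%:E <= eta%:E)%E.
  by move=> i; exact: wiener_step_approx.
pose q s := \sum_i v i * step_eval (phi i) s.
have bq : bounded_measurable q.
  by apply: bm_sum => i; apply: bmM; [exact: bm_cst|exact: bm_step_eval].
have [mq [Mq hMq]] := bq.
have mq2 : measurable_fun setT (fun s => q s ^+ 2) by exact: measurable_funX.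
have d1 : `|Ex P (fun w => cos (\sum_i v i * X (pts i) w)) -
    Ex P (fun w => cos (\sum_i v i * step_integral B (phi i) w))| <= e + K * eta / e.
  rewrite distrC; apply: Ex_cos_dist => //.
  - apply: measurable_sum => i; apply: measurable_funM => //; exact: measurable_step_integral.
  - by apply: measurable_sum => i; apply: measurable_funM.
  - apply: (@ge0_integral_sqr_sum_le _ _ P setT m v (fun i w => step_integral B (phi i) w)
      (fun i w => X (pts i) w)) => //.
    + by move=> i; exact: measurable_step_integral.
    + by move=> i; case: (hphi i).
have bqf x : 0 <= x <= 1 -> (q x - f x) ^+ 2 <= 2 * Mq ^+ 2 + 2 * M.
  move=> x01.
  have := hf x x01; have : q x ^+ 2 <= Mq ^+ 2.
    by rewrite -[leLHS]real_normK ?num_real// ler_sqr ?nnegrE// (le_trans _ (hMq x)).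
  have := sqr_ge0 (q x + f x); nra.
have iqf : mu.-integrable I01 (EFin \o (fun s => (q s - f s) ^+ 2)).
  apply: unit_integrable; first by apply: measurable_funX; exact: measurable_funB.
  by exists (2 * Mq ^+ 2 + 2 * M) => x x01; rewrite ger0_norm ?sqr_ge0// bqf.
have iq : mu.-integrable I01 (EFin \o (fun s => q s ^+ 2)).
  apply: unit_integrable => //; exists (Mq ^+ 2) => x x01; rewrite ger0_norm ?sqr_ge0//.
  by rewrite -[leLHS]real_normK ?num_real// ler_sqr ?nnegrE// (le_trans _ (hMq x)).
have if2 : mu.-integrable I01 (EFin \o (fun s => f s ^+ 2)).
  apply: unit_integrable => //; exists M => x x01; rewrite ger0_norm ?sqr_ge0//.
  exact: hf.
have d2 : \int[mu]_(s in I01) (q s - f s) ^+ 2 <= K * eta.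
  rewrite -lee_fin /Rintegral fineK; last exact: (integrable_fin_num mI iqf).
  apply: (@ge0_integral_sqr_sum_le _ _ mu I01 m v (fun i => step_eval (phi i))
      (fun i s => expR (- (s * pts i)))) => //.
  - by move=> i; apply: measurable_funTS; exact: measurable_step_eval.
  - by move=> i; apply: measurable_funTS; exact: measurable_laplace.
  - by move=> i; case: (hphi i).
have d3 : `|\int[mu]_(s in I01) q s ^+ 2 - \int[mu]_(s in I01) f s ^+ 2| <= (1 + e^-1) * (K * eta) + e * M.
  rewrite -RintegralB//.
  have iB : mu.-integrable I01 (EFin \o (fun s => q s ^+ 2 - f s ^+ 2)).
    by have := integrableB mI iq if2; exact.
  apply: (le_trans (le_normr_Rintegral mI iB)).
  have iZ : mu.-integrable I01 (EFin \o (fun s => (1 + e^-1) * (q s - f s) ^+ 2)).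
    by have := integrableZl mI (1 + e^-1) iqf; exact.
  have iC : mu.-integrable I01 (EFin \o (fun s => e * M)).
    by apply: unit_integrable => //; exists `|e * M|.
  apply: (@le_trans _ _ (\int[mu]_(s in I01) ((1 + e^-1) * (q s - f s) ^+ 2 + e * M))).
    apply: le_Rintegral => //.
    - exact: (integrable_norm iB).
    - have := integrableD mI iZ iC; exact.
    - move=> s; rewrite /I01/= in_itv/= => s01.
      by rewrite (le_trans (norm_sqr_sub_le _ _ e0))// lerD2l ler_wpM2l ?hf// ltW.
  rewrite RintegralD// RintegralZl//; apply: lerD.
    by rewrite ler_wpM2l// addr_ge0// invr_ge0 ltW.
  rewrite Rintegral_cst// [X in fine X]lebesgue_measure_itv/= lte_fin ltr01 /=.
  by rewrite subr0 mulr1.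
have := Ex_cos_step BM v phi; rewrite -/I01 -/q => ES.
rewrite ES in d1.
have I0 : 0 <= \int[mu]_(s in I01) q s ^+ 2 by apply: Rintegral_ge0 => s _; exact: sqr_ge0.
have I1 : 0 <= \int[mu]_(s in I01) f s ^+ 2 by apply: Rintegral_ge0 => s _; exact: sqr_ge0.
rewrite -/f.
set a := \int[mu]_(s in I01) q s ^+ 2 in d1 d3 I0.
set b := \int[mu]_(s in I01) f s ^+ 2 in d3 I1 *.
have d4 : `|expR (- (a / 2)) - expR (- (b / 2))| <= `|a - b| / 2.
  have i2 : `|2^-1| = 2^-1 :> R by rewrite ger0_norm.
  have := @expRN_lipschitz R (a / 2) (b / 2); rewrite -mulrBl normrM i2.
  by apply; rewrite divr_ge0.
have Ke : K * eta / e <= e by rewrite ler_pdivrMr// -expr2.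
have Ke2 : e^-1 * (K * eta) <= e by rewrite mulrC.
apply: (le_trans (ler_distD (expR (- (a / 2))) _ _)).
have : e ^+ 2 <= e by rewrite expr2 ler_piMr// ltW.
have eM : 0 <= e * M by rewrite mulr_ge0// ltW.
rewrite mulrDl mul1r in d3; lra.
Qed.

End wiener_combination.

(** * Small balls of Gaussian fields *)

Lemma Ex_fubini (d d' : measure_display) (T : measurableType d)
    (T' : measurableType d') (R : realType) (P : probability T R)
    (P' : probability T' R) (F : T * T' -> R) : bounded_measurable F ->
  Ex P (fun x => Ex P' (fun y => F (x, y))) =
  Ex P' (fun y => Ex P (fun x => F (x, y))).
Proof.
move=> [mF [M hM]].
have b1 x : bounded_measurable (fun y => F (x, y)).
  split; last by exists M => y.
  by apply: measurableT_comp => //; exact: pair1_measurable.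
have b2 y : bounded_measurable (fun x => F (x, y)).
  split; last by exists M => x.
  by apply: measurableT_comp => //; exact: pair2_measurable.
have iF : (P \x P')%E.-integrable setT (EFin \o F).
  apply: measurable_bounded_integrable => //.
    rewrite -setXTT [X in (X < _)%E]product_measure1E//.
    by rewrite [X in (X * _)%E]probability_setT [X in (_ * X)%E]probability_setT mule1 ltry.
  exists M; split; first exact: num_real.
  by move=> y My x _; apply: le_trans (hM x) _; exact: ltW.
have := Fubini iF => /= h.
rewrite /Ex /Rintegral; congr fine.
under eq_integral do rewrite -[X in X%:E]/(Ex P' (fun y => F (_, y))) -ExE//.
under [RHS]eq_integral do rewrite -[X in X%:E]/(Ex P (fun x => F (x, _))) -ExE//.
exact: h.
Qed.

(** Null vectors are allowed: different coefficient rows represent the same function as soon as a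
    node is repeated, and in the lower bound the tested times may coincide with nodes. *)
Record semi_inner (R : realType) (V : lmodType R) (q : V -> V -> R) : Prop := {
  form_sym : forall u v, q u v = q v u ;
  form_linear : forall (a : R) u v w, q (a *: u + v) w = a * q u w + q v w ;
  form_nneg : forall u, 0 <= q u u }.

Section semi_inner_theory.
Context (R : realType) (V : lmodType R) (q : V -> V -> R).
Hypothesis Q : semi_inner q.

Lemma form0l v : q 0 v = 0.
Proof. by have := form_linear Q (-1) 0 0 v; rewrite scaler0 addr0; lra. Qed.

Lemma formZl (a : R) u v : q (a *: u) v = a * q u v.
Proof. by rewrite -[a *: u]addr0 (form_linear Q) form0l addr0. Qed.

Lemma formZr (a : R) u v : q u (a *: v) = a * q u v.
Proof. by rewrite (form_sym Q) formZl (form_sym Q). Qed.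

Lemma formDl u v w : q (u + v) w = q u w + q v w.
Proof. by rewrite -[u]scale1r (form_linear Q) mul1r scale1r. Qed.

Lemma formDr u v w : q w (u + v) = q w u + q w v.
Proof. by rewrite !(form_sym Q w) formDl. Qed.

Lemma formNl u v : q (- u) v = - q u v.
Proof. by rewrite -scaleN1r formZl mulN1r. Qed.

Lemma formBl u v w : q (u - v) w = q u w - q v w.
Proof. by rewrite formDl formNl. Qed.

Lemma form_suml (I : Type) (s : seq I) (p : pred I) (F : I -> V) v :
  q (\sum_(i <- s | p i) F i) v = \sum_(i <- s | p i) q (F i) v.
Proof.
elim: s => [|i s IH]; first by rewrite !big_nil form0l.
by rewrite !big_cons; case: (p i) => //; rewrite formDl IH.
Qed.

Lemma form_quad (a : R) u v :
  q (a *: u + v) (a *: u + v) = a ^+ 2 * q u u + 2 * a * q v u + q v v.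
Proof.
rewrite (form_linear Q) (form_sym Q u) (form_sym Q v) !(form_linear Q).
rewrite (form_sym Q u v); ring.
Qed.

Lemma form_null u v : q u u = 0 -> q v u = 0.
Proof.
move=> u0; apply/eqP; apply: contraT => vu0.
(* If [q v u] were nonzero, this multiple of [u] added to [v] would have square norm [-1]. *)
have := form_nneg Q ((- (q v v + 1) / (2 * q v u)) *: u + v).
rewrite form_quad u0 mulr0 add0r (_ : _ + _ = - 1); first by rewrite oppr_ge0 ler10.
by field.
Qed.

Lemma form_cauchy_schwarz u v : q v u ^+ 2 <= q v v * q u u.
Proof.
have := form_nneg Q u; rewrite le_eqVlt => /predU1P[/esym u0|u0].
  by rewrite (form_null _ u0) u0 mulr0 expr0n.
have := form_nneg Q ((- (q v u / q u u)) *: u + v).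
rewrite form_quad (_ : _ + _ = (q v v * q u u - q v u ^+ 2) / q u u); last first.
  by field; rewrite gt_eqF.
by rewrite pmulr_lge0 ?invr_gt0// subr_ge0.
Qed.

End semi_inner_theory.

(** * Exponential tilts of Gaussian fields *)

Section tilting.
Context (d : measure_display) (T : measurableType d) (R : realType).
Variables (P : probability T R) (V : lmodType R) (W : V -> T -> R).
Hypothesis W_linear : forall (a : R) u v w, W (a *: u + v) w = a * W u w + W v w.
Hypothesis W_measurable : forall v, measurable_fun setT (W v).
(** Kept as a hypothesis because it is obtained from the Brownian motion, in
    [Ex_standard_normal_cos]. *)
Hypothesis normal_cos : forall c : R,
  Ex (normal_prob 0 1) (fun x : measurableTypeR R => cos (c * x)) = expR (- (c ^+ 2 / 2)).

(* The measure [Phi dP] has total mass [Z], and normalised it makes [W] a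
   centred Gaussian field with covariance [q]. *)
Record gaussian_weight (Phi : T -> R) (Z : R) (q : V -> V -> R) : Prop := {
  weight_measurable : measurable_fun setT Phi ;
  weight_ge0 : forall w, 0 <= Phi w ;
  weight_le1 : forall w, Phi w <= 1 ;
  weight_mass : 0 < Z ;
  weight_form : semi_inner q ;
  weight_char : forall v,
    Ex P (fun w => Phi w * cos (W v w)) = Z * expR (- (q v v / 2)) }.

Variables (Phi : T -> R) (Z : R) (q : V -> V -> R).
Hypothesis G : gaussian_weight Phi Z q.

Lemma weight_bm : bounded_measurable Phi.
Proof.
split; first exact: weight_measurable G.
by exists 1 => w; rewrite ger0_norm ?(weight_ge0 G)// (weight_le1 G).
Qed.

Let Q : semi_inner q := weight_form G.

Lemma weight_mass_eq : Ex P Phi = Z.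
Proof.
have := weight_char G 0; have W0 w : W 0 w = 0.
  by have := W_linear (-1) 0 0 w; rewrite scaler0 addr0; lra.
under eq_fun do rewrite W0 cos0 mulr1.
rewrite (form0l Q).
by rewrite mul0r oppr0 expR0 mulr1.
Qed.

(* [exp (- s x^2 / 2)] is the mean of [cos (sqrt s * g * x)] over a standard
   normal [g], so the tilted characteristic function is a Gaussian integral. *)
Lemma gaussian_weight_step u s : 0 <= s ->
  gaussian_weight (fun w => Phi w * expR (- (s * W u w ^+ 2 / 2)))
    (Z / Num.sqrt (1 + s * q u u))
    (fun v v' => q v v' - s * q v u * q v' u / (1 + s * q u u)).
Proof.
move=> s0; have uu := form_nneg Q u.
have D0 : 0 < 1 + s * q u u by rewrite ltr_pwDl// mulr_ge0.
have E1 w : expR (- (s * W u w ^+ 2 / 2)) <= 1.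
  by rewrite -expR0 ler_expR oppr_le0 divr_ge0// mulr_ge0// sqr_ge0.
split.
- apply: measurable_funM; first exact: weight_measurable G.
  apply: measurableT_comp => //; apply: measurable_funN; apply: measurable_funM => //.
  by apply: measurable_funM => //; exact: measurable_funX.
- by move=> w; rewrite mulr_ge0 ?(weight_ge0 G)// expR_ge0.
- by move=> w; rewrite mulr_ile1 ?(weight_ge0 G) ?expR_ge0 ?(weight_le1 G).
- by rewrite divr_gt0 ?(weight_mass G)// sqrtr_gt0.
- split.
  + by move=> v v'; rewrite (form_sym Q v v'); ring.
  + by move=> a x y z; rewrite !(form_linear Q); ring.
  + move=> v; rewrite subr_ge0 ler_pdivrMr// -mulrA -expr2.
    have := form_cauchy_schwarz Q u v; have := form_nneg Q v; nra.
move=> v; set b := Num.sqrt s.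
have bs : b ^+ 2 = s by rewrite sqr_sqrtr.
pose F (z : T * measurableTypeR R) := Phi z.1 * cos (W v z.1) * cos (b * W u z.1 * z.2).
have mW1 x : measurable_fun setT (fun z : T * measurableTypeR R => W x z.1).
  by apply: measurableT_comp => //; exact: measurable_fst.
have bF : bounded_measurable F.
  apply: bmM; first apply: bmM.
  - apply: (@bm_comp _ _ _ _ _ Phi fst); first exact: weight_bm.
    exact: measurable_fst.
  - exact: bm_cos.
  - apply: bm_cos; apply: measurable_funM; last exact: measurable_snd.
    exact: measurable_funM.
have bc c : bounded_measurable (fun x : measurableTypeR R => cos (c * x)).
  by apply: bm_cos; apply: measurable_funM.
transitivity (Ex P (fun x => Ex (normal_prob 0 1) (fun y => F (x, y)))).
  congr (Ex P); apply/funext => w; rewrite /F/= ExZ// normal_cos exprMn bs.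
  by rewrite mulrAC.
rewrite Ex_fubini//.
have a0 : 0 <= s * q u u by rewrite mulr_ge0.
(* When the quadratic coefficient vanishes, either [s = 0] or [u] is a null vector; in both cases
   the linear coefficient vanishes too, so the Gaussian integral below stays bounded. *)
have ab c : c ^+ 2 = (b * q v u) ^+ 2 -> s * q u u = 0 -> c = 0.
  move=> cE suu; apply/eqP; rewrite -sqrf_eq0 cE sqrf_eq0 mulf_eq0.
  move/eqP: suu; rewrite mulf_eq0 => /orP[/eqP s00|/eqP u0].
    by rewrite /b s00 sqrtr0 eqxx.
  by rewrite (form_null Q _ u0) eqxx orbT.
pose g c (y : measurableTypeR R) := expR (c * y - s * q u u * y ^+ 2 / 2).
have bg c : c ^+ 2 = (b * q v u) ^+ 2 -> bounded_measurable (g c).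
  by move=> cE; apply: gauss_bm => // ; exact: ab.
have inner y : Ex P (fun x => F (x, y)) =
    Z * expR (- (q v v / 2)) / 2 * (g (b * q v u) y + g (- (b * q v u)) y).
  (* The product of two cosines is half a sum of cosines of the field at [v + b y u] and
     [v - b y u], where the characteristic function is known. *)
  have -> : (fun x => F (x, y)) = (fun x => 2^-1 *
     (Phi x * cos (W ((b * y) *: u + v) x) + Phi x * cos (W ((- (b * y)) *: u + v) x))).
    apply/funext => x; rewrite /F/= !W_linear.
    rewrite mulNr [- _ + _]addrC (cosB (W v x)) (addrC _ (W v x)) cosD.
    rewrite (mulrAC b y); by field.
  have bP x : bounded_measurable (fun w => Phi w * cos (W x w)).
    by apply: bmM; [exact: weight_bm|exact: bm_cos].
  rewrite ExZ; last exact: bmD.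
  rewrite ExD// !(weight_char G) !(form_quad Q).
  have e1 k : Z * expR (- (((k * (b * y)) ^+ 2 * q u u + 2 * (k * (b * y)) * q v u + q v v) / 2)) =
     Z * expR (- (q v v / 2)) * expR (- (k * (b * q v u)) * y - s * k ^+ 2 * q u u * y ^+ 2 / 2).
    rewrite -[RHS]mulrA -expRD; congr (_ * expR _); rewrite -bs; by field.
  have e2 := e1 1; have e3 := e1 (-1).
  rewrite !mul1r expr1n mulr1 in e2; rewrite !mulN1r (sqrrN 1) expr1n mulr1 opprK in e3.
  rewrite e2 e3 /g; by field.
under eq_fun do rewrite inner.
rewrite ExZ; last by apply: bmD; apply: bg; rewrite ?sqrrN.
rewrite ExD; [|by apply: bg|by apply: bg; rewrite sqrrN].
rewrite /g !Ex_normal_gauss//; try by apply: ab; rewrite ?sqrrN.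
rewrite !expr1n !mulr1 sqrrN exprMn bs.
set z := Num.sqrt _.
rewrite (_ : - ((q v v - s * q v u * q v u / (1 + s * q u u)) / 2) =
   - (q v v / 2) + s * q v u ^+ 2 / (2 * (1 + s * q u u))); last first.
  by field; rewrite gt_eqF.
rewrite expRD; field; rewrite gt_eqF// sqrtr_gt0//.
Qed.

End tilting.

Section norm_events.
Context (d : measure_display) (T : measurableType d) (R : realType).

Lemma measurable_norm_le (I : set nat) (Y : nat -> T -> R) (c : R) :
  (forall j, measurable_fun setT (Y j)) ->
  measurable [set w | forall j, I j -> `|Y j w| <= c].
Proof.
move=> mY; rewrite (_ : [set w | _] = \bigcap_(j in I) [set w | `|Y j w| <= c]).
  apply: bigcap_measurableType => j _.
  rewrite (_ : [set w | _] = (fun w => `|Y j w|) @^-1` `]-oo, c]).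
    by rewrite -[_ @^-1` _]setTI; apply: measurableT_comp => //; exact: measurableT_comp.
  by apply/seteqP; split => w /=; rewrite in_itv.
by apply/seteqP; split => w.
Qed.

Lemma bm_norm_gt (Y : T -> R) (c : R) : measurable_fun setT Y ->
  bounded_measurable (fun w => (c < `|Y w|)%R%:R : R).
Proof.
move=> mY; rewrite (_ : (fun w => _) = \1_[set w | c < `|Y w|]).
  apply: bm_indic; rewrite (_ : [set w | _] = (fun w => `|Y w|) @^-1` `]c, +oo[).
    by rewrite -[_ @^-1` _]setTI; apply: measurableT_comp => //; exact: measurableT_comp.
  by apply/seteqP; split => w /=; rewrite in_itv/= andbT.
by apply/funext => w; rewrite indicE mem_setE.
Qed.

End norm_events.

(** * Gram-Schmidt for semi-definite forms *)

Section gram_schmidt.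
Context (R : realType) (V : lmodType R) (q : V -> V -> R).
Hypothesis Q : semi_inner q.
Variable e : nat -> V.

(** Norm 0 stands for a vector dependent on its predecessors. The triangular expansion is stated
    only through [q], since it holds only modulo null vectors. *)
Record gram_schmidt_family (n : nat) (eps : nat -> V) : Prop := {
  gs_orth : forall l m, (l < n)%N -> (m < n)%N -> l != m -> q (eps l) (eps m) = 0 ;
  gs_norm : forall l, (l < n)%N -> q (eps l) (eps l) = 0 \/ q (eps l) (eps l) = 1 ;
  gs_expand : forall i, (i < n)%N -> forall v,
    q v (e i) = \sum_(j < i.+1) q (e i) (eps j) * q v (eps j) }.

Definition gs_residual (n : nat) (eps : nat -> V) (v : V) : V :=
  v - \sum_(l < n) q v (eps l) *: eps l.

Lemma gs_residual_orth n eps v l :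
  (forall l m, (l < n)%N -> (m < n)%N -> l != m -> q (eps l) (eps m) = 0) ->
  (forall l, (l < n)%N -> q (eps l) (eps l) = 0 \/ q (eps l) (eps l) = 1) ->
  (l < n)%N -> q (gs_residual n eps v) (eps l) = 0.
Proof.
move=> ho hn ln; rewrite /gs_residual (formBl Q) (form_suml Q).
rewrite (bigD1 (Ordinal ln))//= (formZl Q) big1 ?addr0; last first.
  by move=> i il; rewrite (formZl Q) ho ?mulr0// ?ltn_ord.
case: (hn _ ln) => h; last by rewrite h mulr1 subrr.
by rewrite h mulr0 (form_null Q _ h) subrr.
Qed.

Lemma gram_schmidt n : exists eps, gram_schmidt_family n eps.
Proof.
elim: n => [|n [eps [ho hn he]]]; first by exists (fun=> 0); split.
pose r := gs_residual n eps (e n); pose N := q r r.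
have N0 : 0 <= N by exact: form_nneg Q r.
(* If [N = 0] the inverse is 0 by convention, so [new] is 0 and falls under the alternative of norm
   0. *)
pose new := (Num.sqrt N)^-1 *: r.
have new_orth l : (l < n)%N -> q new (eps l) = 0.
  by move=> ln; rewrite (formZl Q) gs_residual_orth ?mulr0.
pose eps' l := if l == n then new else eps l.
have eps'n : eps' n = new by rewrite /eps' eqxx.
have eps'l l : (l < n)%N -> eps' l = eps l.
  by move=> ln; rewrite /eps' ltn_eqF.
have lt_succ l : (l < n.+1)%N -> l = n \/ (l < n)%N.
  by rewrite ltnS leq_eqVlt => /predU1P.
have new_norm : q new new = 0 \/ q new new = 1.
  rewrite (formZl Q) (formZr Q) -/N mulrA -expr2 exprVn sqr_sqrtr//.
  have [->|h] := eqVneq N 0; first by left; rewrite mulr0.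
  by right; rewrite mulVf.
have new_e v : q v (e n) = \sum_(j < n) q (e n) (eps j) * q v (eps j) + q (e n) new * q v new.
  have en : e n = r + \sum_(l < n) q (e n) (eps l) *: eps l by rewrite subrK.
  have rn : q r new = Num.sqrt N.
    rewrite (formZr Q) -/N; have [->|h] := eqVneq N 0; first by rewrite mulr0 sqrtr0.
    rewrite -{2}[N](@sqr_sqrtr R)// expr2 mulKf//.
    by rewrite sqrtr_eq0 -ltNge lt_neqAle eq_sym h.
  have -> : q (e n) new = Num.sqrt N.
    rewrite {1}en (formDl Q) rn (form_suml Q) big1 ?addr0// => i _.
    by rewrite (formZl Q) (form_sym Q _ new) new_orth ?mulr0.
  rewrite {1}en (formDr Q) addrC (form_sym Q v (\sum_(_ < _) _)) (form_suml Q); congr (_ + _).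
    by apply: eq_bigr => i _; rewrite (formZl Q) (form_sym Q v).
  rewrite (formZr Q); have [h|h] := eqVneq N 0.
    by rewrite (form_null Q _ h) h sqrtr0 mul0r.
  by rewrite mulVKf// sqrtr_eq0 -ltNge lt_neqAle eq_sym h.
exists eps'; split.
- move=> l m /lt_succ[->|ln] /lt_succ[->|mn]; rewrite ?eqxx// ?eps'n ?eps'l//.
  + by rewrite new_orth.
  + by rewrite (form_sym Q) new_orth.
  + exact: ho.
- by move=> l /lt_succ[->|ln]; rewrite ?eps'n// eps'l//; exact: hn.
- move=> i /lt_succ[->|i_n] v.
    rewrite big_ord_recr/= eps'n new_e; congr (_ + _).
    by apply: eq_bigr => j _; rewrite eps'l.
  rewrite he//; apply: eq_bigr => j _; rewrite eps'l//.
  by rewrite (leq_trans (ltn_ord j)).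
Qed.

Variables (n : nat) (eps : nat -> V).
Hypothesis GS : gram_schmidt_family n eps.

Lemma gs_orth_prev i l : (i < l)%N -> (l < n)%N -> q (e i) (eps l) = 0.
Proof.
move=> il ln; rewrite (form_sym Q) (gs_expand GS) ?(ltn_trans il)//.
rewrite big1// => j _; rewrite [X in _ * X](gs_orth GS) ?mulr0//.
  by apply: ltn_trans ln; exact: leq_trans (ltn_ord j) il.
by rewrite gtn_eqF// (leq_trans (ltn_ord j)).
Qed.

(** [eps l] is orthogonal to [e 0, ..., e (l - 1)], so the coefficient is unchanged when any
    combination of these is subtracted from [v]; Cauchy-Schwarz concludes. *)
Lemma gs_coef_le v l (c : nat -> R) : (l < n)%N ->
  q v (eps l) ^+ 2 <= q (v - \sum_(i < l) c i *: e i) (v - \sum_(i < l) c i *: e i).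
Proof.
move=> ln; set p := \sum_(i < l) _.
have -> : q v (eps l) = q (v - p) (eps l).
  rewrite (formBl Q) (form_suml Q) big1 ?subr0// => i _.
  by rewrite (formZl Q) gs_orth_prev ?mulr0.
apply: (le_trans (form_cauchy_schwarz Q _ _)).
by case: (gs_norm GS ln) => ->; rewrite ?mulr0 ?mulr1// (form_nneg Q).
Qed.

(** Pythagoras: the residual is orthogonal to every [eps l], hence to every [e i]. *)
Lemma gs_residual_le v (c : nat -> R) :
  q (gs_residual n eps v) (gs_residual n eps v) <=
  q (v - \sum_(i < n) c i *: e i) (v - \sum_(i < n) c i *: e i).
Proof.
set r := gs_residual n eps v; pose h := \sum_(l < n) q v (eps l) *: eps l - \sum_(i < n) c i *: e i.
have -> : v - \sum_(i < n) c i *: e i = 1 *: h + r.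
  by rewrite scale1r [RHS]addrC /r /gs_residual /h addrA subrK.
have rh : q r h = 0.
  have re l : (l < n)%N -> q r (eps l) = 0.
    by apply: gs_residual_orth; [exact: gs_orth GS|exact: gs_norm GS].
  rewrite (form_sym Q) (formBl Q) !(form_suml Q) !big1 ?subrr// => i _.
    rewrite (formZl Q) (form_sym Q) (gs_expand GS)// big1 ?mulr0// => j _.
    by rewrite re ?mulr0// (leq_trans (ltn_ord j)).
  by rewrite (formZl Q) (form_sym Q _ r) re ?mulr0.
by rewrite (form_quad Q) rh mulr0 addr0 lerDr mulr_ge0 ?sqr_ge0// (form_nneg Q).
Qed.

End gram_schmidt.

(** * Upper and lower small ball bounds for a general Gaussian field *)

Section gaussian_small_balls.
Context (d : measure_display) (T : measurableType d) (R : realType).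
Variables (P : probability T R) (V : lmodType R) (W : V -> T -> R).
Hypothesis W_linear : forall (a : R) u v w, W (a *: u + v) w = a * W u w + W v w.
Hypothesis W_measurable : forall v, measurable_fun setT (W v).
Hypothesis normal_cos : forall c : R,
  Ex (normal_prob 0 1) (fun x : measurableTypeR R => cos (c * x)) = expR (- (c ^+ 2 / 2)).
Variable q0 : V -> V -> R.
Hypothesis G0 : gaussian_weight P W (fun=> 1) 1 q0.

Let Q0 : semi_inner q0 := weight_form G0.

Definition tilt n (s : nat -> R) (u : nat -> V) (w : T) : R :=
  expR (- \sum_(i < n) (s i * W (u i) w ^+ 2 / 2)).

Lemma tiltS n s u w :
  tilt n.+1 s u w = tilt n s u w * expR (- (s n * W (u n) w ^+ 2 / 2)).
Proof. by rewrite /tilt big_ord_recr/= opprD expRD. Qed.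

Lemma tilt_step n s u Z q : 0 <= s n -> gaussian_weight P W (tilt n s u) Z q ->
  gaussian_weight P W (tilt n.+1 s u) (Z / Num.sqrt (1 + s n * q (u n) (u n)))
    (fun v v' => q v v' - s n * q v (u n) * q v' (u n) / (1 + s n * q (u n) (u n))).
Proof.
move=> sn G; have := gaussian_weight_step W_linear W_measurable normal_cos G (u n) sn.
by under [in X in X -> _]eq_fun do rewrite -tiltS.
Qed.

Lemma tilt0 s u : tilt 0 s u = (fun=> 1).
Proof. by apply/funext => w; rewrite /tilt big_ord0 oppr0 expR0. Qed.

Section upper.
Variables (N : nat) (u : nat -> V) (s : R) (D : nat -> R).
Hypothesis s_gt0 : 0 < s.
Hypothesis D_gt0 : forall i, (i < N)%N -> 0 < D i.
Hypothesis ridge : forall i (c : nat -> R), (i < N)%N ->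
  D i <= q0 (u i - \sum_(j < i) c j *: u j) (u i - \sum_(j < i) c j *: u j)
         + (\sum_(j < i) c j ^+ 2 + 1) / s.

(** The tilted variance of [v] is the ridge regression error of [v] on the vectors already used,
    with penalty [1 / s]. It is enough to know that it is attained at some [c], because [ridge]
    bounds the error below for every [c]. *)
Lemma tilt_mass_le n : (n <= N)%N -> exists Z q,
  [/\ gaussian_weight P W (tilt n (fun=> s) u) Z q,
    forall v, exists c : nat -> R,
     q v v = q0 (v - \sum_(j < n) c j *: u j) (v - \sum_(j < n) c j *: u j)
             + (\sum_(j < n) c j ^+ 2) / s &
    Z <= \prod_(i < n) (Num.sqrt (s * D i))^-1].
Proof.
elim: n => [_|n IH nN].
  exists 1, q0; rewrite tilt0 big_ord0; split => // v; exists (fun=> 0).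
  by rewrite !big_ord0 subr0 mul0r addr0.
have [Z [q [G hq hZ]]] := IH (ltnW nN).
set E := 1 + s * q (u n) (u n).
have E0 : 0 < E by rewrite ltr_pwDl// mulr_ge0 ?(ltW s_gt0)// (form_nneg (weight_form G)).
exists (Z / Num.sqrt E), (fun v v' => q v v' - s * q v (u n) * q v' (u n) / E); split.
- exact: (tilt_step (ltW s_gt0) G).
(* [k] is the ridge coefficient on the new vector: it minimises
   [q (v - k u_n) (v - k u_n) + k^2 / s], and the minimum is the updated variance. *)
- move=> v; pose k := s * q v (u n) / E.
  have [c hc] := hq (v - k *: u n).
  exists (fun j => if j == n then k else c j).
  rewrite !big_ord_recr/= eqxx.
  have -> : \sum_(i < n) (if i == n :> nat then k else c i) *: u i = \sum_(i < n) c i *: u i.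
    by apply: eq_bigr => i _; rewrite ltn_eqF.
  have -> : \sum_(i < n) (if i == n :> nat then k else c i) ^+ 2 = \sum_(i < n) c i ^+ 2.
    by apply: eq_bigr => i _; rewrite ltn_eqF.
  have -> : v - (\sum_(i < n) c i *: u i + k *: u n) =
            (v - k *: u n) - \sum_(i < n) c i *: u i by rewrite opprD addrA addrAC.
  rewrite mulrDl addrA -hc.
  have -> : v - k *: u n = (- k) *: u n + v by rewrite scaleNr addrC.
  rewrite (form_quad (weight_form G)) /k; have sn : s != 0 by rewrite gt_eqF.
  have -> : q (u n) (u n) = (E - 1) / s by rewrite /E; field.
  by field; rewrite sn gt_eqF.
- rewrite big_ord_recr/=; apply: ler_pM => //.
  + exact: ltW (weight_mass G).
  (* The [+ 1] in the penalty of [ridge] is the unit coefficient of [u n] itself; multiplied by [s]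
     it gives the 1 in [E], whence [s * D n <= E]. *)
  have [c hc] := hq (u n); have := ridge c nN; rewrite mulrDl mul1r addrA -hc => h.
  rewrite lef_pV2 ?posrE ?sqrtr_gt0 ?mulr_gt0 ?D_gt0// ler_wsqrtr//.
  rewrite /E; move: h; rewrite -(ler_pM2l s_gt0) mulrDr divff ?gt_eqF//; lra.
Qed.

(* Markov's inequality for the mass of the tilt by [exp (- |W u|^2 / (2 delta^2))];
   [D i] bounds below the ridge regression error of [u i] on its predecessors. *)
Lemma gaussian_small_ball_upper (delta : R) : 0 < delta -> s = delta ^- 2 ->
  fine (P [set w | forall i, (i < N)%N -> `|W (u i) w| <= delta]) <=
  \prod_(i < N) (expR (2^-1) * delta / Num.sqrt (D i)).
Proof.
move=> d0 sE; have [Z [q [G _ hZ]]] := tilt_mass_le (leqnn N).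
set A := [set w | _].
have mA : measurable A.
  exact: (@measurable_norm_le _ _ _ [set i | (i < N)%N] (fun i => W (u i))).
rewrite -Ex_indic//.
apply: (@le_trans _ _ (expR (N%:R / 2) * Z)).
  rewrite -(weight_mass_eq W_linear G) -ExZ; last exact: weight_bm G.
  apply: le_Ex.
  - exact: bm_indic.
  - by apply: bmM; [exact: bm_cst|exact: weight_bm G].
  move=> w; rewrite indicE; have [wA|_] := boolP (w \in A); last first.
    by rewrite mulr_ge0 ?expR_ge0.
  move: wA; rewrite inE => wA.
  rewrite /tilt -expRD -[leLHS]expR0 ler_expR subr_ge0.
  have -> : N%:R / 2 = \sum_(i < N) (2^-1 : R).
    by rewrite sumr_const card_ord mulr_natl.
  apply: ler_sum => i _; rewrite ler_pdivrMr// mulVf//.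
  rewrite sE mulrC ler_pdivrMr ?exprn_gt0// mul1r.
  by rewrite -[leLHS]real_normK ?num_real// lerXn2r ?nnegrE ?(ltW d0)// wA.
apply: (le_trans (ler_wpM2l (expR_ge0 _) hZ)).
have -> : expR (N%:R / 2) = \prod_(i < N) expR (2^-1 : R).
  by rewrite prodr_const card_ord expRM_natl.
rewrite -big_split/=; apply: ler_prod => i _; rewrite mulr_ge0 ?expR_ge0 ?invr_ge0 ?sqrtr_ge0//=.
rewrite -mulrA ler_wpM2l ?expR_ge0// sE sqrtrM ?invr_ge0 ?sqr_ge0//.
by rewrite sqrtrV ?sqr_ge0// sqrtr_sqr ger0_norm ?(ltW d0)// invfM invrK.
Qed.

End upper.

(** The second moment is replaced by a bounded function: where [|W u| > beta], the extra tilt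
    [exp (- (W u)^2 / beta^2)] is at most 1/2, so the indicator is at most twice one minus this
    tilt, and the mean is a difference of two known masses. *)
Lemma weight_chebyshev Phi Z q u (beta : R) : gaussian_weight P W Phi Z q ->
  0 < beta ->
  Ex P (fun w => Phi w * (beta < `|W u w|)%R%:R) <= 2 * Z * q u u / beta ^+ 2.
Proof.
move=> G b0; have k0 : 0 <= 2 / beta ^+ 2 by rewrite divr_ge0// sqr_ge0.
have G' := gaussian_weight_step W_linear W_measurable normal_cos G u k0.
have quu := form_nneg (weight_form G) u; have Z0 := weight_mass G.
have bI := bm_norm_gt beta (W_measurable u).
have bP := weight_bm G; have bP' := weight_bm G'.
apply: (@le_trans _ _ (Ex P (fun w => 2 * (Phi w - Phi w * expR (- (2 / beta ^+ 2 * W u w ^+ 2 / 2)))))).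
  apply: le_Ex; [exact: bmM|by apply: bmM; [exact: bm_cst|exact: bmB]|].
  move=> w; have Phi0 := weight_ge0 G w.
  set x := expR _; have x1 : x <= 1.
    by rewrite -expR0 ler_expR oppr_le0 divr_ge0// mulr_ge0// sqr_ge0.
  have [h|h] := ltP beta `|W u w|; last first.
    by rewrite mulr0 mulr_ge0// subr_ge0 ler_piMr.
  suff : x <= 2^-1 by rewrite mulr1; nra.
  have y1 : 1 <= 2 / beta ^+ 2 * W u w ^+ 2 / 2.
    have -> : 2 / beta ^+ 2 * W u w ^+ 2 / 2 = W u w ^+ 2 / beta ^+ 2.
      by field; rewrite gt_eqF.
    rewrite ler_pdivlMr ?exprn_gt0// mul1r.
    by rewrite -[leRHS]real_normK ?num_real// lerXn2r ?nnegrE// ltW.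
  have := expR_ge1Dx (2 / beta ^+ 2 * W u w ^+ 2 / 2).
  by rewrite /x expRN => h2; rewrite lef_pV2 ?posrE ?expR_gt0//; lra.
rewrite ExZ; last exact: bmB.
rewrite ExB// (weight_mass_eq W_linear G) (weight_mass_eq W_linear G').
have k1 : 0 <= 2 / beta ^+ 2 * q u u by rewrite mulr_ge0.
have := invsqrt_ge k1; set z := (Num.sqrt _)^-1 => hz.
have -> : 2 * Z * q u u / beta ^+ 2 = Z * (2 / beta ^+ 2 * q u u) by field; rewrite gt_eqF.
nra.
Qed.

Lemma field0 w : W 0 w = 0.
Proof. by have := W_linear (-1) 0 0 w; rewrite scaler0 addr0; lra. Qed.

Lemma field_sum n (a : nat -> R) (u : nat -> V) w :
  W (\sum_(l < n) a l *: u l) w = \sum_(l < n) a l * W (u l) w.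
Proof.
elim: n => [|n IH]; first by rewrite !big_ord0 field0.
by rewrite !big_ord_recr/= addrC W_linear IH addrC.
Qed.

Lemma fieldB u v w : W (u - v) w = W u w - W v w.
Proof. by rewrite addrC -scaleN1r W_linear mulN1r addrC. Qed.

Section lower.
Variables (n k : nat) (e f : nat -> V) (rho beta s : nat -> R) (delta : R).
Hypothesis delta_gt0 : 0 < delta.
Hypothesis rho_ge0 : forall l, 0 <= rho l.
Hypothesis beta_gt0 : forall l, 0 < beta l.
Hypothesis s_ge0 : forall l, 0 <= s l.
Hypothesis dist_le : forall j l, (j < k)%N -> (l <= n)%N -> exists c : nat -> R,
  q0 (f j - \sum_(i < l) c i *: e i) (f j - \sum_(i < l) c i *: e i) <= rho l ^+ 2.
Hypothesis tail_le : \sum_(l < n) (beta l ^+ 2 * (1 + s l))^-1 <= 1 / 8.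
Hypothesis sum_le : \sum_(l < n) rho l * beta l <= delta / 2.
Hypothesis rest_le : k%:R * rho n ^+ 2 / delta ^+ 2 <= 1 / 32.

(** By orthogonality the earlier tilts do not affect the covariances with [eps m], so the tilts act
    coordinate by coordinate and the masses multiply. *)
Lemma tilt_orthonormal eps m : gram_schmidt_family q0 e n eps -> (m <= n)%N ->
  exists Z q,
  [/\ gaussian_weight P W (tilt m s eps) Z q,
    forall v v', q v v' = q0 v v' -
      \sum_(l < m) s l * q0 v (eps l) * q0 v' (eps l) / (1 + s l * q0 (eps l) (eps l)) &
    \prod_(l < m) (Num.sqrt (1 + s l))^-1 <= Z].
Proof.
move=> GS; elim: m => [_|m IH mn].
  exists 1, q0; rewrite tilt0 big_ord0; split => // v v'.
  by rewrite big_ord0 subr0.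
have [Z [q [G hq hZ]]] := IH (ltnW mn).
have qe v : q v (eps m) = q0 v (eps m).
  rewrite hq big1 ?subr0// => l _; rewrite [X in _ * X / _](gs_orth GS) ?mulr0 ?mul0r//.
    by rewrite (ltn_trans (ltn_ord l)).
  by rewrite gtn_eqF.
have kap : 0 <= q0 (eps m) (eps m) <= 1.
  by case: (gs_norm GS mn) => ->; rewrite lexx ler01.
exists (Z / Num.sqrt (1 + s m * q (eps m) (eps m))),
  (fun v v' => q v v' - s m * q v (eps m) * q v' (eps m) / (1 + s m * q (eps m) (eps m))).
split.
- exact: (tilt_step (s_ge0 m) G).
- by move=> v v'; rewrite big_ord_recr/= !qe hq opprD addrA.
- rewrite big_ord_recr/= qe; apply: ler_pM => //.
    by apply: prodr_ge0 => i _; rewrite invr_ge0 sqrtr_ge0.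
  have sm := s_ge0 m; case/andP: kap => k0 k1.
  have h0 : 0 <= s m * q0 (eps m) (eps m) by rewrite mulr_ge0.
  rewrite lef_pV2 ?posrE ?sqrtr_gt0; [|lra|lra].
  by rewrite ler_wsqrtr// lerD2l ler_piMr.
Qed.

(* Under the tilt by [exp (- sum s_l (W eps_l)^2 / 2)], [eps] the orthonormalised
   [e], Chebyshev's inequality makes all [|W eps_l| <= beta l] and all residuals
   [<= delta / 2] outside mass [Z / 2]. *)
Lemma gaussian_small_ball_lower :
  2^-1 * \prod_(l < n) (Num.sqrt (1 + s l))^-1 <=
  fine (P [set w | forall j, (j < k)%N -> `|W (f j) w| <= delta]).
Proof.
have [eps GS] := gram_schmidt Q0 e n.
have [Z [q [G hq hZ]]] := tilt_orthonormal GS (leqnn n).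
have Z0 := weight_mass G.
set A := [set w | _].
have mA : measurable A.
  exact: (@measurable_norm_le _ _ _ [set i | (i < k)%N] (fun i => W (f i))).
pose r j := gs_residual q0 n eps (f j).
pose bad1 l w : R := tilt n s eps w * (beta l < `|W (eps l) w|)%R%:R.
pose bad2 j w : R := tilt n s eps w * (delta / 2 < `|W (r j) w|)%R%:R.
have bI u c := bm_norm_gt c (W_measurable u).
have bP := weight_bm G.
have bb1 l : bounded_measurable (bad1 l) by exact: bmM.
have bb2 j : bounded_measurable (bad2 j) by exact: bmM.
(* Union bound, pointwise under the weight: off all the bad events the point lies in [A], and the
   weight is at most 1. *)
have E1 : Z <= Ex P (fun w => \1_A w + (\sum_(l < n) bad1 l w + \sum_(j < k) bad2 j w)).
  rewrite -(weight_mass_eq W_linear G); apply: le_Ex => //.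
    by apply: bmD; [exact: bm_indic|apply: bmD; exact: bm_sum].
  move=> w; have t0 := weight_ge0 G w; have t1 := weight_le1 G w.
  have b10 l : 0 <= bad1 l w by rewrite mulr_ge0.
  have b20 j : 0 <= bad2 j w by rewrite mulr_ge0.
  have [/existsP[l hl]|/existsPn nl] := boolP [exists l : 'I_n, beta l < `|W (eps l) w|].
    apply: (@le_trans _ _ (\sum_(l < n) bad1 l w)).
      rewrite (bigD1 l)//= {1}/bad1 hl mulr1 lerDl sumr_ge0//.
    by rewrite addrCA lerDl addr_ge0// ?sumr_ge0// indicE.
  have [/existsP[j hj]|/existsPn nj] := boolP [exists j : 'I_k, delta / 2 < `|W (r j) w|].
    apply: (@le_trans _ _ (\sum_(j < k) bad2 j w)).
      rewrite (bigD1 j)//= {1}/bad2 hj mulr1 lerDl sumr_ge0//.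
    by rewrite addrA lerDr addr_ge0// ?sumr_ge0// indicE.
  suff wA : A w.
    by rewrite indicE mem_set//= (le_trans t1)// lerDl addr_ge0// sumr_ge0.
  move=> j jk; have := nj (Ordinal jk); rewrite -leNgt /= => hj.
  have -> : W (f j) w = W (r j) w + \sum_(l < n) q0 (f j) (eps l) * W (eps l) w.
    by rewrite /r /gs_residual fieldB (field_sum n (fun l => q0 (f j) (eps l))) subrK.
  rewrite (le_trans (ler_normD _ _))// [leRHS]splitr lerD//.
  rewrite (le_trans (ler_norm_sum _ _ _))// (le_trans _ sum_le)//.
  apply: ler_sum => l _; rewrite normrM; apply: ler_pM => //.
    have [c hc] := dist_le jk (ltnW (ltn_ord l)).
    rewrite -ler_sqr ?nnegrE// real_normK ?num_real//.
    exact: (le_trans (gs_coef_le Q0 GS (f j) c (ltn_ord l)) hc).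
  by have := nl l; rewrite -leNgt.
rewrite ExD in E1; [|exact: bm_indic|by apply: bmD; exact: bm_sum].
rewrite Ex_indic// ExD in E1; [|exact: bm_sum|exact: bm_sum].
rewrite !Ex_sum// in E1.
(* Under the tilt [eps l] has variance [1 / (1 + s l)] or 0, so Chebyshev and [tail_le] give
   [2 * Z / 8]. *)
have S1 : \sum_(l < n) Ex P (bad1 l) <= Z / 4.
  apply: (@le_trans _ _ (\sum_(l < n) 2 * Z * (beta l ^+ 2 * (1 + s l))^-1)).
    apply: ler_sum => l _; apply: (le_trans (weight_chebyshev (eps l) G (beta_gt0 l))).
    rewrite -mulrA ler_wpM2l//; first by rewrite mulr_ge0// ltW.
    rewrite [(beta l ^+ 2 * (1 + s l))^-1]invfM [leRHS]mulrC ler_wpM2r// ?invr_ge0 ?sqr_ge0//.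
    have sl := s_ge0 l; rewrite -[leRHS]mul1r ler_pdivlMr; last by lra.
    rewrite hq (bigD1 l)//= big1 ?addr0; last first.
      move=> i il; rewrite (gs_orth GS) ?ltn_ord// ?mulr0 ?mul0r//.
      by rewrite eq_sym.
    case: (gs_norm GS (ltn_ord l)) => ->; first by rewrite !mulr0 !mul0r subr0 mul0r.
    by rewrite !mulr1 mulrBl mul1r divfK ?gt_eqF//; lra.
  have Z2 : 0 <= 2 * Z by rewrite mulr_ge0// ltW.
  by have := ler_wpM2l Z2 tail_le; rewrite -mulr_sumr; lra.
(* The tilt only decreases variances, and the threshold [delta / 2] turns the factor 2 of Chebyshev
   into 8; [rest_le] gives [8 * Z / 32]. *)
have S2 : \sum_(j < k) Ex P (bad2 j) <= Z / 4.
  apply: (@le_trans _ _ (\sum_(j < k) 8 * Z * (rho n ^+ 2 / delta ^+ 2))).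
    have d2 : 0 < delta / 2 by rewrite divr_gt0.
    apply: ler_sum => j _; apply: (le_trans (weight_chebyshev (r j) G d2)).
    have -> : 2 * Z * q (r j) (r j) / (delta / 2) ^+ 2 = 8 * Z * (q (r j) (r j) / delta ^+ 2).
      by field; rewrite gt_eqF.
    rewrite ler_wpM2l//; first by rewrite mulr_ge0// ltW.
    rewrite ler_pM2r ?invr_gt0 ?exprn_gt0//.
    have [c hc] := dist_le (ltn_ord j) (leqnn n).
    apply: (le_trans _ (le_trans (gs_residual_le Q0 GS (f j) c) hc)).
    rewrite hq lerBlDr lerDl sumr_ge0// => l _.
    apply: divr_ge0; last by rewrite addr_ge0// mulr_ge0// (form_nneg Q0).
    by rewrite -(mulrA (s l)) mulr_ge0// -expr2 sqr_ge0.
  have Z8 : 0 <= 8 * Z by rewrite mulr_ge0// ltW.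
  have := ler_wpM2l Z8 rest_le; rewrite sumr_const card_ord -[X in _ -> X <= _]mulr_natl.
  rewrite (_ : k%:R * (8 * Z * (rho n ^+ 2 / delta ^+ 2)) = 8 * Z * (k%:R * rho n ^+ 2 / delta ^+ 2)); last by ring.
  lra.
have := lerD S1 S2; lra.
Qed.

End lower.

End gaussian_small_balls.

(** * Cauchy matrices *)

Section cauchy_form.
Context (R : realType).
Implicit Types (a u v w c : nat -> R) (n : nat).

Definition blaschke n a (t : R) : R := \prod_(i < n) ((t - a i) / (t + a i)).

(** The Gram form of the exponentials [exp (- a_i s)] in L^2(0, +oo), whose inner products are
    [1 / (a_i + a_j)]. *)
Definition cauchy_form n a u v : R :=
  \sum_(i < n) \sum_(j < n) u i * v j / (a i + a j).

Lemma cauchy_formE n a u v :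
  cauchy_form n a u v = \sum_(i < n) u i * \sum_(j < n) v j / (a i + a j).
Proof.
apply: eq_bigr => i _; rewrite mulr_sumr.
by apply: eq_bigr => j _; rewrite mulrA.
Qed.

Lemma cauchy_formC n a u v : cauchy_form n a u v = cauchy_form n a v u.
Proof.
rewrite /cauchy_form exchange_big/=; apply: eq_bigr => i _; apply: eq_bigr => j _.
by rewrite (mulrC (u j)) (addrC (a j)).
Qed.

Lemma cauchy_formDZl n a u v w (k : R) :
  cauchy_form n a (fun i => u i + k * v i) w =
  cauchy_form n a u w + k * cauchy_form n a v w.
Proof.
rewrite /cauchy_form mulr_sumr -big_split/=; apply: eq_bigr => i _.
rewrite mulr_sumr -big_split/=; apply: eq_bigr => j _; ring.
Qed.

Lemma partial_fractions n a :
  (forall i j, (i < j <= n)%N -> a i != a j) ->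
  exists alpha : nat -> R,
    alpha n = \prod_(i < n) ((a n + a i) / (a n - a i)) /\
    forall z, (forall i, (i <= n)%N -> z + a i != 0) ->
      \sum_(i < n.+1) alpha i / (z + a i) = blaschke n a z / (z + a n).
Proof.
elim: n => [|n IH] hd.
  exists (fun=> 1); split; first by rewrite big_ord0.
  by move=> z hz; rewrite big_ord1 /blaschke big_ord0.
have [alpha [an hz]] : exists alpha : nat -> R,
    alpha n = \prod_(i < n) ((a n + a i) / (a n - a i)) /\
    forall z, (forall i, (i <= n)%N -> z + a i != 0) ->
      \sum_(i < n.+1) alpha i / (z + a i) = blaschke n a z / (z + a n).
  by apply: IH => i j /andP[ij jn]; apply: hd; rewrite ij ltnW.
set t := a n.+1; set b := a n.
have tne i : (i <= n)%N -> t - a i != 0.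
  by move=> hi; rewrite subr_eq0 eq_sym hd// ltnS hi /=.
(* The identity for [n] is multiplied by [(z - b) / (z + t)] and each term is split again into
   partial fractions; [A] collects the residues at the new pole [- t]. *)
pose A := (t + b) * \sum_(i < n.+1) alpha i / (t - a i).
exists (fun i => if (i <= n)%N then alpha i * (a i + b) / (a i - t) else A); split.
  rewrite ltnn /A.
  have -> : \sum_(i < n.+1) alpha i / (t - a i) = - \sum_(i < n.+1) alpha i / (- t + a i).
    rewrite -sumrN; apply: eq_bigr => i _.
    by rewrite -mulrN -invrN opprD opprK.
  rewrite hz; last first.
    by move=> i /tne; rewrite -oppr_eq0 opprB addrC.
  rewrite big_ord_recr/= -/t -/b.
  have -> : blaschke n a (- t) = \prod_(i < n) ((t + a i) / (t - a i)).
    apply: eq_bigr => i _.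
    by rewrite -opprD mulNr -mulrN -invrN opprD opprK.
  rewrite -mulrN -invrN opprD opprK mulrCA; congr (_ * _).
move=> z hzz.
have zt : z + t != 0 by exact: hzz.
have zi i : (i <= n)%N -> z + a i != 0 by move=> hi; rewrite hzz// leqW.
rewrite big_ord_recr/= ltnn.
under eq_bigr => i _ do rewrite -ltnS ltn_ord.
rewrite -/t /A -mulrA [(\sum_(_ < _) _) / _]mulrC mulrA mulr_sumr -big_split/=.
transitivity (\sum_(i < n.+1) (z - b) / (z + t) * (alpha i / (z + a i))).
  apply: eq_bigr => i _; have i_n : (i <= n)%N by rewrite -ltnS.
  have h1 := tne _ i_n; have h2 := zi _ i_n.
  have h3 : a i - t != 0 by rewrite -oppr_eq0 opprB.
  by field; rewrite h1 h2 h3 zt.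
rewrite -mulr_sumr hz// /blaschke big_ord_recr/= -/b.
have zb : z + b != 0 by exact: zi.
by field; rewrite zt zb.
Qed.

(* The squared distance, in L^2(0, +oo), from [exp (- a_n s)] to the span of the
   [exp (- a_i s)], [i < n]. *)
Definition cauchy_dist n a : R := blaschke n a (a n) ^+ 2 / (2 * a n).

Section positive_points.
Variables (a : nat -> R) (N : nat).
Hypothesis a_gt0 : forall i, 0 < a i.
Hypothesis a_neq : forall i j, (i < j < N)%N -> a i != a j.

(** [beta] gives the residual of [exp (- a_n s)] against the earlier exponentials. Its Laplace
    transform is the Blaschke product over [z + a_n], up to normalisation, and the zeros of that
    product at [a_j] are the orthogonality relations. *)
Lemma cauchy_residual n : (n < N)%N -> exists beta : nat -> R,
  [/\ beta n = 1,
     (forall j, (j < n)%N -> \sum_(i < n.+1) beta i / (a j + a i) = 0) &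
     \sum_(i < n.+1) beta i / (a n + a i) = cauchy_dist n a].
Proof.
move=> nN; have hd i j : (i < j <= n)%N -> a i != a j.
  by move=> /andP[ij jn]; apply: a_neq; rewrite ij (leq_ltn_trans jn).
have [alpha [an hz]] := partial_fractions hd.
have anB : alpha n = (blaschke n a (a n))^-1.
  by rewrite an /blaschke -prodfV; apply: eq_bigr => i _; rewrite invf_div.
have B0 : blaschke n a (a n) != 0.
  rewrite /blaschke; apply/prodf_neq0 => i _; rewrite mulf_neq0//.
    by rewrite subr_eq0 eq_sym hd// ltn_ord leqnn.
  by rewrite invr_eq0 gt_eqF// addr_gt0.
exists (fun i => alpha i * blaschke n a (a n)); split.
- by rewrite anB mulVf.
- move=> j jn; under eq_bigr do rewrite mulrAC.
  rewrite -mulr_suml hz; last by move=> i _; rewrite gt_eqF// addr_gt0.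
  by rewrite /blaschke (bigD1 (Ordinal jn))//= subrr !mul0r.
- under eq_bigr do rewrite mulrAC.
  rewrite -mulr_suml hz; last by move=> i _; rewrite gt_eqF// addr_gt0.
  have := a_gt0 n => an0; rewrite /cauchy_dist.
  by field; rewrite ?gt_eqF ?addr_gt0.
Qed.

(** Pythagoras along the residual [beta]. Iterated, it diagonalises the Cauchy form, so that
    positivity follows without any integral over the half-line. *)
Lemma cauchy_form_succ n c : (n < N)%N -> exists c',
  cauchy_form n.+1 a c c = cauchy_form n a c' c' + c n ^+ 2 * cauchy_dist n a.
Proof.
move=> nN; have [beta [b1 b0 bD]] := cauchy_residual nN.
pose c' i := c i - c n * beta i.
have bil u : cauchy_form n.+1 a u beta = u n * cauchy_dist n a.
  rewrite cauchy_formE big_ord_recr/= bD big1 ?add0r// => i _.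
  by rewrite b0 ?mulr0.
exists c'.
have cE : c = (fun i => c' i + c n * beta i).
  by apply/funext => i; rewrite /c' subrK.
have c'n : c' n = 0 by rewrite /c' b1 mulr1 subrr.
transitivity (cauchy_form n.+1 a c' c' + c n ^+ 2 * cauchy_dist n a).
  rewrite {1 2}cE cauchy_formDZl cauchy_formC [X in _ + c n * X]cauchy_formC.
  rewrite !cauchy_formDZl ![cauchy_form _ _ beta _]cauchy_formC !bil b1 c'n; ring.
congr (_ + _); rewrite /cauchy_form big_ord_recr/= [X in _ + X]big1 ?addr0; last first.
  by move=> i _; rewrite c'n !mul0r.
by apply: eq_bigr => i _; rewrite big_ord_recr/= c'n mulr0 mul0r addr0.
Qed.

Lemma cauchy_dist_ge0 n : 0 <= cauchy_dist n a.
Proof. by rewrite /cauchy_dist divr_ge0 ?sqr_ge0// mulr_ge0// ltW. Qed.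

Lemma cauchy_form_ge0 n c : (n <= N)%N -> 0 <= cauchy_form n a c c.
Proof.
elim: n c => [|n IH] c nN; first by rewrite /cauchy_form big_ord0.
have [c' ->] := cauchy_form_succ c nN.
by rewrite addr_ge0 ?IH ?(ltnW nN)// mulr_ge0 ?sqr_ge0// cauchy_dist_ge0.
Qed.

Lemma cauchy_form_ge n c : (n < N)%N ->
  c n ^+ 2 * cauchy_dist n a <= cauchy_form n.+1 a c c.
Proof.
move=> nN; have [c' ->] := cauchy_form_succ c nN.
by rewrite lerDr cauchy_form_ge0// ltnW.
Qed.

Lemma cauchy_form_min n : (n < N)%N -> exists beta : nat -> R,
  beta n = 1 /\ cauchy_form n.+1 a beta beta = cauchy_dist n a.
Proof.
move=> nN; have [beta [b1 b0 bD]] := cauchy_residual nN.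
exists beta; split => //.
rewrite cauchy_formE big_ord_recr/= bD b1 mul1r big1 ?add0r// => i _.
by rewrite b0 ?mulr0.
Qed.

End positive_points.

End cauchy_form.

(** * Sums of log coth over arithmetic progressions *)

Section odd_basel.
Context (R : realType).
Implicit Types (p n : nat) (x y : R).

Lemma mulcos_le_sin x : 0 <= x <= pi / 2 -> x * cos x <= sin x.
Proof.
move=> /andP[x0 xpi]; rewrite -subr_ge0 -[X in X <= _](_ : sin (0 : R) - 0 * cos 0 = 0); last first.
  by rewrite sin0 mul0r subr0.
apply: (@derive_ge0_le R (fun y => sin y - y * cos y) (fun y => y * sin y)) => // y /andP[y0 yx].
  by apply: is_derive_eq; rewrite /GRing.scale/=; ring.
apply: mulr_ge0 => //; apply: sin_ge0_pi; rewrite y0/=.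
by have := pi_ge0 R; lra.
Qed.

Definition odd_angle p (k : nat) : R := k.*2.+1%:R * pi / 2 ^+ p.+2.

Lemma odd_angle_bounds p k : (k < 2 ^ p)%N -> 0 < odd_angle p k < pi / 2.
Proof.
move=> kp; have p0 : 0 < 2 ^+ p.+2 :> R by rewrite exprn_gt0.
have pi0 := pi_gt0 R.
have x0 : 0 < k.*2.+1%:R :> R by rewrite ltr0n.
have xp : k.*2.+1%:R < 2 ^+ p.+1 :> R.
  by rewrite -natrX ltr_nat expnS mul2n -doubleS leq_double.
rewrite /odd_angle; apply/andP; split; first by apply: divr_gt0 => //; exact: mulr_gt0.
have -> : 2 ^+ p.+2 = 2 ^+ p.+1 * 2 :> R by rewrite exprSr.
rewrite invfM mulrA ltr_pM2r ?invr_gt0// ltr_pdivrMr ?exprn_gt0// mulrC.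
by rewrite ltr_pM2l.
Qed.

(* Summed over odd multiples of [pi / 2 ^ (p + 2)], this identity doubles the
   number of angles; it yields the odd Basel sum with an explicit error. *)
Lemma invsin_double x : 0 < x < pi / 2 ->
  (sin x ^+ 2)^-1 = ((sin (x / 2) ^+ 2)^-1 + (sin (pi / 2 - x / 2) ^+ 2)^-1) / 4.
Proof.
move=> /andP[x0 xpi]; have s : sin (x / 2) != 0.
  by rewrite gt_eqF// sin_gt0_pihalf//; lra.
have c : cos (x / 2) != 0.
  by rewrite gt_eqF// cos_gt0_pihalf//; lra.
have -> : sin (pi / 2 - x / 2) = cos (x / 2).
  by rewrite addrC sinDpihalf cosN.
have -> : sin x = cos (x / 2) * sin (x / 2) *+ 2.
  by rewrite -sin_mulr2n -[(x / 2) *+ 2]mulr_natr divfK.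
have cs := cos2Dsin2 (x / 2).
rewrite -mulr_natr.
transitivity ((cos (x / 2) ^+ 2 + sin (x / 2) ^+ 2) / (cos (x / 2) * sin (x / 2) * 2) ^+ 2).
  by rewrite cs mul1r.
by field; rewrite s c.
Qed.

Lemma sum_invsin_odd_angle p :
  \sum_(k < 2 ^ p) (sin (odd_angle p k) ^+ 2)^-1 = 2 ^+ (p.*2.+1).
Proof.
elim: p => [|p IH].
  rewrite big_ord1 /odd_angle/= mul1r.
  have h : 0 < (pi / 2 : R) / 1 < pi by rewrite divr1; have := pi_gt0 R; lra.
  have := cos_mulr2n (pi / 2 ^+ 2 : R).
  have -> : (pi / 2 ^+ 2) *+ 2 = pi / 2 :> R by rewrite -mulr_natr; field.
  rewrite cos_pihalf cos2sin2 => e.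
  have -> : sin (pi / 2 ^+ 2) ^+ 2 = 1 / 2 :> R by move: e; rewrite -mulr_natr; lra.
  by field.
(* The second half of the range is read backwards: the angles of index [k] and [2^(p+1) - 1 - k] are
   complementary. *)
have -> : \sum_(k < 2 ^ p.+1) (sin (odd_angle p.+1 k) ^+ 2)^-1 =
    \sum_(k < 2 ^ p) ((sin (odd_angle p.+1 k) ^+ 2)^-1 +
      (sin (odd_angle p.+1 (2 ^ p.+1 - 1 - k)) ^+ 2)^-1).
  rewrite -[LHS](big_mkord xpredT (fun k => (sin (odd_angle p.+1 k) ^+ 2)^-1)).
  rewrite (@big_cat_nat _ _ _ (2 ^ p)%N)//=; last by rewrite leq_exp2l.
  rewrite big_split/= big_mkord; congr (_ + _).
  rewrite big_nat_rev/= -{1}[(2 ^ p)%N]add0n big_addn.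
  have -> : (2 ^ p.+1 - 2 ^ p = 2 ^ p)%N by rewrite expnS mul2n -addnn addnK.
  rewrite big_mkord; apply: eq_bigr => k _; congr ((sin (odd_angle _ _) ^+ 2)^-1).
  by rewrite -subnDA add1n (addnC k) -addnS subnDA addnC addnK.
transitivity (\sum_(k < 2 ^ p) 4 * (sin (odd_angle p k) ^+ 2)^-1).
  apply: eq_bigr => k _; rewrite (invsin_double (odd_angle_bounds (ltn_ord k))).
  have e1 : odd_angle p k / 2 = odd_angle p.+1 k.
    rewrite /odd_angle; have -> : 2 ^+ p.+3 = 2 ^+ p.+2 * 2 :> R by rewrite exprSr.
    by move: (2 ^+ p.+2 : R) => y; rewrite (invfM y) mulrA.
  have e2 : pi / 2 - odd_angle p k / 2 = odd_angle p.+1 (2 ^ p.+1 - 1 - k).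
    rewrite e1 /odd_angle.
    have -> : ((2 ^ p.+1 - 1 - k).*2.+1 = 2 ^ p.+2 - k.*2.+1)%N.
      have kp := ltn_ord k; rewrite [(2 ^ p.+2)%N]expnS.
      have kp1 : (k < 2 ^ p.+1)%N by rewrite (leq_trans kp)// leq_exp2l.
      by rewrite -!mul2n -subnDA mulnBr; lia.
    rewrite natrB; last first.
      have kp := ltn_ord k; rewrite [(2 ^ p.+2)%N]expnS mul2n.
      have kp1 : (k < 2 ^ p.+1)%N by rewrite (leq_trans kp)// leq_exp2l.
      by rewrite ltn_double.
    rewrite natrX [2 ^+ p.+3]exprSr; field.
    by rewrite expf_neq0.
  by rewrite e2 e1 [RHS]mulrC divfK// pnatr_eq0.
by rewrite -mulr_sumr IH doubleS [RHS]exprS [in RHS]exprS; ring.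
Qed.

Definition odd_basel n : R := \sum_(k < n) (k.*2.+1%:R ^+ 2)^-1.

Lemma odd_angle_sum p : \sum_(k < 2 ^ p) (odd_angle p k ^+ 2)^-1 =
  2 ^+ (p.*2.+4) / pi ^+ 2 * odd_basel (2 ^ p).
Proof.
rewrite /odd_basel mulr_sumr; apply: eq_bigr => k _; rewrite /odd_angle.
have -> : 2 ^+ p.*2.+4 = (2 ^+ p.+2) ^+ 2 :> R.
  by rewrite -exprM; congr (_ ^+ _); rewrite muln2 !doubleS.
have pi0 : pi != 0 :> R by rewrite gt_eqF ?pi_gt0.
have k0 : k.*2.+1%:R != 0 :> R by rewrite pnatr_eq0.
have x0 : 2 ^+ p.+2 != 0 :> R by rewrite expf_neq0.
move: (pi : R) (k.*2.+1%:R : R) (2 ^+ p.+2 : R) pi0 k0 x0 => x y z x0 y0 z0.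
by field; rewrite x0 y0 z0.
Qed.

Lemma odd_basel_dyadic_le p : odd_basel (2 ^ p) <= pi ^+ 2 / 8.
Proof.
have := odd_angle_sum p; have := sum_invsin_odd_angle p => h1 h2.
have : \sum_(k < 2 ^ p) (odd_angle p k ^+ 2)^-1 <= \sum_(k < 2 ^ p) (sin (odd_angle p k) ^+ 2)^-1.
  apply: ler_sum => k _; have /andP[a0 api] := odd_angle_bounds (ltn_ord k).
  have s0 : 0 < sin (odd_angle p k) by apply: sin_gt0_pihalf; rewrite a0.
  rewrite lef_pV2 ?posrE ?exprn_gt0//.
  by apply: lerXn2r; rewrite ?nnegrE ?(ltW s0) ?(ltW a0)// sin_le// ltW.
have e4 : 2 ^+ p.*2.+4 = 2 ^+ p.*2.+1 * 8 :> R.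
  by rewrite (_ : p.*2.+4 = (p.*2.+1 + 3)%N) ?exprD; [lra|lia].
rewrite h1 h2 e4; set x := 2 ^+ p.*2.+1.
have x0 : 0 < x by rewrite exprn_gt0.
have pi20 : 0 < pi ^+ 2 :> R by rewrite exprn_gt0 ?pi_gt0.
rewrite (_ : x * 8 / pi ^+ 2 * _ = x * (8 * odd_basel (2 ^ p) / pi ^+ 2)); last first.
  by move: (pi ^- 2 : R) (odd_basel _) => y z; ring.
rewrite -[leRHS]mulr1 ler_pM2l// ler_pdivrMr// mul1r.
by rewrite ler_pdivlMr// mulrC.
Qed.

(** From [x <= tan x], [1 / sin^2 <= 1 + 1 / x^2]. The extra 1, summed over [2^p] angles against a
    total of [2^(2p+1)], is the relative error. *)
Lemma odd_basel_dyadic_ge p :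
  pi ^+ 2 / 8 * (1 - 2 ^- p.+1) <= odd_basel (2 ^ p).
Proof.
have := odd_angle_sum p; have := sum_invsin_odd_angle p => h1 h2.
have : \sum_(k < 2 ^ p) (sin (odd_angle p k) ^+ 2)^-1 <= \sum_(k < 2 ^ p) (1 + (odd_angle p k ^+ 2)^-1).
  apply: ler_sum => k _; have /andP[a0 api] := odd_angle_bounds (ltn_ord k).
  set a := odd_angle p k in a0 api *.
  have s0 : 0 < sin a by apply: sin_gt0_pihalf; rewrite a0.
  have c0 : 0 < cos a by apply: cos_gt0_pihalf; rewrite api andbT; lra.
  have : a * cos a <= sin a by apply: mulcos_le_sin; rewrite !ltW.
  move=> h; have h3 : (a * cos a) ^+ 2 <= sin a ^+ 2.
    by apply: lerXn2r => //; rewrite nnegrE; [apply: mulr_ge0; exact: ltW|exact: ltW].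
  rewrite -[leLHS]mul1r ler_pdivrMr ?exprn_gt0//.
  have a20 : 0 < a ^+ 2 by rewrite exprn_gt0.
  rewrite -(ler_pM2l a20) mulr1.
  rewrite (_ : a ^+ 2 * ((1 + a ^- 2) * sin a ^+ 2) = (a ^+ 2 + 1) * sin a ^+ 2); last first.
    by field; rewrite gt_eqF.
  have cs := cos2Dsin2 a; rewrite exprMn in h3.
  have cE : cos a ^+ 2 = 1 - sin a ^+ 2 by rewrite -cs addrK.
  by rewrite cE in h3; lra.
rewrite big_split/= sumr_const card_ord h1 h2 => h.
have pi20 : 0 < pi ^+ 2 :> R by rewrite exprn_gt0 ?pi_gt0.
set x : R := 2 ^+ p; have x0 : 0 < x by rewrite exprn_gt0.
have e1 : 2 ^+ p.*2.+1 = 2 * x ^+ 2 :> R by rewrite exprS -mul2n exprM exprAC.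
have e4 : 2 ^+ p.*2.+4 = 16 * x ^+ 2 :> R.
  by rewrite (_ : p.*2.+4 = (3 + p.*2.+1)%N)// exprD e1; ring.
have e2 : 2 ^- p.+1 = (2 * x)^-1 :> R by rewrite exprS.
have eN : (2 ^ p)%:R = x by rewrite natrX.
rewrite e1 e4 eN in h; rewrite e2.
set S := odd_basel _ in h *.
have : 2 * x ^+ 2 * pi ^+ 2 <= x * pi ^+ 2 + 16 * x ^+ 2 * S.
  have := ler_wpM2r (ltW pi20) h.
  rewrite [X in _ <= X -> _](_ : _ = x * pi ^+ 2 + 16 * x ^+ 2 * S)//.
  clear h e1 e4 e2 eN h1 h2; clearbody x S; move: pi20; move: (pi ^+ 2 : R) => y y0.
  by field; rewrite gt_eqF.
move=> h5; rewrite -(ler_pM2l (_ : 0 < 16 * x ^+ 2)); last by rewrite mulr_gt0 ?exprn_gt0.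
rewrite (_ : 16 * x ^+ 2 * _ = 2 * x ^+ 2 * pi ^+ 2 - x * pi ^+ 2); first lra.
by field; rewrite gt_eqF.
Qed.

Lemma odd_basel_le n : odd_basel n <= pi ^+ 2 / 8.
Proof.
apply: le_trans (odd_basel_dyadic_le n); rewrite /odd_basel.
rewrite -(subnKC (ltnW (ltn_expl n (ltnSn 1)))) big_split_ord/= lerDl.
by apply: sumr_ge0 => k _; rewrite invr_ge0 sqr_ge0.
Qed.

Lemma odd_harmonic_le p : \sum_(k < 2 ^ p) (k.*2.+1%:R : R)^-1 <= 1 + p%:R.
Proof.
elim: p => [|p IH]; first by rewrite big_ord1 invr1 addr0.
rewrite expnS mul2n -addnn big_split_ord/= -natr1 addrA lerD//.
apply: (@le_trans _ _ (\sum_(k < 2 ^ p) (2 ^ p)%:R^-1)).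
  apply: ler_sum => k _; rewrite lef_pV2 ?posrE ?ltr0n ?expn_gt0// ler_nat.
  rewrite (leq_trans _ (leqnSn _))// (leq_trans (leq_addr k _))//.
  by rewrite -addnn leq_addr.
by rewrite sumr_const card_ord -[_ *+ _]mulr_natl divff// pnatr_eq0 -lt0n expn_gt0.
Qed.

End odd_basel.

(** * The artanh series and sums of log coth *)

Section log_tanh.
Context (R : realType).
Implicit Types (u v x h : R) (n k J : nat).

Definition artanh_partial n u : R := \sum_(k < n) u ^+ k.*2.+1 / k.*2.+1%:R.

Lemma is_derive_pow n u : is_derive u 1 (fun v : R => v ^+ n) (n%:R * u ^+ n.-1).
Proof.
have h := is_deriveX n (is_derive_id u (1 : R)).
have : is_derive u 1 (id ^+ n : R -> R) (n%:R * u ^+ n.-1).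
  by apply: is_derive_eq; rewrite /GRing.scale/= mulr1.
by rewrite exprfctE.
Qed.

Lemma is_derive_artanh_partial n u :
  is_derive u 1 (artanh_partial n) (\sum_(k < n) u ^+ k.*2).
Proof.
elim: n => [|n IH].
  rewrite big_ord0 (_ : artanh_partial 0 = fun=> 0); first exact: is_derive_cst.
  by apply/funext => v; rewrite /artanh_partial big_ord0.
rewrite big_ord_recr/= (_ : artanh_partial n.+1 = fun v => artanh_partial n v + n.*2.+1%:R^-1 * v ^+ n.*2.+1).
  have dp := is_derive_pow n.*2.+1 u.
  by apply: is_derive_eq; rewrite /GRing.scale/= mulKf// pnatr_eq0.
by apply/funext => v; rewrite /artanh_partial big_ord_recr/= mulrC.
Qed.

Lemma geometric_even n u : (1 - u ^+ 2) * (\sum_(k < n) u ^+ k.*2) = 1 - u ^+ n.*2.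
Proof.
elim: n => [|n IH]; first by rewrite big_ord0 mulr0 subrr.
by rewrite big_ord_recr/= mulrDr IH doubleS !exprS; ring.
Qed.

Lemma is_derive_ln_ratio u : 0 <= u < 1 ->
  is_derive u 1 (fun v => ln (1 + v) - ln (1 - v)) (2 / (1 - u ^+ 2)).
Proof.
move=> /andP[u0 u1].
have p1 : 0 < 1 + u by lra.
have p2 : 0 < 1 - u by lra.
have d1 := is_derive1_ln p1; have d2 := is_derive1_ln p2.
apply: is_derive_eq.
rewrite /GRing.scale/=; have e : 1 - u ^+ 2 = (1 + u) * (1 - u) by ring.
by rewrite e; field; rewrite !gt_eqF.
Qed.

Lemma artanh_ge n u : 0 <= u < 1 -> 2 * artanh_partial n u <= ln ((1 + u) / (1 - u)).
Proof.
move=> /andP[u0 u1]; rewrite ln_div ?posrE; [|lra|lra].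
have a0 : artanh_partial n 0 = 0.
  by rewrite /artanh_partial big1// => k _; rewrite expr0n/= mul0r.
pose g v := ln (1 + v) - ln (1 - v) - 2 * artanh_partial n v.
suff : g 0 <= g u by rewrite /g a0 addr0 subr0 mulr0 subrr; lra.
apply: (@derive_ge0_le R g (fun v => 2 / (1 - v ^+ 2) - 2 * \sum_(k < n) v ^+ k.*2)) => // v /andP[v0 vu].
  have v1 : 0 <= v < 1 by lra.
  have := is_derive_ln_ratio v1; have := is_derive_artanh_partial n v => d1 d2.
  by apply: is_derive_eq.
have h : 0 < 1 - v ^+ 2 by nra.
rewrite -(pmulr_rge0 _ h) mulrBr mulrCA divff ?gt_eqF// mulrCA geometric_even.
have := exprn_ge0 n.*2 v0; lra.
Qed.

Lemma artanh_le n u : 0 <= u < 1 ->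
  ln ((1 + u) / (1 - u)) <=
  2 * artanh_partial n u + 2 * u ^+ n.*2.+1 / (n.*2.+1%:R * (1 - u ^+ 2)).
Proof.
move=> /andP[u0 u1]; rewrite ln_div ?posrE; [|lra|lra].
have a0 : artanh_partial n 0 = 0.
  by rewrite /artanh_partial big1// => k _; rewrite expr0n/= mul0r.
(* The remainder keeps the constant [1 - u^2] of the right end, which is at most [1 - v^2] on the
   whole interval. *)
pose g v := 2 * artanh_partial n v + 2 / (n.*2.+1%:R * (1 - u ^+ 2)) * v ^+ n.*2.+1
             - (ln (1 + v) - ln (1 - v)).
have hu : 0 < 1 - u ^+ 2 by nra.
have n0 : n.*2.+1%:R != 0 :> R by rewrite pnatr_eq0.
suff : g 0 <= g u.
  rewrite /g a0 !addr0 subr0 expr0n/= !mulr0 !subrr addr0 subr0 subr_ge0.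
  by rewrite (mulrAC 2 _ (u ^+ _)).
apply: (@derive_ge0_le R g (fun v => 2 * (\sum_(k < n) v ^+ k.*2) +
   2 / (1 - u ^+ 2) * v ^+ n.*2 - 2 / (1 - v ^+ 2))) => // v /andP[v0 vu].
  have v1 : 0 <= v < 1 by lra.
  have := is_derive_ln_ratio v1; have := is_derive_artanh_partial n v => d1 d2.
  have dp := is_derive_pow n.*2.+1 v.
  apply: is_derive_eq; congr (_ + _ - _); rewrite /GRing.scale/=.
  move: (n.*2.+1%:R : R) (v ^+ n.*2) (1 - u ^+ 2) n0 hu => x y z x0 z0.
  by field; rewrite x0 gt_eqF.
have h : 0 < 1 - v ^+ 2 by nra.
rewrite -(pmulr_rge0 _ h) mulrBr mulrDr mulrCA geometric_even.
rewrite [X in _ - X]mulrCA divff ?gt_eqF//.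
have e1 := exprn_ge0 n.*2 v0; move: (v ^+ n.*2) e1 => y y0.
have hh : 1 <= (1 - v ^+ 2) / (1 - u ^+ 2) by rewrite ler_pdivlMr// mul1r; nra.
rewrite (_ : (1 - v ^+ 2) * (2 / (1 - u ^+ 2) * y) = 2 * y * ((1 - v ^+ 2) / (1 - u ^+ 2))); last by ring.
move: (_ / _) hh => z z1; nra.
Qed.

(** This is [log (coth (x / 2))], minus the logarithm of the Blaschke factor of two exponents [e^y]
    at logarithmic distance [x]. *)
Definition lcoth x : R := ln ((1 + expR (- x)) / (1 - expR (- x))).

Lemma expRN_lt1 x : 0 < x -> 0 <= expR (- x) < 1.
Proof. by move=> x0; rewrite expR_ge0/= -expR0 ltr_expR oppr_lt0. Qed.

Lemma lcoth_ge0 x : 0 < x -> 0 <= lcoth x.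
Proof.
move=> /expRN_lt1/andP[h0 h1]; apply: ln_ge0; rewrite ler_pdivlMr; lra.
Qed.

Lemma geometric_expR J x : (1 - expR (- x)) * (\sum_(j < J) expR (- (x * j.+1%:R))) =
  expR (- x) * (1 - expR (- (x * J%:R))).
Proof.
elim: J => [|J IH]; first by rewrite big_ord0 !mulr0 oppr0 expR0 subrr mulr0.
have e : expR (- (x * J.+1%:R)) = expR (- (x * J%:R)) * expR (- x).
  by rewrite -expRD -natr1; congr expR; ring.
by rewrite big_ord_recr/= mulrDr IH e; ring.
Qed.

Lemma geometric_expR_le J x : 0 < x -> \sum_(j < J) expR (- (x * j.+1%:R)) <= x^-1.
Proof.
move=> x0; have /andP[h0 h1] := expRN_lt1 x0.
have h2 : 0 < 1 - expR (- x) by lra.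
rewrite -(ler_pM2l h2) geometric_expR.
rewrite ler_pdivlMr//.
have e0 := expR_ge0 (- (x * J%:R)).
have : expR (- x) * (1 + x) <= 1.
  by rewrite -ler_pdivlMl ?expR_gt0// expRN invrK mulr1 expR_ge1Dx.
have : 0 <= expR (- x) * expR (- (x * J%:R)) * x by rewrite !mulr_ge0// ltW.
lra.
Qed.

(** The complete series is at least [1 / x - 1], and truncation costs at most [1 / (J x^2)] because
    [exp (- J x) <= 1 / (J x)]. *)
Lemma geometric_expR_ge J x : (0 < J)%N -> 0 < x ->
  x^-1 - 1 - (J%:R * x ^+ 2)^-1 <= \sum_(j < J) expR (- (x * j.+1%:R)).
Proof.
move=> J0 x0; have /andP[h0 h1] := expRN_lt1 x0.
have h2 : 0 < 1 - expR (- x) by lra.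
have JR : 0 < J%:R :> R by rewrite ltr0n.
set S := \sum_(j < J) _.
have hS : (1 - expR (- x)) * S = expR (- x) * (1 - expR (- (x * J%:R))) by exact: geometric_expR.
set ep := expR (- (x * J%:R)) in hS.
have ep0 : 0 <= ep by exact: expR_ge0.
have ep1 : ep <= (J%:R * x)^-1.
  rewrite /ep expRN lef_pV2 ?posrE ?expR_gt0 ?mulr_gt0// (mulrC x).
  by have := expR_ge1Dx (J%:R * x); lra.
have ep2 : ep <= 1 by rewrite /ep -expR0 ler_expR oppr_le0 mulr_ge0// ltW.
have hx : 1 - x <= expR (- x) by exact: expR_ge1Dx.
have S1 : expR (- x) * (1 - ep) <= x * S.
  rewrite -hS ler_wpM2r//; last lra.
  by rewrite sumr_ge0// => i _; rewrite expR_ge0.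
have S2 : (1 - x) * (1 - ep) <= expR (- x) * (1 - ep) by rewrite ler_wpM2r//; lra.
rewrite -(ler_pM2l x0) (le_trans _ S1)// (le_trans _ S2)//.
have -> : x * (x^-1 - 1 - (J%:R * x ^+ 2)^-1) = 1 - x - (J%:R * x)^-1.
  by field; rewrite !gt_eqF.
have : 0 <= x * ep by rewrite mulr_ge0// ltW.
lra.
Qed.

Lemma ler_of_odd_inv (a b c : R) :
  (forall n, a <= b + c / n.*2.+1%:R) -> a <= b.
Proof.
move=> h; apply/ler_addgt0Pr => e e0.
have [n hn] : exists n : nat, c / e <= n%:R.
  exists (Num.truncn `|c / e|).+1.
  by rewrite (le_trans (ler_norm _))// ltW// truncnS_gt.
apply: le_trans (h n) _; rewrite lerD2l ler_pdivrMr ?ltr0n//.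
rewrite ler_pdivrMr// in hn; rewrite (le_trans hn)// mulrC ler_pM2l// ler_nat.
by rewrite -addnn -addnS leq_addr.
Qed.

Lemma sum_lcoth_le h J : 0 < h -> \sum_(j < J) lcoth (h * j.+1%:R) <= pi ^+ 2 / (4 * h).
Proof.
(* A crude constant for the [J] remainders of the artanh series; it is divided by [2n + 1] and
   disappears as [n] grows. *)
move=> h0; pose c := J%:R * 2 / (1 - expR (- h) ^+ 2).
have /andP[q0 q1] := expRN_lt1 h0.
have q2 : 0 < 1 - expR (- h) ^+ 2 by nra.
apply: (@ler_of_odd_inv _ _ c) => n.
apply: (@le_trans _ _ (\sum_(j < J) (2 * artanh_partial n (expR (- (h * j.+1%:R))) +
     2 / (n.*2.+1%:R * (1 - expR (- h) ^+ 2))))).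
  apply: ler_sum => j _.
  have x0 : 0 < h * j.+1%:R by rewrite mulr_gt0.
  have u01 := expRN_lt1 x0.
  apply: (le_trans (artanh_le n u01)); rewrite lerD2l.
  case/andP: u01; set u := expR _ => u0 u1.
  have uq : u <= expR (- h).
    by rewrite /u ler_expR lerN2 ler_peMr ?ler1n// ltW.
  rewrite -!mulrA ler_wpM2l// -[leRHS]mul1r; apply: ler_pM => //.
  + exact: exprn_ge0.
  + by rewrite invr_ge0 mulr_ge0//; nra.
  + by rewrite exprn_ile1// ltW.
  rewrite lef_pV2 ?posrE; last by rewrite mulr_gt0.
    by rewrite ler_wpM2l//; nra.
  by rewrite mulr_gt0 ?ltr0n//; nra.
rewrite big_split/= sumr_const card_ord lerD//; last first.
  rewrite -[leLHS]mulr_natl /c invfM; move: (_^-1) (n.*2.+1%:R^-1 : R) => y z; lra.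
rewrite -mulr_sumr.
have -> : \sum_(j < J) artanh_partial n (expR (- (h * j.+1%:R))) =
    \sum_(k < n) (\sum_(j < J) expR (- (k.*2.+1%:R * h * j.+1%:R))) / k.*2.+1%:R.
  rewrite exchange_big/=; apply: eq_bigr => k _; rewrite mulr_suml.
  apply: eq_bigr => j _; congr (_ / _).
  by rewrite -expRM_natl; congr expR; ring.
apply: (@le_trans _ _ (2 * (h^-1 * odd_basel R n))).
  rewrite ler_wpM2l// mulr_sumr; apply: ler_sum => k _.
  have k0 : 0 < k.*2.+1%:R :> R by rewrite ltr0n.
  rewrite expr2 invfM mulrA ler_wpM2r ?invr_ge0 ?(ltW k0)//.
  by rewrite -invfM (mulrC h) geometric_expR_le// mulr_gt0.
have := odd_basel_le R n; set S := odd_basel R n => hS.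
rewrite (_ : pi ^+ 2 / (4 * h) = 2 * (h^-1 * (pi ^+ 2 / 8))); last first.
  by field; rewrite gt_eqF.
by rewrite ler_wpM2l// ler_wpM2l// invr_ge0 ltW.
Qed.

(** With step [h = pi^2 / (2 r)] the full sum would be about [pi^2 / (4 h) = r / 2]. Taking [r^2]
    nodes keeps [J h^2] constant, so truncation costs O(1), and so does the Basel tail after [r]
    terms; the [- 1] lost in each geometric sum adds up to the odd harmonic sum, hence the loss
    linear in [p]. *)
Lemma sum_lcoth_ge p (r : R) : r = (2 ^ p)%:R ->
  r / 2 - (3 + 2 * p%:R) <= \sum_(j < (2 ^ p) ^ 2) lcoth (pi ^+ 2 / (2 * r) * j.+1%:R).
Proof.
move=> rE; set n := (2 ^ p)%N; set h := pi ^+ 2 / (2 * r).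
have r0 : 0 < r by rewrite rE ltr0n expn_gt0.
have n0 : (0 < n ^ 2)%N by rewrite !expn_gt0.
have pi0 := pi_gt0 R.
have h0 : 0 < h by rewrite divr_gt0 ?exprn_gt0 ?mulr_gt0.
apply: (@le_trans _ _ (\sum_(j < n ^ 2) 2 * artanh_partial n (expR (- (h * j.+1%:R))))); last first.
  apply: ler_sum => j _; apply: artanh_ge; apply: expRN_lt1.
  by rewrite mulr_gt0.
rewrite -mulr_sumr.
have -> : \sum_(j < n ^ 2) artanh_partial n (expR (- (h * j.+1%:R))) =
    \sum_(k < n) (\sum_(j < n ^ 2) expR (- (k.*2.+1%:R * h * j.+1%:R))) / k.*2.+1%:R.
  rewrite exchange_big/=; apply: eq_bigr => k _; rewrite mulr_suml.
  apply: eq_bigr => j _; congr (_ / _).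
  by rewrite -expRM_natl; congr expR; ring.
have Jh : (n ^ 2)%:R * h ^+ 2 = pi ^+ 4 / 4.
  by rewrite natrX -rE /h; field; rewrite gt_eqF.
apply: (@le_trans _ _ (2 * (h^-1 * odd_basel R n - (1 + p%:R) - (pi ^+ 4 / 4)^-1 * odd_basel R n))); last first.
  rewrite ler_wpM2l//.
  apply: (@le_trans _ _ (h^-1 * odd_basel R n - \sum_(k < n) (k.*2.+1%:R : R)^-1 - (pi ^+ 4 / 4)^-1 * odd_basel R n)).
    by rewrite lerD2r lerD2l lerN2 odd_harmonic_le.
  rewrite !mulr_sumr -!sumrB; apply: ler_sum => k _.
  have k0 : 0 < k.*2.+1%:R :> R by rewrite ltr0n.
  have k1 : 1 <= k.*2.+1%:R :> R by rewrite ler1n.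
  have kh : 0 < k.*2.+1%:R * h by rewrite mulr_gt0.
  have := geometric_expR_ge n0 kh; set S := \sum_(_ < _) _ => hS.
  rewrite ler_pdivlMr// (le_trans _ hS)//.
  have -> : (n ^ 2)%:R * (k.*2.+1%:R * h) ^+ 2 = k.*2.+1%:R ^+ 2 * (pi ^+ 4 / 4).
    by rewrite -Jh exprMn mulrCA.
  have pi4 : 0 < pi ^+ 4 / 4 :> R by rewrite divr_gt0 ?exprn_gt0.
  move: (pi ^+ 4 / 4) (k.*2.+1%:R : R) k0 k1 pi4 => y z z0 z1 y0.
  rewrite !mulrBl mulVf ?gt_eqF//.
  rewrite (_ : h^-1 / z ^+ 2 * z = (z * h)^-1); last by field; rewrite !gt_eqF.
  rewrite lerD2l lerN2 invfM mulrAC mulrC ler_wpM2r ?invr_ge0 ?(ltW y0)//.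
    by rewrite exprn_ge0// ltW.
  by rewrite ler_peMr// invr_ge0 ltW.
have hb := odd_basel_dyadic_ge R p; have hb2 := odd_basel_le R n; rewrite -/n in hb.
set S := odd_basel R n in hb hb2 *.
have e1 : h^-1 * (pi ^+ 2 / 8 * (1 - 2 ^- p.+1)) <= h^-1 * S by rewrite ler_wpM2l// invr_ge0 ltW.
have e2 : h^-1 * (pi ^+ 2 / 8 * (1 - 2 ^- p.+1)) = r / 4 - 1 / 8.
  have -> : 2 ^+ p.+1 = 2 * r by rewrite exprS rE natrX.
  rewrite /h; move: r0 pi0; clear => r0 pi0; move: (pi : R) pi0 => y y0.
  by field; rewrite !gt_eqF.
have e3 : (pi ^+ 4 / 4)^-1 * S <= (pi ^+ 4 / 4)^-1 * (pi ^+ 2 / 8).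
  by rewrite ler_wpM2l// invr_ge0 divr_ge0// exprn_ge0// ltW.
have e4 : (pi ^+ 4 / 4)^-1 * (pi ^+ 2 / 8) = (pi ^+ 2)^-1 / 2 :> R.
  by move: (pi : R) pi0 => y y0; field; rewrite gt_eqF.
have e5 : (pi ^+ 2)^-1 <= 4^-1 :> R.
  by rewrite lef_pV2 ?posrE ?exprn_gt0//; have := pi_ge2 R; nra.
lra.
Qed.

End log_tanh.

(** * The Laplace field and its upper bound *)

Section unit_integral.
Context (R : realType).
Implicit Types (f g : R -> R) (a c : nat -> R).
Local Notation mu := (@lebesgue_measure R).

Definition unit_int f : R := \int[mu]_(s in `[0, 1]) f s.

Lemma continuous_unit_integrable f : continuous f ->
  mu.-integrable `[0 : R, 1] (EFin \o f).
Proof.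
move=> cf; apply: continuous_compact_integrable; first exact: segment_compact.
exact: continuous_subspaceT.
Qed.

Let mI : measurable (`[0 : R, 1]%classic : set (measurableTypeR R)).
Proof. exact: measurable_itv. Qed.

Lemma unit_intD f g : continuous f -> continuous g ->
  unit_int (fun s => f s + g s) = unit_int f + unit_int g.
Proof. by move=> cf cg; apply: RintegralD => //; exact: continuous_unit_integrable. Qed.

Lemma unit_intZ k f : continuous f -> unit_int (fun s => k * f s) = k * unit_int f.
Proof. by move=> cf; apply: RintegralZl => //; exact: continuous_unit_integrable. Qed.

Lemma unit_int0 : unit_int (fun=> 0) = 0.
Proof. by rewrite /unit_int Rintegral_cst// mul0r. Qed.

Lemma unit_int_ge0 f : (forall s, 0 <= f s) -> 0 <= unit_int f.
Proof. by move=> f0; apply: Rintegral_ge0 => s _. Qed.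

Lemma unit_int_le f g : continuous f -> continuous g ->
  (forall s, 0 <= s <= 1 -> f s <= g s) -> unit_int f <= unit_int g.
Proof.
move=> cf cg fg; apply: le_Rintegral; rewrite ?mI//; try exact: continuous_unit_integrable.
Qed.

Lemma continuous_sum_fun n (F : nat -> R -> R) : (forall i, continuous (F i)) ->
  continuous (fun s => \sum_(i < n) F i s).
Proof.
move=> cF; elim: n => [|n IH] x.
  under eq_fun do rewrite big_ord0; exact: cvg_cst.
under eq_fun do rewrite big_ord_recr/=.
by apply: continuousD; [exact: IH|exact: cF].
Qed.

Lemma unit_int_sum n (F : nat -> R -> R) : (forall i, continuous (F i)) ->
  unit_int (fun s => \sum_(i < n) F i s) = \sum_(i < n) unit_int (F i).
Proof.
move=> cF; elim: n => [|n IH].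
  by under eq_fun do rewrite big_ord0; rewrite big_ord0 unit_int0.
under eq_fun do rewrite big_ord_recr/=.
by rewrite big_ord_recr/= unit_intD ?IH//; exact: continuous_sum_fun.
Qed.

Lemma continuous_expRN k : continuous (fun s : R => expR (- (s * k))).
Proof.
move=> x; apply: (@continuous_comp _ _ _ (fun s : R => - (s * k)) expR); last exact: continuous_expR.
by apply: continuousN; apply: continuousM; [exact: cvg_id|exact: cvg_cst].
Qed.

Lemma continuous_scale k f : continuous f -> continuous (fun s => k * f s).
Proof. by move=> cf x; apply: cvgM; [exact: cvg_cst|exact: cf]. Qed.

Lemma unit_int_expR k : 0 < k -> unit_int (fun s => expR (- (s * k))) = (1 - expR (- k)) / k.
Proof.
move=> k0; pose F (s : R) := - expR (- (s * k)) / k.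
have dF (s : R) : is_derive s 1 F (expR (- (s * k))).
  apply: is_derive_eq; rewrite /GRing.scale/=.
  by field; rewrite gt_eqF.
rewrite /unit_int /Rintegral (@continuous_FTC2 _ _ F)//.
- by rewrite /= /F mul0r mul1r oppr0 expR0 mulrBl !mulNr opprK addrC.
- by apply: continuous_subspaceT; exact: continuous_expRN.
- have dF1 s : derivable F s 1 by case: (dF s).
  split=> //; apply: cvg_at_right_filter || apply: cvg_at_left_filter;
  by apply: differentiable_continuous; exact/derivable1_diffP.
- by move=> s _; rewrite derive1E; case: (dF s).
Qed.

Definition expsum n a c (s : R) : R := \sum_(i < n) c i * expR (- (s * a i)).

Lemma continuous_expsum n a c : continuous (expsum n a c).
Proof.
apply: (@continuous_sum_fun n (fun i s => c i * expR (- (s * a i)))) => i.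
by apply: continuous_scale; exact: continuous_expRN.
Qed.

Lemma continuous_expsum2 n a c : continuous (fun s => expsum n a c s ^+ 2).
Proof.
move=> x; under eq_fun do rewrite expr2.
by apply: cvgM; exact: continuous_expsum.
Qed.

(** The integral over (0, 1) is that over (0, +oo) minus that over (1, +oo), and translation by 1
    multiplies the coefficients by [exp (- a_i)]. *)
Lemma unit_int_expsum2 n a c : (forall i, 0 < a i) ->
  unit_int (fun s => expsum n a c s ^+ 2) =
  cauchy_form n a c c -
  cauchy_form n a (fun i => c i * expR (- a i)) (fun i => c i * expR (- a i)).
Proof.
move=> a0.
have -> : (fun s => expsum n a c s ^+ 2) =
    (fun s => \sum_(i < n) \sum_(j < n) c i * c j * expR (- (s * (a i + a j)))).
  apply/funext => s; rewrite expr2 /expsum mulr_suml; apply: eq_bigr => i _.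
  rewrite mulr_sumr; apply: eq_bigr => j _.
  by rewrite mulrACA -expRD mulrDr opprD.
have cE i j : continuous (fun s : R => c i * c j * expR (- (s * (a i + a j)))).
  by apply: continuous_scale; exact: continuous_expRN.
rewrite (@unit_int_sum n (fun i s => \sum_(j < n) c i * c j * expR (- (s * (a i + a j))))); last first.
  by move=> i; exact: (@continuous_sum_fun n (fun j s => c i * c j * expR (- (s * (a i + a j))))).
rewrite /cauchy_form -sumrB; apply: eq_bigr => i _.
rewrite (@unit_int_sum n (fun j s => c i * c j * expR (- (s * (a i + a j)))))//.
rewrite -sumrB; apply: eq_bigr => j _.
rewrite unit_intZ; last exact: continuous_expRN.
have aij : 0 < a i + a j by rewrite addr_gt0.
rewrite unit_int_expR// opprD expRD.
by field; rewrite gt_eqF.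
Qed.

Lemma cauchy_form_le n a c (m : R) : 0 < m -> (forall i, m <= a i) ->
  cauchy_form n a c c <= n%:R * (\sum_(i < n) c i ^+ 2) / (2 * m).
Proof.
move=> m0 ma.
apply: (@le_trans _ _ (\sum_(i < n) \sum_(j < n) (c i ^+ 2 + c j ^+ 2) / 2 / (2 * m))).
  apply: ler_sum => i _; apply: ler_sum => j _.
  have hm : 2 * m <= a i + a j by have := ma i; have := ma j; lra.
  have m2 : 0 < 2 * m by lra.
  apply: (@le_trans _ _ ((c i ^+ 2 + c j ^+ 2) / 2 / (a i + a j))).
    rewrite ler_wpM2r// ?invr_ge0; first by rewrite (le_trans (ltW m2)).
    by rewrite ler_pdivlMr//; have := sqr_ge0 (c i - c j); nra.
  rewrite ler_wpM2l//; first by rewrite divr_ge0// addr_ge0// sqr_ge0.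
  by rewrite lef_pV2 ?posrE// (lt_le_trans m2).
rewrite le_eqVlt; apply/orP; left; apply/eqP.
under eq_bigr do rewrite -mulr_suml -mulr_suml big_split/= sumr_const card_ord.
rewrite -mulr_suml -mulr_suml big_split/= sumr_const card_ord sumrMnl.
by rewrite -!(mulr_natl (\sum_i _) n); field; rewrite gt_eqF.
Qed.

End unit_integral.

(** * The Laplace process as a Gaussian field *)

Section laplace_field.
Context (d : measure_display) (T : measurableType d) (R : realType).
Variables (P : probability T R) (B X : R -> {RV P >-> R}).
Hypotheses (BM : standard_brownian_motion B) (LX : continuous_laplace_process B X).

(** [B 1 - B 0] is standard normal, so the characteristic function found for increments by
    subdivision gives that of the normal law. *)
Lemma Ex_standard_normal_cos (c : R) :
  Ex (normal_prob 0 1) (fun x : measurableTypeR R => cos (c * x)) = expR (- (c ^+ 2 / 2)).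
Proof.
have b : bounded_measurable (fun x : R => cos (c * x)).
  by apply: bm_cos; apply: measurable_funM.
have := Ex_increment_law BM (lexx 0) ltr01 b.
rewrite subr0 sqrtr1 (Ex_increment_cos BM c (lexx 0) ler01) subr0 mulr1 => e.
exact: esym.
Qed.

Variables (m : nat) (p : nat -> R).
Hypothesis p_ge0 : forall i, 0 <= p i.
Implicit Types u v : 'rV[R]_m.

Definition laplace_field v (w : T) : R := \sum_(i < m) v 0 i * X (p i) w.

Definition row_fun v (s : R) : R := \sum_(i < m) v 0 i * expR (- (s * p i)).

Definition laplace_form u v : R := unit_int (fun s => row_fun u s * row_fun v s).

Definition unit_row (j : nat) : 'rV[R]_m := \row_i (i == j :> nat)%:R.

Lemma laplace_field_linear a u v w :
  laplace_field (a *: u + v) w = a * laplace_field u w + laplace_field v w.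
Proof.
rewrite /laplace_field mulr_sumr -big_split/=; apply: eq_bigr => i _.
by rewrite !mxE mulrDl mulrA.
Qed.

Lemma row_fun_linear a u v s : row_fun (a *: u + v) s = a * row_fun u s + row_fun v s.
Proof.
rewrite /row_fun mulr_sumr -big_split/=; apply: eq_bigr => i _.
by rewrite !mxE mulrDl mulrA.
Qed.

Lemma measurable_laplace_field v : measurable_fun setT (laplace_field v).
Proof.
by apply: measurable_sum => i; apply: measurable_funM => //; exact: measurable_funP.
Qed.

Lemma laplace_field_unit_row j w : (j < m)%N -> laplace_field (unit_row j) w = X (p j) w.
Proof.
move=> jm; rewrite /laplace_field (bigD1 (Ordinal jm))//= mxE eqxx mul1r big1 ?addr0// => i ij.
rewrite mxE; case: eqP => [e|]; last by rewrite mul0r.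
by move: ij; rewrite -val_eqE/= e eqxx.
Qed.

Lemma row_fun_unit_row j s : (j < m)%N -> row_fun (unit_row j) s = expR (- (s * p j)).
Proof.
move=> jm; rewrite /row_fun (bigD1 (Ordinal jm))//= mxE eqxx mul1r big1 ?addr0// => i ij.
rewrite mxE; case: eqP => [e|]; last by rewrite mul0r.
by move: ij; rewrite -val_eqE/= e eqxx.
Qed.

Lemma row_fun_expsum v : exists c : nat -> R, row_fun v = expsum m p c.
Proof.
exists (fun i => if insub i is Some j then v 0 j else 0).
apply/funext => s; apply: eq_bigr => i _.
by rewrite valK.
Qed.

Lemma continuous_row_fun v : continuous (row_fun v).
Proof. by have [c ->] := row_fun_expsum v; exact: continuous_expsum. Qed.

Lemma laplace_semi_inner : semi_inner laplace_form.
Proof.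
have cM u v : continuous (fun s => row_fun u s * row_fun v s).
  by move=> x; apply: cvgM; exact: continuous_row_fun.
split=> [u v|a u v w|u].
- by congr unit_int; apply/funext => s; rewrite mulrC.
- rewrite /laplace_form -unit_intZ// -unit_intD//.
    by congr unit_int; apply/funext => s; rewrite row_fun_linear mulrDl mulrA.
  exact: continuous_scale.
- by apply: unit_int_ge0 => s; rewrite -expr2 sqr_ge0.
Qed.

Lemma laplace_gaussian_weight :
  gaussian_weight P laplace_field (fun=> 1) 1 laplace_form.
Proof.
split=> //; first exact: laplace_semi_inner.
move=> v; under eq_fun do rewrite mul1r; rewrite mul1r.
have := @Ex_cos_wiener _ _ _ _ _ _ BM LX m (fun i => v 0 i) (fun i => p i) (fun i => p_ge0 i).
rewrite /laplace_field => ->; congr (expR (- (_ / 2))).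
Qed.

Lemma row_fun_combination v (c : nat -> R) n s : (n <= m)%N ->
  row_fun (v - \sum_(j < n) c j *: unit_row j) s =
  row_fun v s - \sum_(j < n) c j * expR (- (s * p j)).
Proof.
move=> nm; rewrite addrC -scaleN1r row_fun_linear mulN1r addrC; congr (_ - _).
elim: n nm => [_|n IH nm].
  by rewrite !big_ord0 /row_fun big1// => i _; rewrite mxE mul0r.
by rewrite !big_ord_recr/= addrC row_fun_linear IH ?(ltnW nm)// row_fun_unit_row// addrC.
Qed.

End laplace_field.

Section laplace_small_ball.
Context (d : measure_display) (T : measurableType d) (R : realType).
Variables (P : probability T R) (B X : R -> {RV P >-> R}).
Hypotheses (BM : standard_brownian_motion B) (LX : continuous_laplace_process B X).

(** Passing from L^2(0, 1) to L^2(0, +oo) adds at most [N exp (- 2 m) / (2 m)] times the sum of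
    squared coefficients, by [cauchy_form_le]. By hypothesis this is covered by the ridge penalty
    [delta^2], so half-line distances may serve as [D]. *)
Lemma laplace_small_ball_upper N (a : nat -> R) (m delta : R) :
  0 < m -> (forall i, m <= a i) -> (forall i j, (i < j < N)%N -> a i != a j) ->
  0 < delta -> N%:R * expR (- (2 * m)) / (2 * m) <= delta ^+ 2 ->
  fine (P [set w | forall i, (i < N)%N -> `|X (a i) w| <= delta]) <=
  \prod_(i < N) (expR (2^-1) * delta / Num.sqrt (cauchy_dist i a)).
Proof.
move=> m0 ma aneq d0 hm.
have a0 i : 0 < a i by exact: lt_le_trans m0 (ma i).
have s0 : 0 < delta ^- 2 by rewrite invr_gt0 exprn_gt0.
have := @gaussian_small_ball_upper _ _ _ P _ (laplace_field X a)
  (laplace_field_linear X a) (measurable_laplace_field X a)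
  (Ex_standard_normal_cos BM) _ (laplace_gaussian_weight BM LX N (fun i => ltW (a0 i)))
  N (unit_row R N) (delta ^- 2) (fun i => cauchy_dist i a) s0.
have -> : [set w | forall i, (i < N)%N -> `|X (a i) w| <= delta] =
    [set w | forall i, (i < N)%N -> `|laplace_field X a (unit_row R N i) w| <= delta].
  apply/seteqP; split => w /= h i iN; have := h i iN;
  by rewrite laplace_field_unit_row.
apply=> //.
- move=> i iN; rewrite /cauchy_dist; apply: divr_gt0; last by rewrite mulr_gt0.
  rewrite exprn_even_gt0//=; apply/prodf_neq0 => j _; rewrite mulf_neq0//.
    by rewrite subr_eq0 eq_sym aneq// ltn_ord.
  by rewrite invr_eq0 gt_eqF// addr_gt0.
- move=> i c iN; pose c' j := if j == i then 1 else - c j.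
  have c'i : c' i = 1 by rewrite /c' eqxx.
  have c'j j : (j < i)%N -> c' j = - c j by move=> ji; rewrite /c' ltn_eqF.
  have -> : laplace_form a (unit_row R N i - \sum_(j < i) c j *: unit_row R N j)
      (unit_row R N i - \sum_(j < i) c j *: unit_row R N j) =
      unit_int (fun s => expsum i.+1 a c' s ^+ 2).
    congr unit_int; apply/funext => s; rewrite -expr2; congr (_ ^+ 2).
    rewrite row_fun_combination ?(ltnW iN)// row_fun_unit_row//.
    rewrite /expsum big_ord_recr/= c'i mul1r addrC -sumrN; congr (_ + _).
    by apply: eq_bigr => j _; rewrite c'j// mulNr.
  rewrite unit_int_expsum2//.
  have h1 := cauchy_form_ge a0 aneq c' iN; rewrite c'i expr1n mul1r in h1.
  set c2 := fun j => c' j * expR (- a j).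
  have h2 := cauchy_form_le i.+1 c2 m0 ma.
  have sumE : \sum_(j < i) c j ^+ 2 + 1 = \sum_(j < i.+1) c' j ^+ 2.
    rewrite big_ord_recr/= c'i expr1n; congr (_ + _).
    by apply: eq_bigr => j _; rewrite c'j// sqrrN.
  rewrite sumE invrK.
  set S := \sum_(j < i.+1) c' j ^+ 2.
  have S0 : 0 <= S by apply: sumr_ge0 => j _; exact: sqr_ge0.
  have h3 : \sum_(j < i.+1) c2 j ^+ 2 <= expR (- (2 * m)) * S.
    rewrite mulr_sumr; apply: ler_sum => j _; rewrite /c2 exprMn mulrC.
    rewrite ler_wpM2r ?sqr_ge0// -expRM_natl ler_expR.
    by have := ma j; lra.
  have h4 : i.+1%:R * (\sum_(j < i.+1) c2 j ^+ 2) / (2 * m) <= S * delta ^+ 2.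
    apply: (@le_trans _ _ (S * (N%:R * expR (- (2 * m)) / (2 * m)))); last by rewrite ler_wpM2l.
    rewrite [leRHS]mulrA ler_pM2r ?invr_gt0 ?mulr_gt0//.
    apply: (@le_trans _ _ (N%:R * (expR (- (2 * m)) * S))); last by rewrite [leRHS]mulrC mulrA.
    apply: ler_pM => //; last by rewrite ler_nat.
    by apply: sumr_ge0 => j _; exact: sqr_ge0.
  lra.
Qed.

(* [L^2(0, 1)] is dominated by [e^2] times [L^2(0, +oo)] with weight
   [exp (- 2 s)], which shifts every exponent by one. *)
Lemma laplace_dist_le n (tau : nat -> R) t :
  (forall i, 0 <= tau i) -> (forall i j, (i < j < n)%N -> tau i != tau j) -> 0 <= t ->
  exists c : nat -> R,
    unit_int (fun s => (expR (- (s * t)) - \sum_(i < n) c i * expR (- (s * tau i))) ^+ 2) <=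
    expR 2 * (blaschke n (fun i => tau i + 1) (t + 1) ^+ 2 / (2 * (t + 1))).
Proof.
move=> tau0 tneq t0.
(* A time equal to a node has distance 0; it is set apart because the Cauchy formulas need distinct
   points. *)
have [/existsP[i0 /eqP ti]|/existsPn tn] := boolP [exists i : 'I_n, tau i == t].
  exists (fun i => (i == i0 :> nat)%:R).
  rewrite (_ : (fun s => _) = (fun=> 0)).
    rewrite unit_int0 mulr_ge0 ?expR_ge0// divr_ge0 ?sqr_ge0// mulr_ge0//; lra.
  apply/funext => s; rewrite (bigD1 i0)//= eqxx mul1r ti big1 ?addr0 ?subrr ?expr0n//.
  by move=> i ii0; rewrite val_eqE (negbTE ii0) mul0r.
pose a i := if (i < n)%N then tau i + 1 else t + 1.
have an : a n = t + 1 by rewrite /a ltnn.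
have ai i : (i < n)%N -> a i = tau i + 1 by move=> i_n; rewrite /a i_n.
have a0 i : 0 < a i by rewrite /a; case: ifP => _; [have := tau0 i|]; lra.
have aneq i j : (i < j < n.+1)%N -> a i != a j.
  move=> /andP[ij]; rewrite ltnS leq_eqVlt => /predU1P[jn|jn].
    by rewrite jn an ai ?(inj_eq (addIr _)) -?jn//; apply: (tn (Ordinal _)); rewrite -jn.
  by rewrite !ai ?(ltn_trans ij)// (inj_eq (addIr _)) tneq// ij.
have [beta [b1 bD]] := cauchy_form_min a0 aneq (ltnSn n).
exists (fun i => - beta i).
have -> : blaschke n (fun i => tau i + 1) (t + 1) ^+ 2 / (2 * (t + 1)) = cauchy_dist n a.
  rewrite /cauchy_dist an; congr (_ ^+ 2 / _); apply: eq_bigr => i _.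
  by rewrite ai.
rewrite -bD.
have hE s : expR (- (s * t)) - \sum_(i < n) - beta i * expR (- (s * tau i)) =
    expR s * expsum n.+1 a beta s.
  rewrite /expsum big_ord_recr/= b1 mul1r an mulrDr mulr_sumr addrC -sumrN; congr (_ + _).
    apply: eq_bigr => i _; rewrite ai// mulNr opprK mulrCA -expRD; congr (_ * expR _); ring.
  by rewrite -expRD; congr expR; ring.
have c2 := @continuous_expsum2 R n.+1 a beta.
apply: (@le_trans _ _ (unit_int (fun s => expR 2 * expsum n.+1 a beta s ^+ 2))).
  apply: unit_int_le.
  - under eq_fun do rewrite hE exprMn; move=> x; apply: cvgM; last exact: c2.
    under eq_fun do rewrite expr2.
    by apply: cvgM; exact: continuous_expR.
  - exact: continuous_scale.
  - move=> s /andP[s0 s1]; rewrite hE exprMn ler_wpM2r ?sqr_ge0//.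
    by rewrite -expRM_natl ler_expR; lra.
rewrite unit_intZ// ler_wpM2l ?expR_ge0// unit_int_expsum2// lerBlDr lerDl.
exact: (cauchy_form_ge0 a0 aneq _ (leqnn n.+1)).
Qed.

Lemma laplace_small_ball_lower n k (tau t rho beta s : nat -> R) (delta : R) :
  (forall i, 0 <= tau i) -> (forall i j, (i < j < n)%N -> tau i != tau j) ->
  (forall j, 0 <= t j) ->
  0 < delta -> (forall l, 0 <= rho l) -> (forall l, 0 < beta l) -> (forall l, 0 <= s l) ->
  (forall j l, (j < k)%N -> (l <= n)%N ->
    expR 2 * (blaschke l (fun i => tau i + 1) (t j + 1) ^+ 2 / (2 * (t j + 1))) <= rho l ^+ 2) ->
  \sum_(l < n) (beta l ^+ 2 * (1 + s l))^-1 <= 1 / 8 ->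
  \sum_(l < n) rho l * beta l <= delta / 2 ->
  k%:R * rho n ^+ 2 / delta ^+ 2 <= 1 / 32 ->
  2^-1 * \prod_(l < n) (Num.sqrt (1 + s l))^-1 <=
  fine (P [set w | forall j, (j < k)%N -> `|X (t j) w| <= delta]).
Proof.
move=> tau0 tneq t0 d0 rho0 beta0 s0 hdist htail hsum hrest.
(* Nodes and tested times are put in one list, so that [e] and [f] live in the same space of rows;
   repetitions are harmless for a semi-definite form. *)
pose p i := if (i < n)%N then tau i else t (i - n)%N.
have p0 i : 0 <= p i by rewrite /p; case: ifP.
have p_n i : (i < n)%N -> p i = tau i by move=> i_n; rewrite /p i_n.
have pn j : p (n + j)%N = t j by rewrite /p ltnNge leq_addr/= addKn.
have -> : [set w | forall j, (j < k)%N -> `|X (t j) w| <= delta] =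
    [set w | forall j, (j < k)%N -> `|laplace_field X p (unit_row R (n + k) (n + j)) w| <= delta].
  apply/seteqP; split => w /= h j jk; have := h j jk;
  by rewrite laplace_field_unit_row ?ltn_add2l// pn.
apply: (gaussian_small_ball_lower (laplace_field_linear X p) (measurable_laplace_field X p)
  (Ex_standard_normal_cos BM) (laplace_gaussian_weight BM LX (n + k) p0)
  (e := unit_row R (n + k)) (rho := rho) (beta := beta)) => //.
move=> j l jk ln.
have tneq' i i' : (i < i' < l)%N -> tau i != tau i'.
  by move=> /andP[h1 h2]; rewrite tneq// h1 (leq_trans h2).
have [c hc] := laplace_dist_le tau0 tneq' (t0 j).
exists c; apply: le_trans (hdist j l jk ln); apply: le_trans hc.
rewrite le_eqVlt; apply/orP; left; apply/eqP; congr unit_int; apply/funext => x.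
rewrite -expr2 row_fun_combination ?(leq_trans ln) ?leq_addr//.
rewrite row_fun_unit_row ?ltn_add2l// pn; congr ((_ - _) ^+ 2).
by apply: eq_bigr => i _; rewrite p_n// (leq_trans (ltn_ord i)).
Qed.

End laplace_small_ball.

Section exponential_nodes.
Context (R : realType).
Implicit Types (x y : R) (n N : nat).

Lemma lcoth_le x y : 0 < x -> x <= y -> lcoth y <= lcoth x.
Proof.
move=> x0 xy; have y0 : 0 < y by exact: lt_le_trans xy.
have /andP[u0 u1] := expRN_lt1 x0; have /andP[v0 v1] := expRN_lt1 y0.
have uv : expR (- y) <= expR (- x) by rewrite ler_expR lerN2.
rewrite /lcoth; move: (expR (- x)) (expR (- y)) u0 u1 v0 v1 uv => u v u0 u1 v0 v1 uv.
have h1 : 0 < (1 + v) / (1 - v) by rewrite divr_gt0//; lra.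
rewrite ler_ln ?posrE//; last by rewrite divr_gt0//; lra.
rewrite ler_pdivrMr; last by lra.
by rewrite mulrAC ler_pdivlMr; [nra|lra].
Qed.

Lemma expRN_lcoth x : 0 < x -> expR (- lcoth x) = (1 - expR (- x)) / (1 + expR (- x)).
Proof.
move=> x0; have /andP[u0 u1] := expRN_lt1 x0.
rewrite /lcoth expRN lnK ?invf_div// posrE divr_gt0//; lra.
Qed.

Lemma norm_blaschke_expR n (y : nat -> R) x :
  (forall i, (i < n)%N -> y i != x) ->
  `|blaschke n (expR \o y) (expR x)| = expR (- \sum_(i < n) lcoth `|x - y i|).
Proof.
move=> hy; rewrite /blaschke normr_prod -sumrN expR_sum; apply: eq_bigr => i _ /=.
have ni : 0 < `|x - y i| by rewrite normr_gt0 subr_eq0 eq_sym hy.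
rewrite expRN_lcoth// normf_div [X in _ / X]ger0_norm ?addr_ge0 ?expR_ge0//.
have ex := expR_gt0 x; have ey := expR_gt0 (y i).
have [xy|xy] := leP x (y i).
  rewrite ler0_norm; last by rewrite subr_le0 ler_expR.
  rewrite ler0_norm; last by rewrite subr_le0.
  rewrite !opprB expRD (expRN (y i)).
  by field; rewrite !gt_eqF ?addr_gt0.
rewrite ger0_norm; last by rewrite subr_ge0 ler_expR ltW.
rewrite ger0_norm; last by rewrite subr_ge0 ltW.
rewrite opprB expRD expRN.
by field; rewrite !gt_eqF ?addr_gt0.
Qed.

End exponential_nodes.

(** * Nodes of the upper bound *)

Section upper_nodes.
Context (R : realType).
Variables (L A0 : R).
Hypothesis A0_ge0 : 0 <= A0.

(** The last index at which the radicand of [upper_level] is nonnegative. *)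
Definition upper_count : nat := Num.truncn (2 * A0 ^+ 2 / pi ^+ 2).

Local Notation N := upper_count.

Let pi2_gt0 : 0 < pi ^+ 2 :> R. Proof. by rewrite exprn_gt0 ?pi_gt0. Qed.

(* The logarithmic nodes have spacing [pi^2 / (A_i + A_(i+1))], the value at which
   the factor [exp (- A_i)] gained at node [i] is half spent on the interactions
   [lcoth] with the later nodes. *)
Definition upper_level (i : nat) : R := Num.sqrt (A0 ^+ 2 - pi ^+ 2 / 2 * i%:R).

Local Notation A := upper_level.

(** The solution of [1 - L + y / 2 = - A i]: before the interactions with the other nodes, node [i]
    contributes the factor [exp (- A i)]. *)
Definition upper_node (i : nat) : R := 2 * (L - 1 - A i).

Local Notation y := upper_node.

Lemma upper_level0 : A 0 = A0.
Proof. by rewrite /upper_level mulr0 subr0 sqrtr_sqr ger0_norm. Qed.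

Lemma upper_level_sqr i : (i <= N)%N -> A i ^+ 2 = A0 ^+ 2 - pi ^+ 2 / 2 * i%:R.
Proof.
move=> iN; rewrite sqr_sqrtr// subr_ge0.
have h : N%:R <= 2 * A0 ^+ 2 / pi ^+ 2.
  have q0 : 0 <= 2 * A0 ^+ 2 / pi ^+ 2 by apply: divr_ge0; [rewrite mulr_ge0// sqr_ge0|exact: ltW].
    by have /andP[] := truncn_itv q0.
have : i%:R <= 2 * A0 ^+ 2 / pi ^+ 2 by apply: le_trans h; rewrite ler_nat.
rewrite ler_pdivlMr//; lra.
Qed.

Lemma upper_level_ge0 i : 0 <= A i. Proof. exact: sqrtr_ge0. Qed.

Lemma upper_level_le i j : (i <= j)%N -> A j <= A i.
Proof.
move=> ij; apply: ler_wsqrtr; rewrite lerD2l lerN2 ler_wpM2l ?ler_nat//.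
by rewrite divr_ge0// ltW.
Qed.

Lemma upper_level_gt0 i : (i < N)%N -> 0 < A i.
Proof.
move=> iN; have h1 := upper_level_sqr (ltnW iN); have h2 := upper_level_sqr iN.
have := sqr_ge0 (A i.+1); rewrite h2 -[i.+1%:R]natr1 => h3.
have : 0 < A i ^+ 2 by rewrite h1; move: h3 pi2_gt0; lra.
by move=> h; rewrite lt_neqAle upper_level_ge0 eq_sym andbT; apply/eqP => e; move: h; rewrite e expr0n/= ltxx.
Qed.

Lemma upper_level_gap i : (i < N)%N -> (A i - A i.+1) * (A i + A i.+1) = pi ^+ 2 / 2.
Proof.
move=> iN; rewrite -subr_sqr !upper_level_sqr// 1?ltnW// -natr1; ring.
Qed.

(** The levels decrease, so the gaps increase: all the nodes after [j] are at least as spread as a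
    progression of step [pi^2 / (2 A_j)], for which [sum_lcoth_le] gives exactly [A_j / 2]. *)
Lemma upper_node_gap j l : (j <= l)%N -> (l < N)%N ->
  pi ^+ 2 / (2 * A j) <= y l.+1 - y l.
Proof.
move=> jl lN; have Aj : 0 < A j by apply: upper_level_gt0; exact: leq_ltn_trans lN.
have h1 := upper_level_gap lN; have h2 := upper_level_le jl.
have h3 := upper_level_ge0 l.+1; have h4 := upper_level_le (leqnSn l).
rewrite /upper_node ler_pdivrMr ?mulr_gt0//.
move: (A l.+1) (A l) (A j) h1 h2 h3 h4 Aj => a b c h1 h2 h3 h4 c0.
have : (b - a) * (b + a) <= (b - a) * (2 * c) by rewrite ler_wpM2l//; lra.
by rewrite h1; lra.
Qed.

Lemma upper_node_dist j k : (j + k <= N)%N -> (j < N)%N ->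
  pi ^+ 2 / (2 * A j) * k%:R <= y (j + k) - y j.
Proof.
move=> jkN jN; elim: k jkN => [|k IH] jkN; first by rewrite addn0 mulr0 subrr.
rewrite addnS in jkN *.
have := upper_node_gap (leq_addr k j) jkN; have := IH (ltnW jkN).
by rewrite -[k.+1%:R]natr1 mulrDr mulr1; lra.
Qed.

Lemma upper_node_lt i j : (i < j)%N -> (j < N)%N -> y i < y j.
Proof.
move=> ij jN; have iN := ltn_trans ij jN.
have := @upper_node_dist i (j - i); rewrite subnKC ?(ltnW ij)// => /(_ (ltnW jN) iN).
have h : 0 < pi ^+ 2 / (2 * A i) * (j - i)%:R.
  apply: mulr_gt0; last by rewrite ltr0n subn_gt0.
  by rewrite divr_gt0// mulr_gt0// upper_level_gt0.
lra.
Qed.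

Lemma sum_lcoth_upper_node j : (j < N)%N ->
  \sum_(j.+1 <= i < N) lcoth (y i - y j) <= A j / 2.
Proof.
move=> jN; have Aj := upper_level_gt0 jN; set h := pi ^+ 2 / (2 * A j).
have h0 : 0 < h by rewrite divr_gt0// mulr_gt0.
rewrite -{1}[j.+1]add0n big_addn big_mkord.
apply: (@le_trans _ _ (\sum_(k < N - j.+1) lcoth (h * k.+1%:R))).
  apply: ler_sum => k _; apply: lcoth_le; first by rewrite mulr_gt0.
  have := @upper_node_dist j k.+1; rewrite addnS -addSn addnC; apply => //.
  by rewrite addnC -leq_subRL// ltnW.
apply: (le_trans (sum_lcoth_le _ h0)).
rewrite /h le_eqVlt; apply/orP; left; apply/eqP.
move: (pi : R) (A j) Aj pi2_gt0 => p a a0 p0.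
by field; rewrite gt_eqF//= -(sqrf_eq0 p) gt_eqF.
Qed.

(** Each pair is charged to its earlier node, so only one-sided sums occur. *)
Lemma sum_pairs_upper_node :
  \sum_(i < N) \sum_(j < i) lcoth (y i - y j) <= (\sum_(j < N) A j) / 2.
Proof.
have -> : \sum_(i < N) \sum_(j < i) lcoth (y i - y j) =
    \sum_(i < N) \sum_(j < N | (j < i)%N) lcoth (y i - y j).
  apply: eq_bigr => i _.
  by rewrite (big_ord_widen N (fun j => lcoth (y i - y j)))// ltnW.
rewrite (exchange_big_dep xpredT)//= mulr_suml; apply: ler_sum => j _.
have := sum_lcoth_upper_node (ltn_ord j).
by rewrite big_geq_mkord.
Qed.

Lemma upper_level_cube i : (i < N)%N -> A i ^+ 3 - A i.+1 ^+ 3 <= 3 * pi ^+ 2 / 4 * A i.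
Proof.
move=> iN; have h1 := upper_level_gap iN.
have h3 := upper_level_ge0 i.+1; have h4 := upper_level_le (leqnSn i).
have h2 := upper_level_gt0 iN.
have e : pi ^+ 2 = 2 * ((A i - A i.+1) * (A i + A i.+1)) by rewrite h1; lra.
rewrite e; move: (A i) (A i.+1) h2 h3 h4 => a b a0 b0 ba.
have : 0 <= (a - b) * ((a - b) * (a + 2 * b)) by rewrite !mulr_ge0//; lra.
nra.
Qed.

(** Up to the factor [3 pi^2 / 4], each level dominates a difference of consecutive cubes. The 64 is
    [4^3], since the last level satisfies [A_N^2 < pi^2 / 2 < 16]. *)
Lemma sum_upper_level : 4 / (3 * pi ^+ 2) * (A0 ^+ 3 - 64) <= \sum_(j < N) A j.
Proof.
have -> : 4 / (3 * pi ^+ 2) = (3 * pi ^+ 2 / 4 : R)^-1 by rewrite invf_div.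
have p34 : 0 < 3 * pi ^+ 2 / 4 :> R by rewrite divr_gt0// mulr_gt0.
rewrite ler_pdivrMl// mulr_sumr.
apply: (@le_trans _ _ (\sum_(j < N) (A j ^+ 3 - A j.+1 ^+ 3))); last first.
  by apply: ler_sum => j _; exact: upper_level_cube.
have -> : \sum_(j < N) (A j ^+ 3 - A j.+1 ^+ 3) = A 0 ^+ 3 - A N ^+ 3.
  elim: N => [|n IH]; first by rewrite big_ord0 subrr.
  by rewrite big_ord_recr/= IH addrA subrK.
rewrite upper_level0 lerD2l lerN2.
have : A N <= 4.
  rewrite -ler_sqr ?nnegrE ?upper_level_ge0// upper_level_sqr//.
  have : 2 * A0 ^+ 2 / pi ^+ 2 < N.+1%:R by exact: truncnS_gt.
  rewrite ltr_pdivrMr// -[N.+1%:R]natr1 => h.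
  have p4 : pi ^+ 2 <= 4 ^+ 2 :> R by rewrite ler_sqr ?nnegrE ?pi_ge0//; have := pihalf_lt2 R; lra.
  by lra.
move=> h; have h' := upper_level_ge0 N.
apply: (@le_trans _ _ (4 ^+ 3)); last by lra.
by rewrite lerXn2r ?nnegrE.
Qed.

Lemma upper_factor_le i : (i < N)%N ->
  expR (2^-1) * expR (- L) / Num.sqrt (cauchy_dist i (expR \o y)) <=
  expR (- A i + \sum_(j < i) lcoth (y i - y j)).
Proof.
move=> iN; set S := \sum_(j < i) _.
have hB : `|blaschke i (expR \o y) (expR (y i))| = expR (- S).
  rewrite norm_blaschke_expR; last first.
    by move=> j ji; rewrite lt_eqF// upper_node_lt.
  congr (expR (- _)); apply: eq_bigr => j _; rewrite ger0_norm// subr_ge0 ltW// upper_node_lt//.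
have D0 : expR (- S - 2^-1 - y i / 2) <= Num.sqrt (cauchy_dist i (expR \o y)).
  rewrite -[leLHS]ger0_norm ?expR_ge0// -sqrtr_sqr; apply: ler_wsqrtr.
  rewrite /cauchy_dist /= -[X in _ <= X / _]real_normK ?num_real// hB.
  have -> : expR (- S - 2^-1 - y i / 2) ^+ 2 = expR (- S) ^+ 2 * expR (-1) * expR (- y i).
    by rewrite -!expRM_natl -!expRD; congr expR; lra.
  rewrite invfM -mulrA ler_wpM2l ?sqr_ge0// (expRN 1) (expRN (y i)) ler_wpM2r ?invr_ge0 ?expR_ge0//.
  by rewrite lef_pV2 ?posrE ?expR_gt0//; have := expR_ge1Dx (1 : R); lra.
have D1 : 0 < Num.sqrt (cauchy_dist i (expR \o y)) by exact: lt_le_trans (expR_gt0 _) D0.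
rewrite ler_pdivrMr//; apply: (@le_trans _ _ (expR (- A i + S) * expR (- S - 2^-1 - y i / 2))); last first.
  by rewrite ler_wpM2l// expR_ge0.
by rewrite -!expRD ler_expR /upper_node; lra.
Qed.

Lemma upper_product_le :
  \prod_(i < N) (expR (2^-1) * expR (- L) / Num.sqrt (cauchy_dist i (expR \o y))) <=
  expR (- (2 / (3 * pi ^+ 2) * (A0 ^+ 3 - 64))).
Proof.
apply: (@le_trans _ _ (\prod_(i < N) expR (- A i + \sum_(j < i) lcoth (y i - y j)))).
  apply: ler_prod => i _; rewrite upper_factor_le// andbT.
  by rewrite !mulr_ge0 ?expR_ge0 ?invr_ge0 ?sqrtr_ge0.
rewrite -expR_sum ler_expR big_split/= sumrN.
have h1 := sum_pairs_upper_node; have h2 := sum_upper_level.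
have -> : 2 / (3 * pi ^+ 2) * (A0 ^+ 3 - 64) = (4 / (3 * pi ^+ 2) * (A0 ^+ 3 - 64)) / 2.
  by move: (pi ^+ 2 : R) pi2_gt0 => p p0; field; rewrite gt_eqF.
lra.
Qed.

End upper_nodes.

Section log_bounds.
Context (R : realType).

(** First term of the artanh series at 1/3. It keeps [log L] away from 0 for [delta < 1/4], so that
    constants are absorbed in the error. *)
Lemma ln4_ge : 4 / 3 <= ln (4 : R).
Proof.
have h : 0 <= (3^-1 : R) < 1 by apply/andP; split; lra.
have := artanh_ge 1 h; rewrite /artanh_partial big_ord1/= expr1 divr1.
have -> : (1 + 3^-1) / (1 - 3^-1) = 2 :> R by field.
have -> : ln (4 : R) = 2 * ln 2 by rewrite mulr_natl -lnXn// -natrX.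
lra.
Qed.

Lemma ln_ge_quarter (L : R) : 4 / 3 <= L -> 1 / 4 <= ln L.
Proof.
move=> hL; have L0 : 0 < L by lra.
have := expR_ge1Dx (- ln L); rewrite expRN lnK ?posrE// => h.
have : L^-1 <= 3 / 4 by rewrite -[X in _ <= X]invrK lef_pV2 ?posrE// ?invf_div//; lra.
lra.
Qed.

Lemma ln_le_self (L : R) : 0 < L -> ln L <= L.
Proof. by move=> L0; have := expR_ge1Dx (ln L); rewrite lnK ?posrE//; lra. Qed.

End log_bounds.

Section laplace_upper.
Context (d : measure_display) (T : measurableType d) (R : realType).
Variables (P : probability T R) (B X : R -> {RV P >-> R}).
Hypotheses (BM : standard_brownian_motion B) (LX : continuous_laplace_process B X).

Lemma laplace_upper (L : R) : 4 / 3 <= L ->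
  exists N (a : nat -> R), (forall i, 0 <= a i) /\
  fine (P [set w | forall i, (i < N)%N -> `|X (a i) w| <= expR (- L)]) <=
  expR (- (2 / (3 * pi ^+ 2)) * L ^+ 3 + 50 * (L ^+ 2 * ln L)).
Proof.
move=> hL; have L0 : 0 < L by lra.
have hl := ln_ge_quarter hL; set l := ln L in hl *.
(* With [A0 = L - g] the smallest node is [exp (y 0) = 2 L], and the tail [N exp (- 4 L) / (4 L)] is
   below [delta^2] because [N <= L^2]. If [L <= g] then [A0 = 0] and there is no node at all. *)
pose g := 1 + ln (2 * L) / 2; pose A0 := Num.max 0 (L - g).
have ln2 : 0 <= ln (2 : R) <= 1.
  by rewrite ln_ge0 ?ler1n//=; have := expR_ge1Dx (ln (2 : R)); rewrite lnK ?posrE//; lra.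
have gE : g = 1 + (ln 2 + l) / 2 by rewrite /g lnM ?posrE.
have g0 : 0 <= g by rewrite gE; lra.
have A00 : 0 <= A0 by rewrite le_max lexx.
have p4 : 4 <= pi ^+ 2 :> R by have := pi_ge2 R; nra.
set N := upper_count A0; set y := upper_node L A0.
pose m := expR (y 0%N).
have NE : N%:R <= 2 * A0 ^+ 2 / pi ^+ 2.
  have h : 0 <= 2 * A0 ^+ 2 / pi ^+ 2 by apply: divr_ge0; [rewrite mulr_ge0// sqr_ge0|lra].
  by rewrite /N /upper_count; have /andP[] := truncn_itv h.
exists N, (expR \o y); split; first by move=> i; exact: expR_ge0.
apply: (@le_trans _ _ (expR (- (2 / (3 * pi ^+ 2) * (A0 ^+ 3 - 64))))).
  apply: le_trans (upper_product_le L A00).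
  apply: (laplace_small_ball_upper BM LX (m := m)).
  - exact: expR_gt0.
  - move=> i; rewrite ler_expR /y /upper_node.
    by have := @upper_level_le R A0 0 i (leq0n i); lra.
  - move=> i j /andP[ij jN]; rewrite (inj_eq (@expR_inj R)) lt_eqF//.
    exact: upper_node_lt.
  - exact: expR_gt0.
  - have [h|h] := leP (L - g) 0.
      have A0E : A0 = 0 by rewrite /A0 max_l.
      have -> : N = 0%N by rewrite /N /upper_count A0E expr0n/= mulr0 mul0r truncn0.
      by rewrite !mul0r sqr_ge0.
    have A0E : A0 = L - g by rewrite /A0 max_r// ltW.
    have mE : m = 2 * L.
      rewrite /m /y /upper_node upper_level0// A0E.
      have -> : 2 * (L - 1 - (L - g)) = ln (2 * L) by rewrite /g; lra.
      by rewrite lnK// posrE mulr_gt0.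
    have N1 : N%:R <= L ^+ 2.
      apply: (le_trans NE); rewrite ler_pdivrMr; last by lra.
      have hA : A0 ^+ 2 <= L ^+ 2 by rewrite lerXn2r ?nnegrE//; lra.
      have := sqr_ge0 L; nra.
    rewrite mE -expRM_natl ler_pdivrMr; last by lra.
    have -> : - (2 * (2 * L)) = 2 * (- L) + (2 * - L) by ring.
    have eL : expR (- L) * L <= 1.
      by rewrite expRN mulrC ler_pdivrMr ?expR_gt0// mul1r; have := expR_ge1Dx L; lra.
    have e0 := expR_gt0 (- L).
    rewrite expRD !expRM_natl.
    have h1 : N%:R * expR (- L) ^+ 2 <= 1.
      apply: (@le_trans _ _ ((expR (- L) * L) ^+ 2)).
        by rewrite exprMn mulrC ler_wpM2l// sqr_ge0.
      by rewrite exprn_ile1// mulr_ge0// ltW.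
    rewrite mulrA mulrC ler_wpM2l ?sqr_ge0//; lra.
rewrite ler_expR.
set k : R := 2 / (3 * pi ^+ 2).
have k0 : 0 <= k by rewrite /k divr_ge0//; lra.
have k1 : k <= 1 / 6.
  by rewrite /k ler_pdivrMr; lra.
have hA : L ^+ 3 - 3 * L ^+ 2 * g <= A0 ^+ 3.
  have [h|h] := leP (L - g) 0.
    have -> : A0 = 0 by rewrite /A0 max_l.
    rewrite expr0n/=; have := sqr_ge0 L; nra.
  have -> : A0 = L - g by rewrite /A0 max_r// ltW.
  have : 0 <= g ^+ 2 * (3 * L - g) by rewrite mulr_ge0 ?sqr_ge0//; lra.
  lra.
have L2 : 1 <= L ^+ 2 by nra.
(* [1 <= L^2] and [1 / 4 <= l] turn the constants into multiples of [L^2 * l]; with [k <= 1 / 6],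
   the 300 becomes the 50 of the statement. *)
have h1 : 3 * L ^+ 2 * g + 64 <= 300 * (L ^+ 2 * l).
  have hg : g <= 3 / 2 + l / 2 by rewrite gE; lra.
  have h2 : L ^+ 2 * g <= L ^+ 2 * (3 / 2 + l / 2) by rewrite ler_wpM2l//; lra.
  have h3 : L ^+ 2 * (1 / 4) <= L ^+ 2 * l by rewrite ler_wpM2l//; lra.
  lra.
have h2 : k * (3 * L ^+ 2 * g + 64) <= 1 / 6 * (300 * (L ^+ 2 * l)).
  apply: ler_pM => //; rewrite addr_ge0// !mulr_ge0//; lra.
have h3 := ler_wpM2l k0 hA.
move: (L ^+ 2) (L ^+ 3) (A0 ^+ 3) L2 h1 h2 h3 => x z a L2 h1 h2 h3; lra.
Qed.

End laplace_upper.

(** * The lower bound *)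

Section consecutive_blocks.
Variable m : nat -> nat.
Hypothesis m_gt0 : forall g, (0 < m g)%N.

Definition block_start (g : nat) : nat := (\sum_(h < g) m h)%N.

Local Notation M := block_start.

(** Counts the blocks that end at or before [l]; as blocks are nonempty, the indices [h < l]
    suffice. *)
Definition block_of (l : nat) : nat := (\sum_(h < l) (M h.+1 <= l)%N)%N.

Definition block_pos (l : nat) : nat := (l - M (block_of l))%N.

Lemma block_startS g : M g.+1 = (M g + m g)%N.
Proof. by rewrite /M big_ord_recr. Qed.

Lemma block_start_le g h : (g <= h)%N -> (M g <= M h)%N.
Proof.
move=> /subnKC <-; elim: (h - g)%N => [|k IH]; first by rewrite addn0.
by rewrite addnS block_startS (leq_trans IH)// leq_addr.
Qed.

Lemma leq_block_start g : (g <= M g)%N.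
Proof.
elim: g => // g IH; rewrite block_startS -addn1.
by rewrite leq_add// m_gt0.
Qed.

Lemma block_ofE g i : (i < m g)%N -> block_of (M g + i) = g.
Proof.
move=> im; rewrite /block_of.
have E h : (M h.+1 <= M g + i)%N = (h < g)%N.
  have [hg|gh] := ltnP h g; first by rewrite (leq_trans (block_start_le hg))// leq_addr.
  apply/negbTE; rewrite -ltnNge (leq_trans _ (block_start_le (gh : g.+1 <= h.+1)%N))//.
  by rewrite block_startS ltn_add2l.
under eq_bigr do rewrite E.
have gl : (g <= M g + i)%N by rewrite (leq_trans (leq_block_start g))// leq_addr.
rewrite -(subnKC gl) big_split_ord/= [X in (_ + X)%N]big1 ?addn0; last first.
  by move=> h _; rewrite ltnNge leq_addr.
under eq_bigr do rewrite ltn_ord.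
by rewrite sum_nat_const card_ord muln1.
Qed.

Lemma block_posE g i : (i < m g)%N -> block_pos (M g + i) = i.
Proof. by move=> im; rewrite /block_pos block_ofE// addKn. Qed.

Lemma block_decomp l : exists g i, (i < m g)%N /\ l = (M g + i)%N.
Proof.
elim: l => [|l [g [i [im ->]]]].
  by exists 0%N, 0%N; rewrite m_gt0 /M big_ord0.
have [h|h] := ltnP i.+1 (m g); first by exists g, i.+1; rewrite addnS.
exists g.+1, 0%N; split; first exact: m_gt0.
by rewrite block_startS addn0 -addnS; congr (_ + _)%N; apply/eqP; rewrite eqn_leq im h.
Qed.

Lemma sum_blocks (V : nmodType) (F : nat -> nat -> V) G :
  \sum_(l < M G) F (block_of l) (block_pos l) = \sum_(g < G) \sum_(i < m g) F g i.
Proof.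
elim: G => [|G IH]; first by rewrite big_ord0 /M !big_ord0.
rewrite big_ord_recr/= -IH block_startS big_split_ord/=; congr (_ + _).
by apply: eq_bigr => i _; rewrite block_ofE ?block_posE.
Qed.

End consecutive_blocks.

(** * Groups of nodes of the lower bound and their gain *)

Section mirrored_grids.
Context (R : realType) (p : nat).
Implicit Types (y : R) (g i : nat).

Local Notation n := (2 ^ p)%N.
Local Notation J := ((2 ^ p) ^ 2)%N.
Local Notation r := ((2 ^ p)%:R : R).

Definition mesh : R := pi ^+ 2 / (2 * r).

Definition grid_extent g : nat := Num.truncn (2 * r * g.+1%:R / mesh + 1).

(** The [2 J] extra nodes ensure that every [y] from 0 to [2 r (g + 1)], ends included, has the
    [J = r^2] neighbours on each side required by [sum_lcoth_ge]. *)
Definition grid_size g : nat := (grid_extent g + 2 * J)%N.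

(* Distinct shifts below 1/2 keep the folded grids disjoint. *)
Definition grid_shift g : R := (g.+4%:R)^-1.

(* The grid [(Z + theta) * mesh] folded at 0, which only brings its nodes closer
   to a given [y >= 0]. *)
Definition grid_node g i : R := `|(i%:R - J%:R + grid_shift g) * mesh|.

Definition group_gain : R := r - (6 + 4 * p%:R).

Lemma mesh_gt0 : 0 < mesh.
Proof. by rewrite divr_gt0 ?exprn_gt0 ?pi_gt0// mulr_gt0// ltr0n expn_gt0. Qed.

Lemma grid_size_gt0 g : (0 < grid_size g)%N.
Proof. by rewrite addn_gt0 muln_gt0 !expn_gt0 orbT. Qed.

Lemma grid_shift_itv g : 0 < grid_shift g <= 1 / 4.
Proof.
rewrite invr_gt0 ltr0n/= div1r lef_pV2 ?posrE ?ltr0n//.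
by rewrite (ler_nat R 4).
Qed.

Lemma sum_sub_ge (F : nat -> R) a k N : (forall i, 0 <= F i) -> (a + k <= N)%N ->
  \sum_(i < k) F (a + i)%N <= \sum_(i < N) F i.
Proof.
move=> F0 /subnKC <-; rewrite !big_split_ord/= -addrA addrCA lerDl.
by rewrite addr_ge0// sumr_ge0.
Qed.

Lemma group_gain_le g y : 0 <= y <= 2 * r * g.+1%:R ->
  (forall i, (i < grid_size g)%N -> grid_node g i != y) ->
  group_gain <= \sum_(i < grid_size g) lcoth `|y - grid_node g i|.
Proof.
move=> /andP[y0 yr] hne; have e0 := mesh_gt0.
have /andP[t0 t1] := grid_shift_itv g; set th := grid_shift g in t0 t1 *.
have ye0 : 0 <= y / mesh by rewrite divr_ge0// ltW.
(* Before folding, node [i] is at [(i - J + th) * mesh], so [y] lies between nodes [i0 + J - 1] and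
   [i0 + J]: the [J] indices from [i0] are on its left and the next [J] on its right. *)
pose i0 := Num.truncn (y / mesh + 1 - th).
have /andP[hi0 hi1] : i0%:R <= y / mesh + 1 - th < i0.+1%:R by apply: truncn_itv; lra.
have i0c : (i0 <= grid_extent g)%N.
  apply: le_truncn; apply: (@le_trans _ _ (y / mesh + 1)); first by lra.
  by rewrite lerD2r ler_pM2r ?invr_gt0.
have i0y : (i0%:R - 1 + th) * mesh <= y by rewrite -ler_pdivlMr//; lra.
have yi0 : y <= (i0%:R + th) * mesh.
  by rewrite -ler_pdivrMr//; move: hi1; rewrite -[i0.+1%:R]natr1; lra.
pose F i := if (i < grid_size g)%N then lcoth `|y - grid_node g i| else 0.
have -> : \sum_(i < grid_size g) lcoth `|y - grid_node g i| = \sum_(i < grid_size g) F i.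
  by apply: eq_bigr => i _; rewrite /F ltn_ord.
have d0 i : (i < grid_size g)%N -> 0 < `|y - grid_node g i|.
  by move=> ig; rewrite normr_gt0 subr_eq0 eq_sym hne.
have F0 i : 0 <= F i by rewrite /F; case: ifP => // ig; apply: lcoth_ge0; exact: d0.
have Fge i (k : R) : (i < grid_size g)%N -> `|y - (i%:R - J%:R + th) * mesh| <= k ->
    lcoth k <= F i.
  move=> ig hk; rewrite /F ig; apply: lcoth_le; first exact: d0.
  apply: le_trans hk; rewrite /grid_node -{1}[y]ger0_norm//.
  exact: ler_dist_dist.
have le1 : (i0 + 2 * J <= grid_size g)%N by rewrite leq_add2r.
apply: le_trans (sum_sub_ge F0 le1).
have -> : (2 * J = J + J)%N by rewrite mul2n addnn.
rewrite big_split_ord/=.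
have h := @sum_lcoth_ge R p r erefl.
have hl : r / 2 - (3 + 2 * p%:R) <= \sum_(i < J) F (i0 + i)%N.
  apply: (le_trans h); rewrite (reindex_inj rev_ord_inj)/=; apply: ler_sum => j _.
  have jJ := ltn_ord j.
  apply: Fge; first by rewrite (leq_trans _ le1)// ltn_add2l (leq_trans jJ)// leq_pmull.
  rewrite ger0_norm; last first.
    rewrite subr_ge0; apply: le_trans i0y; rewrite ler_pM2r// natrD.
    by have : j.+1%:R <= J%:R :> R; [rewrite ler_nat|rewrite -[j.+1%:R]natr1; lra].
  rewrite (subnSK jJ) (natrB _ (ltnW jJ)) natrD -/mesh.
  have : (i0%:R + th) * mesh - (i0%:R + j%:R - J%:R + th) * mesh = mesh * (J%:R - j%:R) by ring.
  lra.
have hr : r / 2 - (3 + 2 * p%:R) <= \sum_(i < J) F (i0 + (J + i))%N.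
  apply: (le_trans h); apply: ler_sum => j _.
  have jJ := ltn_ord j.
  apply: Fge; first by rewrite (leq_trans _ le1)// ltn_add2l mul2n -addnn ltn_add2l.
  rewrite ler0_norm; last first.
    rewrite subr_le0; apply: le_trans yi0 _; rewrite ler_pM2r// !natrD.
    by have : 0 <= j%:R :> R by []; lra.
  rewrite opprB -/mesh !natrD -[j.+1%:R]natr1.
  have : (i0%:R + (J%:R + j%:R) - J%:R + th) * mesh - (i0%:R - 1 + th) * mesh = mesh * (j%:R + 1) by ring.
  lra.
rewrite /group_gain; move: hl hr; lra.
Qed.

(** Equality after folding makes an integer equal to a difference or to a sum of two shifts, hence
    equal to 0. A difference then forces equal shifts, and a sum of positive shifts is
    impossible. *)
Lemma grid_node_inj g i g' i' : grid_node g i = grid_node g' i' -> g = g' /\ i = i'.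
Proof.
have m0 : `|mesh| != 0 by rewrite normr_eq0 gt_eqF// mesh_gt0.
rewrite /grid_node !(normrM _ mesh) => E0; have E := mulIf m0 E0.
have /andP[t0 t1] := grid_shift_itv g; have /andP[u0 u1] := grid_shift_itv g'.
have key (k : int) : `|k%:~R : R| < 1 -> k = 0.
  by rewrite -intr_norm -[1]/(1%:~R) ltr_int; lia.
move/eqP: E; rewrite eqr_norm2 => /orP[]/eqP e.
  have hk : ((i%:Z - i'%:Z)%:~R : R) = grid_shift g' - grid_shift g.
    by rewrite intrB; move: e; rewrite -!pmulrn; lra.
  have /key h : `|(i%:Z - i'%:Z)%:~R : R| < 1.
    by rewrite hk; have := ler_norm (grid_shift g' - grid_shift g); rewrite ltr_norml; lra.
  have ii : i = i' by lia.
  move: hk; rewrite h mulr0z => /eqP; rewrite eq_sym subr_eq0 => /eqP /invr_inj /eqP.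
  by rewrite eqr_nat => /eqP[->].
have hk : ((J%:Z + J%:Z - i%:Z - i'%:Z)%:~R : R) = grid_shift g' + grid_shift g.
  by rewrite !(intrB, intrD); move: e; rewrite -!pmulrn; lra.
have /key h : `|(J%:Z + J%:Z - i%:Z - i'%:Z)%:~R : R| < 1 by rewrite hk ltr_norml; lra.
by exfalso; move: hk; rewrite h mulr0z; lra.
Qed.

Lemma grid_node_ge0 g i : 0 <= grid_node g i. Proof. exact: normr_ge0. Qed.

Local Notation M := (block_start grid_size).

Definition flat_node (l : nat) : R :=
  grid_node (block_of grid_size l) (block_pos grid_size l).

Lemma flat_node_inj : injective flat_node.
Proof.
move=> l l'; have [g [i [ig ->]]] := block_decomp grid_size_gt0 l.
have [g' [i' [ig' ->]]] := block_decomp grid_size_gt0 l'.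
rewrite /flat_node !(block_ofE grid_size_gt0) ?(block_posE grid_size_gt0)//.
by move=> /grid_node_inj[-> ->].
Qed.

(** The last group gives its full gain if it reaches [y]. If not, [y / 2] alone exceeds all [G]
    gains; this term will be paid by the norm of [exp (- e^y s)], which is why group [g] need not
    extend beyond [2 r (g + 1)]. *)
Lemma flat_gain_le G y : 0 <= group_gain -> 0 <= y ->
  (forall l, (l < M G)%N -> flat_node l != y) ->
  G%:R * group_gain <= \sum_(l < M G) lcoth `|y - flat_node l| + y / 2.
Proof.
move=> hg y0 hne.
have hne' g i : (g < G)%N -> (i < grid_size g)%N -> grid_node g i != y.
  move=> gG ig; have := hne (M g + i)%N.
  rewrite /flat_node (block_ofE grid_size_gt0)// (block_posE grid_size_gt0)//; apply.
  by apply: leq_trans (block_start_le grid_size gG); rewrite block_startS ltn_add2l.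
rewrite (@sum_blocks grid_size grid_size_gt0 R (fun g i => lcoth `|y - grid_node g i|)).
elim: G hne' {hne} => [|G IH] hne; first by rewrite big_ord0 mul0r add0r divr_ge0.
rewrite big_ord_recr/=.
have IH' := IH (fun g i gG => hne g i (ltnW gG)).
have pos g : (g < G.+1)%N -> 0 <= \sum_(i < grid_size g) lcoth `|y - grid_node g i|.
  move=> gG; apply: sumr_ge0 => i _; apply: lcoth_ge0.
  by rewrite normr_gt0 subr_eq0 eq_sym hne.
have [h|h] := leP y (2 * r * G.+1%:R).
  have := @group_gain_le G y; rewrite y0 h => /(_ isT (fun i => hne G i (ltnSn G))).
  by rewrite -[G.+1%:R]natr1; lra.
have h1 : 0 <= \sum_(g < G) \sum_(i < grid_size g) lcoth `|y - grid_node g i|.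
  by apply: sumr_ge0 => g _; apply: pos; rewrite ltnW// ltnS.
have h2 := pos G (ltnSn G).
have h3 : G.+1%:R * group_gain <= G.+1%:R * r.
  by rewrite ler_wpM2l// /group_gain; have : 0 <= p%:R :> R by []; lra.
lra.
Qed.

Lemma norm_blaschke_le1 l (a : nat -> R) t : (forall i, 0 < a i) -> 0 < t ->
  `|blaschke l a t| <= 1.
Proof.
move=> a0 t0; rewrite /blaschke normr_prod; apply: prodr_ile1 => i _.
rewrite normr_ge0/= normf_div [X in _ / X]ger0_norm; last by rewrite addr_ge0// ltW.
rewrite ler_pdivrMr ?addr_gt0// mul1r.
by rewrite (le_trans (ler_normB _ _))// !gtr0_norm.
Qed.

(** Only the [g] complete groups are counted, the nodes of the current group giving factors at most
    1. The term [y / 2] of [flat_gain_le] cancels against [exp (- y)]. *)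
Lemma flat_dist_le g i y : 0 <= group_gain -> 0 <= y ->
  expR 2 * (blaschke (M g + i) (expR \o flat_node) (expR y) ^+ 2 / (2 * expR y)) <=
  expR (1 - g%:R * group_gain) ^+ 2.
Proof.
move=> hg y0.
have hB : `|blaschke (M g + i) (expR \o flat_node) (expR y)| <=
          `|blaschke (M g) (expR \o flat_node) (expR y)|.
  rewrite /blaschke big_split_ord/= normrM ler_piMr//.
  apply: (@norm_blaschke_le1 i (fun j => expR (flat_node (M g + j)))); last exact: expR_gt0.
  by move=> j; exact: expR_gt0.
have hB2 : `|blaschke (M g) (expR \o flat_node) (expR y)| <= expR (y / 2 - g%:R * group_gain).
  have [/existsP[l /eqP hl]|/existsPn hl] := boolP [exists l : 'I_(M g), flat_node l == y].
    rewrite /blaschke (bigD1 l)//= hl subrr !mul0r normr0; exact: expR_ge0.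
  have hne l : (l < M g)%N -> flat_node l != y by move=> lM; exact: (hl (Ordinal lM)).
  rewrite norm_blaschke_expR// ler_expR.
  by have := flat_gain_le hg y0 hne; lra.
have hB3 := le_trans hB hB2.
have hB4 : blaschke (M g + i) (expR \o flat_node) (expR y) ^+ 2 <= expR (y / 2 - g%:R * group_gain) ^+ 2.
  by rewrite -[leLHS]real_normK ?num_real// lerXn2r ?nnegrE ?expR_ge0.
have -> : expR (1 - g%:R * group_gain) ^+ 2 = expR 2 * (expR (y / 2 - g%:R * group_gain) ^+ 2 / expR y).
  rewrite -expRN -!expRM_natl -!expRD; congr expR; lra.
rewrite ler_wpM2l ?expR_ge0//; apply: ler_pM => //.
- exact: sqr_ge0.
- rewrite lef_pV2 ?posrE ?mulr_gt0 ?expR_gt0// ler_peMl ?expR_ge0//; lra.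
Qed.

End mirrored_grids.

(** * Sums of truncated arithmetic progressions *)

Section truncated_sums.
Context (R : realType).
Variables (A h : R).
Hypotheses (A_ge0 : 0 <= A) (h_gt0 : 0 < h).
Implicit Types m g G : nat.

Lemma sum_linear m : \sum_(g < m.+1) (A - h * g%:R) =
  A + m%:R * A - h * m%:R * (m%:R + 1) / 2.
Proof.
elim: m => [|m IH]; first by rewrite big_ord1/=; field.
by rewrite big_ord_recr/= IH -[m.+1%:R]natr1; field.
Qed.

Lemma sum_quadratic m : h ^+ 2 * (\sum_(g < m.+1) g%:R * (A - h * g%:R)) =
  A * (h * m%:R) ^+ 2 / 2 - (h * m%:R) ^+ 3 / 3
  + h / 2 * (h * m%:R) * (A - h * m%:R) - m%:R * h ^+ 3 / 6.
Proof.
elim: m => [|m IH]; first by rewrite big_ord1/=; field.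
by rewrite big_ord_recr/= mulrDr IH -[m.+1%:R]natr1; field.
Qed.

Lemma sum_truncate (F : nat -> R) m G : (forall g, 0 <= F g) ->
  (forall g, (m < g)%N -> F g = 0) -> \sum_(g < G) F g <= \sum_(g < m.+1) F g.
Proof.
move=> F0 Fm; have [mG|mG] := leqP G m.+1.
  have := @sum_sub_ge R F 0 G m.+1 F0 mG.
  by under eq_bigr do rewrite add0n.
rewrite -(subnKC (ltnW mG)) big_split_ord/= [X in _ + X]big1 ?addr0// => g _.
by rewrite Fm// ltn_addr.
Qed.

Let cut := Num.truncn (A / h).

Let cut_le : h * cut%:R <= A.
Proof.
have : 0 <= A / h by rewrite divr_ge0// ltW.
by move=> /truncn_itv/andP[+ _]; rewrite ler_pdivlMr// mulrC.
Qed.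

Let pos_part_le g : (g <= cut)%N -> Num.max 0 (A - h * g%:R) = A - h * g%:R.
Proof.
move=> gc; apply: max_r; rewrite subr_ge0 (le_trans _ cut_le)// ler_pM2l//.
by rewrite ler_nat.
Qed.

Let pos_part_gt g : (cut < g)%N -> Num.max 0 (A - h * g%:R) = 0.
Proof.
move=> cg; apply: max_l; rewrite subr_le0.
have : A / h < g%:R by rewrite -truncn_lt_nat// divr_ge0// ltW.
by rewrite ltr_pdivrMr// mulrC => /ltW.
Qed.

Lemma sum_pos_part_le G : \sum_(g < G) Num.max 0 (A - h * g%:R) <= A + A ^+ 2 / (2 * h).
Proof.
apply: (le_trans (@sum_truncate (fun g => Num.max 0 (A - h * g%:R)) cut G _ _)).
- by move=> g; rewrite le_max lexx.
- by move=> g; exact: pos_part_gt.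
have -> : \sum_(g < cut.+1) Num.max 0 (A - h * g%:R) = \sum_(g < cut.+1) (A - h * g%:R).
  by apply: eq_bigr => g _; rewrite pos_part_le// -ltnS.
rewrite sum_linear.
rewrite -addrA lerD2l ler_pdivlMr ?mulr_gt0//.
have := cut_le; have : 0 <= cut%:R :> R by [].
move: (cut%:R : R) => x x0 hx.
have := sqr_ge0 (A - h * x); have : 0 <= h * (h * x) by rewrite !mulr_ge0// ltW.
lra.
Qed.

(** With [x = h * cut], the exact sum is bounded at the worst [x]: the integral part
    [A x^2 / 2 - x^3 / 3] is largest at [x = A], the correction [h x (A - x) / 2] at [x = A / 2]. *)
Lemma sum_weighted_pos_part_le G :
  h ^+ 2 * (\sum_(g < G) g%:R * Num.max 0 (A - h * g%:R)) <= A ^+ 3 / 6 + h * A ^+ 2 / 8.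
Proof.
have h2 : 0 <= h ^+ 2 by exact: sqr_ge0.
apply: (le_trans (ler_wpM2l h2 (@sum_truncate (fun g => g%:R * Num.max 0 (A - h * g%:R)) cut G _ _))).
- by move=> g; rewrite mulr_ge0// le_max lexx.
- by move=> g cg; rewrite pos_part_gt// mulr0.
have -> : \sum_(g < cut.+1) g%:R * Num.max 0 (A - h * g%:R) =
    \sum_(g < cut.+1) g%:R * (A - h * g%:R).
  by apply: eq_bigr => g _; rewrite pos_part_le// -ltnS.
rewrite sum_quadratic.
have := cut_le; have c0 : 0 <= cut%:R :> R by [].
have : 0 <= cut%:R * h ^+ 3 / 6 by rewrite divr_ge0// mulr_ge0// exprn_ge0// ltW.
have : 0 <= h * cut%:R by rewrite mulr_ge0// ltW.
move: (h * cut%:R) (cut%:R * h ^+ 3 / 6) => x z x0 z0 xA.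
have e1 : 0 <= (A - x) ^+ 2 * (A + 2 * x) by rewrite mulr_ge0 ?sqr_ge0//; lra.
have e2 : 0 <= h * (A - 2 * x) ^+ 2 by rewrite mulr_ge0 ?sqr_ge0// ltW.
lra.
Qed.

End truncated_sums.

(** * Cost of the lower bound *)

Section lower_cost.
Context (R : realType) (p : nat).
Implicit Types (g G : nat) (L : R).
Local Notation r := ((2 ^ p)%:R : R).
Local Notation M := (block_start (grid_size R p)).

(** The value for which [tilt_scale_le] holds with the same loss in the constant and in the slope:
    the 6 of the scale, the squared weight and the leading [e] give [3 + 2 (2p + 3) + 1], while the
    slope loses [6 + 4p] from the gain and 4 from the squared weight. *)
Definition grid_loss : R := 10 + 4 * p%:R.

Lemma grid_size_le g :
  (grid_size R p g)%:R <= 4 / pi ^+ 2 * r ^+ 2 * g%:R + 4 * r ^+ 2.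
Proof.
have r1 : 1 <= r by rewrite ler1n expn_gt0.
have pi0 := pi_gt0 R; have p4 : 4 <= pi ^+ 2 :> R by have := pi_ge2 R; nra.
have e : 2 * r * g.+1%:R / mesh R p = 4 / pi ^+ 2 * r ^+ 2 * g.+1%:R.
  rewrite /mesh; have r0 : r != 0 by rewrite gt_eqF//; lra.
  move: (pi : R) pi0 => x x0; move: (2 ^ p)%:R r0 => y y0.
  by field; rewrite y0 gt_eqF.
have r2 : 1 <= r ^+ 2 by nra.
have q1 : 4 / pi ^+ 2 <= 1 :> R by rewrite ler_pdivrMr; lra.
have q2 : 4 / pi ^+ 2 * r ^+ 2 <= r ^+ 2 by rewrite ler_piMl// sqr_ge0.
have : (grid_extent R p g)%:R <= 4 / pi ^+ 2 * r ^+ 2 * g.+1%:R + 1.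
  rewrite -e /grid_extent; set x := _ + 1.
  have x0 : 0 <= x by rewrite addr_ge0// divr_ge0 ?mulr_ge0// ltW// mesh_gt0.
  by have /andP[] := truncn_itv x0.
rewrite /grid_size natrD natrM (natrX R (2 ^ p) 2) -[g.+1%:R]natr1.
move: (4 / pi ^+ 2 * r ^+ 2) q2 => z q2; lra.
Qed.

Definition grid_weight g : R := (grid_size R p g)%:R * 2 ^+ g.+1.

Lemma grid_weight_ge1 g : 1 <= grid_weight g.
Proof.
rewrite /grid_weight -natrX -natrM ler1n muln_gt0 expn_gt0 andbT.
exact: grid_size_gt0.
Qed.

Lemma grid_weight_le g : grid_weight g <= 2 ^+ (p.*2 + 3 + g.*2).
Proof.
have r1 : 1 <= r by rewrite ler1n expn_gt0.
have p4 : 4 <= pi ^+ 2 :> R by have := pi_ge2 R; nra.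
have q1 : 4 / pi ^+ 2 <= 1 :> R by rewrite ler_pdivrMr; lra.
have h1 : (grid_size R p g)%:R <= 4 * r ^+ 2 * 2 ^+ g.
  apply: (le_trans (grid_size_le g)).
  have g2 : g.+1%:R <= 2 ^+ g :> R by rewrite -natrX ler_nat ltn_expl.
  have h2 : 4 / pi ^+ 2 * r ^+ 2 * g%:R <= r ^+ 2 * g%:R.
    by rewrite ler_wpM2r// ler_piMl// sqr_ge0.
  have h3 : r ^+ 2 * (g%:R + 1) <= r ^+ 2 * 2 ^+ g by rewrite ler_wpM2l ?sqr_ge0// natr1.
  have h4 : 0 <= r ^+ 2 * g%:R by rewrite mulr_ge0// sqr_ge0.
  lra.
have -> : 2 ^+ (p.*2 + 3 + g.*2) = 4 * r ^+ 2 * 2 ^+ g * 2 ^+ g.+1 :> R.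
  rewrite natrX -exprM muln2 -[g.*2]addnn !exprD [2 ^+ g.+1]exprS; ring.
by rewrite /grid_weight ler_wpM2r// exprn_ge0.
Qed.

(* [grid_weight g] spreads the error budget as [2 ^- (g + 1)] over group [g]; the
   scale is the least one for which the group fits its share. *)
Definition tilt_scale L g : R :=
  Num.max 1 (6 * grid_weight g ^+ 2 * expR (1 + L - g%:R * group_gain R p)).

Lemma tilt_scale_ge1 L g : 1 <= tilt_scale L g.
Proof. by rewrite le_max lexx. Qed.

Lemma pow2_le_expR k : 2 ^+ k <= expR k%:R :> R.
Proof.
rewrite -[k%:R]mulr1 expRM_natl lerXn2r ?nnegrE ?expR_ge0//.
by have := expR_ge1Dx (1 : R); lra.
Qed.

Lemma tilt_scale_le L g : tilt_scale L g <=
  expR (Num.max 0 (L + grid_loss - (r - grid_loss) * g%:R)).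
Proof.
rewrite ge_max -{1}expR0 ler_expR le_max lexx/=.
apply: (@le_trans _ _ (expR (L + grid_loss - (r - grid_loss) * g%:R))); last first.
  by rewrite ler_expR le_max lexx orbT.
have w0 : 0 <= grid_weight g by rewrite (le_trans ler01)// grid_weight_ge1.
have h1 : grid_weight g ^+ 2 <= expR (p.*2 + 3 + g.*2)%:R ^+ 2.
  rewrite lerXn2r ?nnegrE ?expR_ge0//.
  by apply: (le_trans (grid_weight_le g)); exact: pow2_le_expR.
have h2 : 6 <= expR 3 :> R.
  by apply: (@le_trans _ _ (2 ^+ 3)); [lra|exact: (pow2_le_expR 3)].
apply: (@le_trans _ _ (expR 3 * expR (p.*2 + 3 + g.*2)%:R ^+ 2 * expR (1 + L - g%:R * group_gain R p))).
  by rewrite ler_wpM2r ?expR_ge0//; apply: ler_pM => //; exact: sqr_ge0.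
rewrite -expRM_natl -!expRD ler_expR /group_gain /grid_loss !natrD -!muln2 !natrM.
lra.
Qed.

Lemma sum_half_powers G : \sum_(g < G) (2 ^+ g.+1)^-1 <= 1 :> R.
Proof.
have -> : \sum_(g < G) (2 ^+ g.+1)^-1 = 1 - (2 ^+ G)^-1 :> R.
  elim: G => [|G IH]; first by rewrite big_ord0 expr0 invr1 subrr.
  rewrite big_ord_recr/= IH exprS.
  have : 2 ^+ G != 0 :> R by rewrite expf_neq0.
  by move: (2 ^+ G : R) => x x0; field.
by rewrite lerBlDr lerDl invr_ge0 exprn_ge0.
Qed.

Lemma sum_inv_weight_le G :
  \sum_(l < M G) (grid_weight (block_of (grid_size R p) l))^-1 <= 1.
Proof.
rewrite (@sum_blocks _ (@grid_size_gt0 R p) R (fun g _ => (grid_weight g)^-1)).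
apply: le_trans (sum_half_powers G); apply: ler_sum => g _.
rewrite sumr_const card_ord -[leLHS]mulr_natl /grid_weight invfM mulrA divff ?mul1r//.
by rewrite pnatr_eq0 -lt0n grid_size_gt0.
Qed.

Context (d : measure_display) (T : measurableType d).
Variables (P : probability T R) (B X : R -> {RV P >-> R}).
Hypotheses (BM : standard_brownian_motion B) (LX : continuous_laplace_process B X).

Lemma laplace_lower_cost L (k : nat) (t : nat -> R) :
  1 <= group_gain R p -> (forall j, 0 <= t j) -> exists G : nat,
  2^-1 * expR (- \sum_(g < G) (grid_size R p g)%:R *
                    Num.max 0 (L + grid_loss - (r - grid_loss) * g%:R)) <=
  fine (P [set w | forall j, (j < k)%N -> `|X (t j) w| <= expR (- L)]).
Proof.
move=> gain1 t0; have gain0 : 0 <= group_gain R p by lra.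
(* Makes [2 G - 2 L - 2 >= 32 k], so that [1 + x <= exp x] leaves all residuals within [rest_le].
   [G] grows with [k], but the cost is later bounded independently of [G]. *)
pose G := (Num.truncn `|L| + 16 * k + 2)%N; exists G.
have hG : `|L| + 16 * k%:R + 1 <= G%:R.
  rewrite /G (natrD _ _ 2) (natrD _ _ (16 * k)) (natrM _ 16 k).
  by have := truncnS_gt `|L|; rewrite -[_.+1%:R]natr1; lra.
have Labs := ler_norm L.
pose blk := block_of (grid_size R p).
(* The 1 subtracted here is the shift of exponents made in [laplace_dist_le]. *)
pose tau i : R := expR (flat_node R p i) - 1.
pose sg l := tilt_scale L (blk l).
pose w l := grid_weight (blk l).
pose rho l := expR (1 - (blk l)%:R * group_gain R p).
have sg1 l : 1 <= sg l by exact: tilt_scale_ge1.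
have sg0 l : 0 < sg l by exact: lt_le_trans ltr01 (sg1 l).
have w1 l : 1 <= w l by exact: grid_weight_ge1.
have w0 l : 0 < w l by exact: lt_le_trans ltr01 (w1 l).
have blkG : blk (M G) = G.
  by rewrite /blk -[M G]addn0 (block_ofE (@grid_size_gt0 R p))// grid_size_gt0.
have sgE l : 1 + (sg l ^+ 2 - 1) = sg l ^+ 2 by rewrite addrC subrK.
(* With [beta = 3 w / sg] and [1 + s = sg^2], the tail terms are [1 / (9 w^2) <= 1 / (8 w)], and
   [rho * beta <= delta / (2 w)] amounts to [sg >= 6 w^2 rho / delta], the lower bound built into
   [tilt_scale]. The [1 / w] sum to at most 1. *)
have := @laplace_small_ball_lower _ _ _ P B X BM LX (M G) k tau t rho
  (fun l => 3 * w l / sg l) (fun l => sg l ^+ 2 - 1) (expR (- L)).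
have -> : \prod_(l < M G) (Num.sqrt (1 + (sg l ^+ 2 - 1)))^-1 =
    expR (- \sum_(g < G) (grid_size R p g)%:R * ln (tilt_scale L g)).
  have -> : \sum_(g < G) (grid_size R p g)%:R * ln (tilt_scale L g) = \sum_(l < M G) ln (sg l).
    rewrite (@sum_blocks _ (@grid_size_gt0 R p) R (fun g _ => ln (tilt_scale L g))).
    by apply: eq_bigr => g _; rewrite sumr_const card_ord mulr_natl.
  rewrite -sumrN expR_sum; apply: eq_bigr => l _.
  by rewrite sgE sqrtr_sqr gtr0_norm// expRN lnK ?posrE.
move=> main; apply: le_trans (main _ _ t0 (expR_gt0 _) _ _ _ _ _ _ _).
- rewrite ler_wpM2l// ler_expR lerN2; apply: ler_sum => g _; rewrite ler_wpM2l//.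
  rewrite -[leRHS]expRK ler_ln ?posrE ?expR_gt0//; last exact: lt_le_trans ltr01 (tilt_scale_ge1 L g).
  exact: tilt_scale_le.
- move=> i; rewrite /tau subr_ge0 -expR0 ler_expR; exact: grid_node_ge0.
- move=> i j /andP[ij _]; rewrite /tau (inj_eq (addIr _)) (inj_eq (@expR_inj R)).
  by rewrite (inj_eq (@flat_node_inj R p)) ltn_eqF.
- by move=> l; exact: expR_ge0.
- by move=> l; rewrite divr_gt0// mulr_gt0.
- by move=> l; rewrite subr_ge0 -[leLHS](expr1n _ 2) lerXn2r ?nnegrE// ltW.
- move=> j l jk ln; have t1 : 0 < t j + 1 by have := t0 j; lra.
  have -> : (fun i => tau i + 1) = expR \o flat_node R p.
    by apply/funext => i; rewrite /tau subrK.
  rewrite -[t j + 1]lnK ?posrE//.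
  have [g [i [ig e]]] := block_decomp (@grid_size_gt0 R p) l.
  rewrite /rho /blk {2}e (block_ofE (@grid_size_gt0 R p))// e.
  apply: flat_dist_le => //; apply: ln_ge0; have := t0 j; lra.
- apply: (@le_trans _ _ (\sum_(l < M G) (1 / 8) * (w l)^-1)).
    apply: ler_sum => l _; rewrite sgE.
    have -> : (3 * w l / sg l) ^+ 2 * sg l ^+ 2 = 9 * w l ^+ 2 by field; rewrite gt_eqF.
    rewrite mul1r -invfM; have := w1 l; have := w0 l; move: (w l) => v v0 v1.
    by rewrite lef_pV2 ?posrE ?mulr_gt0 ?exprn_gt0//; nra.
  by rewrite -mulr_sumr ler_piMr// sum_inv_weight_le.
- apply: (@le_trans _ _ (\sum_(l < M G) expR (- L) / 2 * (w l)^-1)); last first.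
    rewrite -mulr_sumr ler_piMr ?sum_inv_weight_le// divr_ge0// expR_ge0//.
  apply: ler_sum => l _.
  have h : 6 * w l ^+ 2 * expR (1 + L - (blk l)%:R * group_gain R p) <= sg l.
    by rewrite /sg /tilt_scale le_max lexx orbT.
  have e : expR (1 + L - (blk l)%:R * group_gain R p) = rho l / expR (- L).
    by rewrite -expRN opprK /rho -expRD; congr expR; ring.
  rewrite e in h; have d0 := expR_gt0 (- L); have wl := w0 l; have sl := sg0 l.
  move: (expR (- L)) (rho l) (w l) (sg l) d0 wl sl h => dl rh ww ss d0 wl sl h.
  rewrite mulrA ler_pdivrMr// mulrAC ler_pdivlMr//.
  move: h; rewrite mulrA ler_pdivrMr//; lra.
- rewrite /rho blkG ler_pdivrMr ?exprn_gt0 ?expR_gt0// -!expRM_natl.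
  have e : expR (2 * (1 - G%:R * group_gain R p)) * (32 * k%:R) <= expR (2 * - L).
    rewrite -ler_pdivlMl ?expR_gt0// -expRN -expRD.
    apply: le_trans (expR_ge1Dx _).
    have : G%:R <= G%:R * group_gain R p by rewrite ler_peMr.
    lra.
  lra.
Qed.

End lower_cost.

Section lower_error.
Context (R : realType).

Definition error_const (K : R) : R :=
  K * (K + 1) ^+ 3 + 6 * (K * (K + 1) ^+ 2) + 4 * (K ^+ 2 * (K + 1)) + 2.

(** Here [S = sqrt (L l)] is the balance point: [q <= K l] and [r >= S] make [q L / r] at most
    [K S], while [r <= K S] makes [r L^2] at most [K S L^2]. All the other terms are compared with
    these two. *)
Lemma lower_error (K L l S r q k : R) :
  0 <= K -> 1 <= L -> 0 <= l <= S -> 1 / 2 <= S <= L -> S ^+ 2 = L * l ->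
  0 <= q <= K * l -> 2 * q <= r -> S <= r <= K * S -> 0 <= k <= 1 / 6 ->
  6 * k * (r / (r - q)) ^+ 2 * ((L + q) ^+ 3 / 6 + (r - q) * (L + q) ^+ 2 / 8) +
  4 * r ^+ 2 * (L + q + (L + q) ^+ 2 / (2 * (r - q))) + 1 <=
  k * L ^+ 3 + error_const K * (S * L ^+ 2).
Proof.
move=> K0 L1 /andP[l0 lS] /andP[S1 SL] SE /andP[q0 qK] qr /andP[Sr rK] /andP[k0 k1].
set h := r - q; set A := L + q.
have r0 : 0 < r by lra.
have h0 : 0 < h by rewrite /h; lra.
have L0 : 0 <= L by lra.
have S0 : 0 <= S by lra.
have A0 : 0 <= A by rewrite /A; lra.
have lL : l <= L by lra.
have AK : A <= (K + 1) * L.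
  by rewrite /A; have := ler_wpM2l K0 lL; lra.
have KL0 : 0 <= (K + 1) * L by rewrite mulr_ge0//; lra.
have A2 : A ^+ 2 <= (K + 1) ^+ 2 * L ^+ 2.
  by rewrite -exprMn lerXn2r ?nnegrE.
have A3 : A ^+ 3 <= (K + 1) ^+ 3 * L ^+ 3.
  by rewrite -exprMn lerXn2r ?nnegrE.
have A20 : 0 <= A ^+ 2 by exact: sqr_ge0.
have A30 : 0 <= A ^+ 3 by exact: exprn_ge0.
have rh : r / h <= 2 by rewrite ler_pdivrMr// /h; lra.
have rh0 : 0 <= r / h by rewrite divr_ge0// ltW.
(* Applied to [z = q / r], this gives [(r / (r - q))^2 <= 1 + 6 q / r]. *)
have key (z : R) : 0 <= z -> z <= 1 / 2 -> 1 <= (1 + 6 * z) * (1 - z) ^+ 2.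
  clear=> z0 z1; have : 0 <= z * ((1 / 2 - z) * (8 - 6 * z)) by rewrite !mulr_ge0//; lra.
  lra.
pose x := q / r.
have x0 : 0 <= x by rewrite divr_ge0// ltW.
have x1 : x <= 1 / 2 by rewrite /x ler_pdivrMr//; lra.
have hx : h = r * (1 - x) by rewrite /h /x; field; rewrite gt_eqF.
have rh2 : (r / h) ^+ 2 <= 1 + 6 * x.
  rewrite hx (_ : r / (r * (1 - x)) = (1 - x)^-1); last first.
    by field; rewrite (gt_eqF r0) andbT gt_eqF//; lra.
  rewrite exprVn -[leLHS]mul1r ler_pdivrMr; last by rewrite exprn_gt0//; lra.
  exact: key.
have xS : x * L <= K * S.
  rewrite /x mulrAC ler_pdivrMr//.
  have h1 : q * L <= K * l * L by rewrite ler_wpM2r.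
  have h2 : K * S * S <= K * S * r by rewrite ler_wpM2l// mulr_ge0.
  have h3 : K * S * S = K * (L * l) by rewrite -SE; ring.
  lra.
set a := S * L ^+ 2.
have a0 : 0 <= a by rewrite mulr_ge0 ?sqr_ge0.
have t1 : k * (6 * x * A ^+ 3) <= K * (K + 1) ^+ 3 * a.
  have h1 : x * A ^+ 3 <= x * ((K + 1) ^+ 3 * L ^+ 3) by rewrite ler_wpM2l.
  have h2 : x * L * ((K + 1) ^+ 3 * L ^+ 2) <= K * S * ((K + 1) ^+ 3 * L ^+ 2).
    by rewrite ler_wpM2r// mulr_ge0 ?sqr_ge0 ?exprn_ge0//; clear -K0; lra.
  have h3 : 0 <= x * A ^+ 3 by exact: mulr_ge0.
  have h4 : k * (6 * x * A ^+ 3) <= 1 / 6 * (6 * x * A ^+ 3).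
    by rewrite ler_wpM2r// -mulrA mulr_ge0.
  have e1 : K * (K + 1) ^+ 3 * a = K * S * ((K + 1) ^+ 3 * L ^+ 2) by rewrite /a; ring.
  have e2 : x * ((K + 1) ^+ 3 * L ^+ 3) = x * L * ((K + 1) ^+ 3 * L ^+ 2) by ring.
  rewrite e1; rewrite e2 in h1; clear -h1 h2 h4; lra.
have qS : q * A ^+ 2 <= K * (K + 1) ^+ 2 * a.
  have h1 : q <= K * S by apply: (le_trans qK); rewrite ler_wpM2l.
  have e1 : K * (K + 1) ^+ 2 * a = K * S * ((K + 1) ^+ 2 * L ^+ 2) by rewrite /a; ring.
  by rewrite e1; apply: ler_pM.
have t2 : k * A ^+ 3 <= k * L ^+ 3 + K * (K + 1) ^+ 2 * a / 2.
  have h1 : A ^+ 3 <= L ^+ 3 + 3 * (q * A ^+ 2).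
    have : 0 <= q ^+ 2 * (3 * L + 2 * q) by rewrite mulr_ge0 ?sqr_ge0//; lra.
    by rewrite /A; lra.
  have h2 := ler_wpM2l k0 h1.
  have h3 : k * (q * A ^+ 2) <= 1 / 6 * (q * A ^+ 2) by rewrite ler_wpM2r// mulr_ge0.
  lra.
have rA : r * A ^+ 2 <= K * (K + 1) ^+ 2 * a.
  have e1 : K * (K + 1) ^+ 2 * a = K * S * ((K + 1) ^+ 2 * L ^+ 2) by rewrite /a; ring.
  by rewrite e1; apply: ler_pM => //; lra.
have t3 : 6 * k * ((r / h) ^+ 2 * (h * A ^+ 2 / 8)) <= K * (K + 1) ^+ 2 * a / 4.
  have e : (r / h) ^+ 2 * (h * A ^+ 2 / 8) = r / h * (r * A ^+ 2) / 8.
    by field; rewrite gt_eqF.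
  have rA0 : 0 <= r * A ^+ 2 by rewrite mulr_ge0// ltW.
  have h1 : r / h * (r * A ^+ 2) <= 2 * (r * A ^+ 2) by rewrite ler_wpM2r.
  have h2 : 0 <= r / h * (r * A ^+ 2) by exact: mulr_ge0.
  have h3 : 6 * k * (r / h * (r * A ^+ 2)) <= 1 * (r / h * (r * A ^+ 2)).
    by rewrite ler_wpM2r//; clear -k1; lra.
  rewrite e; clear -h1 h3 rA; lra.
have t4 : r ^+ 2 * A <= K ^+ 2 * (K + 1) * a.
  have h1 : r ^+ 2 <= K ^+ 2 * S ^+ 2.
    by rewrite -exprMn lerXn2r ?nnegrE// ?(ltW r0)// mulr_ge0.
  have h2 : r ^+ 2 * A <= K ^+ 2 * S ^+ 2 * ((K + 1) * L) by apply: ler_pM => //; exact: sqr_ge0.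
  have h3 : K ^+ 2 * (K + 1) * (S * L) * S <= K ^+ 2 * (K + 1) * (S * L) * L.
    by rewrite ler_wpM2l// !mulr_ge0 ?sqr_ge0//; clear -K0; lra.
  have e1 : K ^+ 2 * (K + 1) * a = K ^+ 2 * (K + 1) * (S * L) * L by rewrite /a; ring.
  rewrite e1; clear -h2 h3; lra.
have t5 : r ^+ 2 * (A ^+ 2 / (2 * h)) <= K * (K + 1) ^+ 2 * a.
  have e : r ^+ 2 * (A ^+ 2 / (2 * h)) = r / h * (r * A ^+ 2) / 2.
    by field; rewrite gt_eqF.
  have rA0 : 0 <= r * A ^+ 2 by rewrite mulr_ge0// ltW.
  have h1 : r / h * (r * A ^+ 2) <= 2 * (r * A ^+ 2) by rewrite ler_wpM2r.
  rewrite e; clear -h1 rA; lra.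
have t6 : 1 <= 2 * a.
  have L21 : 1 <= L ^+ 2 by rewrite -[X in X <= _](expr1n R 2) lerXn2r ?nnegrE.
  by rewrite /a; clear -L21 S1; nra.
have t7 : k * (r / h) ^+ 2 * A ^+ 3 <= k * A ^+ 3 + k * (6 * x * A ^+ 3).
  have h1 : (r / h) ^+ 2 * A ^+ 3 <= (1 + 6 * x) * A ^+ 3 by rewrite ler_wpM2r.
  have h2 := ler_wpM2l k0 h1; clear -h2; lra.
have KKa : 0 <= K * (K + 1) ^+ 2 * a by apply: le_trans qS; exact: mulr_ge0.
clearbody a.
have e : 6 * k * (r / h) ^+ 2 * (A ^+ 3 / 6 + h * A ^+ 2 / 8) + 4 * r ^+ 2 * (A + A ^+ 2 / (2 * h)) + 1 =
   k * (r / h) ^+ 2 * A ^+ 3 + 6 * k * ((r / h) ^+ 2 * (h * A ^+ 2 / 8)) +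
   4 * (r ^+ 2 * A) + 4 * (r ^+ 2 * (A ^+ 2 / (2 * h))) + 1.
  by move: (r / h) (A ^+ 2 / (2 * h)) => u v; field.
rewrite e /error_const.
move: (K * (K + 1) ^+ 3) (K * (K + 1) ^+ 2) (K ^+ 2 * (K + 1)) t1 qS t2 rA t3 t4 t5 KKa => c1 c2 c3.
move: (k * (r / h) ^+ 2 * A ^+ 3) (6 * k * ((r / h) ^+ 2 * (h * A ^+ 2 / 8))) (r ^+ 2 * A) (r ^+ 2 * (A ^+ 2 / (2 * h))) t7.
move=> u1 u2 u3 u4; lra.
Qed.

(** [7 <= p] makes [grid_loss] at most half of [r]. If [p = 7], then [128 <= 256 S] because
    [S >= 1 / 2]; otherwise minimality gives [2^p < 2 S]. *)
Lemma dyadic_scale (S : R) : 1 / 2 <= S -> exists p : nat,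
  [/\ (7 <= p)%N, S <= (2 ^ p)%:R & (2 ^ p)%:R <= 256 * S].
Proof.
move=> S1.
have ex : exists p, (7 <= p)%N && (S <= (2 ^ p)%:R).
  pose N := (Num.truncn S).+1; exists (N + 7)%N; rewrite leq_addl/=.
  apply: (@le_trans _ _ N%:R); first by rewrite ltW// truncnS_gt.
  by rewrite ler_nat (leq_trans (ltnW (ltn_expl N (ltnSn 1))))// leq_exp2l// leq_addr.
case: (ex_minnP ex) => p /andP[p7 Sp] pmin; exists p; split=> //.
have [p8|p8] := leqP p 7.
  have -> : p = 7%N by apply/eqP; rewrite eqn_leq p8 p7.
  rewrite natrX; lra.
have : ~~ ((7 <= p.-1)%N && (S <= (2 ^ p.-1)%:R)).
  by apply/negP => /pmin; lia.
rewrite negb_and -ltNge -ltnNge => /orP[|h]; first lia.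
have -> : (2 ^ p)%:R = 2 * (2 ^ p.-1)%:R :> R.
  by rewrite -(natrM _ 2) -expnS prednK//; lia.
lra.
Qed.

Lemma dyadic_large p : (7 <= p)%N -> 2 * (10 + 4 * p%:R) <= (2 ^ p)%:R :> R.
Proof.
move=> p7; have h : (2 * (10 + 4 * p) <= 2 ^ p)%N.
  rewrite -(subnKC p7); elim: (p - 7)%N => // k IH.
  by rewrite addnS expnS; lia.
by move: h; rewrite -(ler_nat R) natrM natrD natrM.
Qed.

End lower_error.

Section laplace_lower.
Context (d : measure_display) (T : measurableType d) (R : realType).
Variables (P : probability T R) (B X : R -> {RV P >-> R}).
Hypotheses (BM : standard_brownian_motion B) (LX : continuous_laplace_process B X).

(** The bound does not depend on [G]. Its leading coefficient [4 / pi^2] is 6 times [2 / (3 pi^2)],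
    and the 6 cancels the [A^3 / 6] of the weighted sum. *)
Lemma grid_cost_le (p : nat) (L q r : R) G : 0 <= L ->
  q = grid_loss R p -> r = (2 ^ p)%:R -> q < r ->
  \sum_(g < G) (grid_size R p g)%:R * Num.max 0 (L + q - (r - q) * g%:R) <=
  6 * (2 / (3 * pi ^+ 2)) * (r / (r - q)) ^+ 2 * ((L + q) ^+ 3 / 6 + (r - q) * (L + q) ^+ 2 / 8) +
  4 * r ^+ 2 * (L + q + (L + q) ^+ 2 / (2 * (r - q))).
Proof.
move=> L0 qE rE qr.
have q0 : 0 <= q by rewrite qE /grid_loss addr_ge0// mulr_ge0.
have A0 : 0 <= L + q by rewrite addr_ge0.
have h0 : 0 < r - q by rewrite subr_gt0.
have pi0 := pi_gt0 R.
have h1 := sum_pos_part_le A0 h0 G; have h2 := sum_weighted_pos_part_le A0 h0 G.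
set f := fun g : nat => Num.max 0 (L + q - (r - q) * g%:R) in h1 h2 *.
have f0 g : 0 <= f g by rewrite /f le_max lexx.
apply: (@le_trans _ _ (\sum_(g < G) (4 / pi ^+ 2 * r ^+ 2 * g%:R + 4 * r ^+ 2) * f g)).
  apply: ler_sum => g _; rewrite -/(f g); apply: ler_wpM2r => //.
  by rewrite rE grid_size_le.
have -> : \sum_(g < G) (4 / pi ^+ 2 * r ^+ 2 * g%:R + 4 * r ^+ 2) * f g =
    4 / pi ^+ 2 * r ^+ 2 * (\sum_(g < G) g%:R * f g) + 4 * r ^+ 2 * (\sum_(g < G) f g).
  by rewrite !mulr_sumr -big_split/=; apply: eq_bigr => g _; ring.
apply: lerD; last by rewrite ler_wpM2l// mulr_ge0// sqr_ge0.
have h3 : \sum_(g < G) g%:R * f g <= ((L + q) ^+ 3 / 6 + (r - q) * (L + q) ^+ 2 / 8) / (r - q) ^+ 2.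
  by rewrite ler_pdivlMr ?exprn_gt0// mulrC.
have c0 : 0 <= 4 / pi ^+ 2 * r ^+ 2 by rewrite mulr_ge0 ?sqr_ge0// divr_ge0// sqr_ge0.
apply: (le_trans (ler_wpM2l c0 h3)).
rewrite le_eqVlt; apply/orP; left; apply/eqP.
move: h0 pi0; move: (r - q) (pi : R) => h y h0 y0.
by field; rewrite !gt_eqF.
Qed.

Lemma laplace_lower (L : R) (k : nat) (t : nat -> R) : 4 / 3 <= L -> (forall j, 0 <= t j) ->
  expR (- (2 / (3 * pi ^+ 2)) * L ^+ 3 - error_const 256 * (L ^+ 2 * Num.sqrt (L * ln L))) <=
  fine (P [set w | forall j, (j < k)%N -> `|X (t j) w| <= expR (- L)]).
Proof.
move=> hL t0; have l1 := ln_ge_quarter hL; set l := ln L in l1 *.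
have L0 : 0 < L by lra.
have lL : l <= L by exact: ln_le_self.
have p4 : 4 <= pi ^+ 2 :> R by have := pi_ge2 R; nra.
set S := Num.sqrt (L * l).
have S0 : 0 <= S by exact: sqrtr_ge0.
have SE : S ^+ 2 = L * l by rewrite sqr_sqrtr// mulr_ge0//; lra.
have SL : S <= L by rewrite -ler_sqr ?nnegrE// ?SE; [rewrite expr2 ler_wpM2l|]; lra.
have lS : l <= S by rewrite -ler_sqr ?nnegrE// ?SE; [rewrite expr2 ler_wpM2r|]; lra.
have S1 : 1 / 2 <= S by rewrite -ler_sqr ?nnegrE// ?SE; nra.
have [p [p7 Sr rS]] := dyadic_scale S1.
have qr := dyadic_large R p7.
set r : R := (2 ^ p)%:R in Sr rS qr.
have p0 : 0 <= p%:R :> R by [].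
have p7R : 7 <= p%:R :> R by rewrite (ler_nat R 7).
have qE : grid_loss R p = 10 + 4 * p%:R by [].
have qr' : grid_loss R p < r by rewrite qE; lra.
have gain : 1 <= group_gain R p by rewrite /group_gain -/r; lra.
have ln2 : 2 / 3 <= ln (2 : R).
  have := ln4_ge R; have -> : ln (4 : R) = 2 * ln 2 by rewrite mulr_natl -lnXn// -natrX.
  lra.
have ln2' : ln (2 : R) <= 1.
  by have := expR_ge1Dx (ln (2 : R)); rewrite lnK ?posrE//; lra.
(* Logarithms of [r <= 256 S <= 2^8 L]: the loss, linear in [p], is O(log L), and 256 serves as [K]
   for both [r] and [q]. *)
have pl : p%:R * ln 2 <= 8 * ln 2 + l.
  have h : ln r <= ln (2 ^+ 8 * L).
    rewrite ler_ln ?posrE ?mulr_gt0 ?exprn_gt0//; last by rewrite /r ltr0n expn_gt0.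
    by apply: (le_trans rS); lra.
  move: h; rewrite lnM ?posrE ?exprn_gt0// /r natrX !lnXn// -[ln 2 *+ p]mulr_natl -[ln 2 *+ 8]mulr_natl.
  by rewrite -/l; lra.
have qK : grid_loss R p <= 256 * l.
  have : (p%:R - 8) * (2 / 3) <= l.
    have [h|h] := leP (8 : R) p%:R; last by nra.
    have : (p%:R - 8) * (2 / 3) <= (p%:R - 8) * ln (2 : R) by apply: ler_wpM2l => //; lra.
    lra.
  by rewrite qE; lra.
have k01 : 0 <= (2 / (3 * pi ^+ 2) : R) <= 1 / 6.
  by apply/andP; split; [rewrite divr_ge0//|rewrite ler_pdivrMr]; lra.
(* The prefactor 1/2 costs at most 1 in the exponent, the [+ 1] of [lower_error]. *)
have e2 : expR (-1) <= 2^-1 :> R.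
  by rewrite expRN lef_pV2 ?posrE ?expR_gt0//; have := expR_ge1Dx (1 : R); lra.
have q0 : 0 <= grid_loss R p by rewrite qE; lra.
have L1 : 1 <= L by lra.
have l0 : 0 <= l by lra.
have [G hG] := laplace_lower_cost BM LX L k gain t0.
apply: le_trans hG.
have := grid_cost_le G (ltW L0) erefl erefl qr'; rewrite -/r.
set c := \sum_(g < G) _ => cost.
have err := @lower_error R 256 L l S r (grid_loss R p) (2 / (3 * pi ^+ 2)).
have {}err := err (ler0n R 256).
apply: (@le_trans _ _ (expR (-1) * expR (- c))); last by rewrite ler_wpM2r ?expR_ge0.
rewrite -expRD ler_expR.
have := err; rewrite [L ^+ 2 * S]mulrC q0 qK S1 SL lS k01 Sr rS.
have -> : 2 * grid_loss R p <= r by rewrite qE.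
rewrite SE L1 l0 => /(_ isT isT isT erefl isT isT isT isT).
clearbody c; move: (error_const 256 * _) cost => ec h1 h2; lra.
Qed.

End laplace_lower.

(** * Reduction of the supremum to countably many times *)

Section small_ball_event.
Context (R : realType).

Definition dense_time (j : nat) : R :=
  if unpickle j is Some q then `|ratr q| else 0.

Lemma dense_time_ge0 j : 0 <= dense_time j.
Proof. by rewrite /dense_time; case: unpickle. Qed.

Lemma dense_time_itv (a b : R) : 0 <= a -> a < b -> exists j, a < dense_time j < b.
Proof.
move=> a0 ab; have [q] := rat_in_itvoo ab; rewrite in_itv/= => /andP[aq qb].
exists (pickle q); rewrite /dense_time pickleK ger0_norm ?aq//.
by rewrite (le_trans a0)// ltW.
Qed.

(** A strict excess at [t] persists just to the right of [t], the side that is available at 0 as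
    well, and a dense time lies there. *)
Lemma sup_norm_le_dense (f : R -> R) (delta : R) :
  {within `[0, +oo[, continuous f} ->
  (ereal_sup [set `|f t|%:E | t in `[0%R, +oo[] <= delta%:E)%E <->
  (forall j, `|f (dense_time j)| <= delta).
Proof.
move=> cf; split => [h j|h].
  rewrite -lee_fin; apply: le_trans h; apply: ereal_sup_ubound.
  exists (dense_time j) => //; rewrite /= in_itv/= andbT; exact: dense_time_ge0.
apply: ge_ereal_sup => z [t /=]; rewrite in_itv/= andbT => t0 <-; rewrite lee_fin leNgt.
apply/negP => ht.
have ct : f x @[x --> t^'+] --> f t.
  have [c1 c2] := (continuous_within_itvcyP 0 f).1 cf.
  move: t0; rewrite le_eqVlt => /predU1P[<-//|t0].
  by apply: cvg_at_right_filter; apply: c1; rewrite in_itv/= t0.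
have : \forall x \near t^'+, delta < `|f x|.
  by apply: (cvgr_gt (`|f t|)) => //; exact: cvg_norm.
move=> /nbhs_ballP[e /= e0 he].
have te : t < t + e by rewrite ltrDl.
have [j /andP[tj je]] := dense_time_itv t0 te.
have := he (dense_time j); rewrite /ball/= => /(_ _ tj).
rewrite ltr_norml => hj.
have : delta < `|f (dense_time j)| by apply: hj; apply/andP; split; lra.
by rewrite ltNge h.
Qed.

End small_ball_event.

Section small_ball_probability.
Context (d : measure_display) (T : measurableType d) (R : realType).
Variables (P : probability T R) (X : R -> {RV P >-> R}) (delta : R).
Hypothesis X_path : forall w, {within `[0, +oo[, continuous (fun t : R => X t w)}.

Let measurable_times (I : set nat) (t : nat -> R) :
  measurable [set w | forall j, I j -> `|X (t j) w| <= delta].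
Proof. by apply: (measurable_norm_le I delta (Y := fun j => X (t j))). Qed.

Let E := [set w | (ereal_sup [set `|X t w|%:E | t in `[0%R, +oo[] <= delta%:E)%E].

Let EE : E = [set w | forall j, setT j -> `|X (dense_time R j) w| <= delta].
Proof.
apply/seteqP; split => w /=.
  by move=> /(sup_norm_le_dense delta (@X_path w)) h j _; exact: h.
by move=> h; apply/(sup_norm_le_dense delta (@X_path w)) => j; exact: h.
Qed.

Lemma measurable_small_ball : measurable E.
Proof. by rewrite EE; exact: measurable_times. Qed.

Lemma small_ball_prob_le N (a : nat -> R) : (forall i, 0 <= a i) ->
  fine (small_ball_prob X delta) <=
  fine (P [set w | forall i, (i < N)%N -> `|X (a i) w| <= delta]).
Proof.
move=> a0; rewrite /small_ball_prob -/E; apply: fine_le.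
- exact: fin_num_measure measurable_small_ball.
- exact: fin_num_measure (@measurable_times [set i | (i < N)%N] a).
apply: le_measure; rewrite ?inE.
- exact: measurable_small_ball.
- exact: (@measurable_times [set i | (i < N)%N] a).
move=> w Ew i _; rewrite -lee_fin; apply: le_trans Ew; apply: ereal_sup_ubound.
by exists (a i) => //; rewrite /= in_itv/= andbT.
Qed.

(** Continuity from above along the first [k] dense times; it matters that [b] does not depend on
    [k]. *)
Lemma small_ball_prob_ge (b : R) :
  (forall k, b <= fine (P [set w | forall j, (j < k)%N -> `|X (dense_time R j) w| <= delta])) ->
  b <= fine (small_ball_prob X delta).
Proof.
move=> hb; pose F k := [set w | forall j, (j < k)%N -> `|X (dense_time R j) w| <= delta].
have mF k : measurable (F k) by exact: (@measurable_times [set j | (j < k)%N] (dense_time R)).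
have EF : E = \bigcap_k F k.
  rewrite EE; apply/seteqP; split => w /= h.
    by move=> k _ j _; exact: h.
  by move=> j _; exact: (h j.+1 I j (ltnSn j)).
have mEF : measurable (\bigcap_k F k) by rewrite -EF; exact: measurable_small_ball.
have homF : {homo F : m n / (m <= n)%N >-> (n <= m)%O}.
  move=> m n mn; apply/subsetPset => w h j jm; apply: h; exact: leq_trans mn.
have F0 : (P (F 0%N) < +oo)%E by rewrite (le_lt_trans (probability_le1 P (mF 0%N)))// ltry.
have cv := nonincreasing_cvg_mu F0 mF mEF homF.
rewrite /small_ball_prob -/E EF -lee_fin fineK; last exact: fin_num_measure mEF.
rewrite -(cvg_lim _ cv)//; apply: lime_ge; first by apply/cvg_ex; exists (P (\bigcap_k F k)).
apply: nearW => k /=; rewrite -[leRHS]fineK ?lee_fin; first exact: hb.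
exact: fin_num_measure (mF k).
Qed.

End small_ball_probability.

Theorem theorem2p7 (R : realType) :
  exists C : R,
    forall (d : measure_display) (T : measurableType d) (P : probability T R)
      (B X : R -> {RV P >-> R}),
    standard_brownian_motion B ->
    continuous_laplace_process B X ->
    forall delta : R, 0 < delta < 1 / 4 ->
      (`| lne (small_ball_prob X delta)
          - (- (2 / (3 * pi ^+ 2)) * ln (1 / delta) ^+ 3)%:E |
       <= (C * (ln (1 / delta) `^ (5 / 2)
                * Num.sqrt (ln (ln (1 / delta)))))%:E)%E.
Proof.
exists (error_const 256 + 50) => d T P B X BM LX delta /andP[delta0 delta1].
set L := ln (1 / delta).
have deltaE : delta = expR (- L) by rewrite /L div1r lnV ?posrE// opprK lnK ?posrE.
have hL : 4 / 3 <= L.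
  apply: le_trans (ln4_ge R) _; rewrite ler_ln ?posrE ?divr_gt0//.
  by rewrite ler_pdivlMr//; lra.
have L0 : 0 < L by lra.
have l0 := ln_ge_quarter hL; have lL := ln_le_self L0.
set l := ln L in l0 lL *.
set S := Num.sqrt (L * l).
have S0 : 0 <= S by exact: sqrtr_ge0.
(* By this inequality the error [L^2 log L] of the upper bound is dominated by that of the lower
   bound. *)
have lS : l <= S.
  rewrite -ler_sqr ?nnegrE//; last by lra.
  by rewrite sqr_sqrtr ?mulr_ge0//; [rewrite expr2 ler_wpM2r|..]; lra.
have -> : L `^ (5 / 2) * Num.sqrt l = L ^+ 2 * S.
  have -> : 5 / 2 = 2%:R + 2^-1 :> R by field.
  rewrite powRD; last by apply/implyP => _; rewrite gt_eqF.
  by rewrite powR_mulrn ?(ltW L0)// powR12_sqrt ?(ltW L0)// -mulrA -sqrtrM ?(ltW L0).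
set c := 2 / (3 * pi ^+ 2).
have path := LX.2.
have [N [a [a0 hup]]] := laplace_upper BM LX hL.
have up : fine (small_ball_prob X delta) <= expR (- c * L ^+ 3 + 50 * (L ^+ 2 * l)).
  by apply: (le_trans (small_ball_prob_le delta path N a0)); rewrite deltaE.
have low : expR (- c * L ^+ 3 - error_const 256 * (L ^+ 2 * S)) <= fine (small_ball_prob X delta).
  apply: small_ball_prob_ge => // k; rewrite deltaE.
  exact: (laplace_lower BM LX k hL (@dense_time_ge0 R)).
have fin : small_ball_prob X delta \is a fin_num.
  exact: fin_num_measure (measurable_small_ball delta path).
rewrite -(fineK fin); move: (fine _) up low => x up low.
have x0 : 0 < x by exact: lt_le_trans (expR_gt0 _) low.
rewrite lne_EFin// -EFinB abse_EFin lee_fin.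
have up' : ln x <= - c * L ^+ 3 + 50 * (L ^+ 2 * l).
  by rewrite -[leRHS]expRK ler_ln ?posrE ?expR_gt0.
have low' : - c * L ^+ 3 - error_const 256 * (L ^+ 2 * S) <= ln x.
  by rewrite -[leLHS]expRK ler_ln ?posrE ?expR_gt0.
have h1 : 0 <= L ^+ 2 * S by rewrite mulr_ge0// sqr_ge0.
have h2 : L ^+ 2 * l <= L ^+ 2 * S by rewrite ler_wpM2l// sqr_ge0.
have h3 : 0 <= error_const (256 : R) * (L ^+ 2 * S).
  by rewrite mulr_ge0// /error_const !addr_ge0// !mulr_ge0 ?exprn_ge0// addr_ge0.
rewrite ler_norml mulrDl.
move: h1 h2 h3 up' low'.
move: (error_const _) (L ^+ 2 * S) (L ^+ 2 * l) (- c * L ^+ 3) (ln x) => e u v y z h1 h2 h3 up' low'.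
by apply/andP; split; lra.
Qed.
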